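(* ($\mathbf{ZF}$) (a) For every non-empty set $I$ and every family $\{\langle X_i,\tau_i\rangle: i\in I\}$ of denumerable metrizable compact spaces, the family $\{X_i:i\in I\}$ has a multiple choice function. (b) For a non-zero von Neumann ordinal $\alpha$, let $\{\mathbf{X}_\gamma:\gamma\in\alpha\}$ be a family of pairwise disjoint non-empty countable, compact metrizable spaces. Then the direct sum $\mathbf{X}=\bigoplus_{\gamma\in\alpha}\mathbf{X}_\gamma$ is weakly Loeb. (c) The following conditions are all equivalent: (i) $\mathbf{WOAC}_{fin}$; (ii) for every well-orderable set $S$ and every family $\{\langle X_s,d_s\rangle:s\in S\}$ of scattered totally bounded metric spaces, the union $\bigcup_{s\in S}X_s$ is well-orderable; (iii) for every well-orderable non-empty set $S$ and every family $\{\langle X_s,d_s\rangle:s\in S\}$ of compact scattered metric spaces, the product $\prod_{s\in S}\langle X_s,\tau(d_s)\rangle$ is compact.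
   Context: The theorem is in $\mathbf{ZF}$ (no axiom of choice). Denumerable means countably infinite. $\mathbf{WOAC}_{fin}$: every well-orderable non-empty family of non-empty finite sets has a choice function. A multiple choice function of a family $\{X_j:j\in J\}$ is a function assigning to each $j\in J$ a non-empty finite subset of $X_j$. A topological space is weakly Loeb if the family of all its non-empty closed subsets has a multiple choice function. $\tau(d)$ is the topology induced by a metric $d$; products carry the Tychonoff product topology; the direct sum is the disjoint topological sum. A space is scattered if every non-empty subspace has an isolated point. A metric space is totally bounded if for every $\varepsilon>0$ it is covered by finitely many balls of radius $\varepsilon$. Compact means every open cover has a finite subcover. *)

(* Defs.v *)
(* "The theorem is in ZF" is rendered semantically: the statement is asserted in
   every model of first-order ZF, which by Goedel's completeness theorem is the
   same as provability in ZF.  Separation and Replacement are schemes over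
   first-order formulas with parameters.  They must not be strengthened to
   arbitrary Rocq predicates: choice in the metatheory would then make the
   axiom of choice hold inside the model.

   Every internal notion below quantifies only over elements of the model, so
   it is the unfolding of a first-order formula of set theory.  Since the
   language has no function symbols, functions are given by their graphs:
   [app f x y] reads "f(x) = y". *)

(* De Bruijn indices: index 0 is bound by the innermost quantifier. *)
Inductive formula : Type :=
| f_mem (i j : nat)
| f_eq (i j : nat)
| f_false
| f_and (p q : formula)
| f_or (p q : formula)
| f_imp (p q : formula)
| f_all (p : formula)
| f_ex (p : formula).

Definition scons {U : Type} (a : U) (e : nat -> U) (n : nat) : U :=
  match n with O => a | S m => e m end.

Fixpoint sat {U : Type} (E : U -> U -> Prop) (e : nat -> U) (p : formula) : Prop :=
  match p with
  | f_mem i j => E (e i) (e j)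
  | f_eq i j => e i = e j
  | f_false => False
  | f_and p q => sat E e p /\ sat E e q
  | f_or p q => sat E e p \/ sat E e q
  | f_imp p q => sat E e p -> sat E e q
  | f_all p => forall a, sat E (scons a e) p
  | f_ex p => exists a, sat E (scons a e) p
  end.

Record ZF_model : Type := {
  carrier :> Type;
  mem : carrier -> carrier -> Prop;
  zf_extensionality : forall x y, (forall z, mem z x <-> mem z y) -> x = y;
  zf_foundation : forall x, (exists y, mem y x) ->
    exists y, mem y x /\ ~ (exists z, mem z x /\ mem z y);
  zf_pairing : forall x y, exists p, forall z, mem z p <-> z = x \/ z = y;
  zf_union : forall x, exists u, forall z, mem z u <-> exists y, mem y x /\ mem z y;
  zf_power : forall x, exists p, forall y,
    mem y p <-> forall z, mem z y -> mem z x;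
  zf_infinity : exists w,
    (exists o, mem o w /\ forall z, ~ mem z o) /\
    (forall x, mem x w -> exists y, mem y w /\ forall z, mem z y <-> mem z x \/ z = x);
  zf_separation : forall (p : formula) (e : nat -> carrier) a,
    exists b, forall x, mem x b <-> mem x a /\ sat mem (scons x e) p;
  (* index 0 is the argument and index 1 the value of the class function *)
  zf_replacement : forall (p : formula) (e : nat -> carrier) a,
    (forall x y y', mem x a -> sat mem (scons x (scons y e)) p ->
       sat mem (scons x (scons y' e)) p -> y = y') ->
    exists b, forall y, mem y b <-> exists x, mem x a /\ sat mem (scons x (scons y e)) p
}.

Arguments mem {z} _ _ : rename.
Notation "x ∈ y" := (mem x y) (at level 70, no associativity).

Section SetTheory.
Context {V : ZF_model}.

Definition subset (a b : V) : Prop := forall x, x ∈ a -> x ∈ b.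
Notation "a ⊆ b" := (subset a b) (at level 70, no associativity).

Definition nonempty (a : V) : Prop := exists x, x ∈ a.
Definition empty (a : V) : Prop := forall x, ~ x ∈ a.
Definition disjoint (a b : V) : Prop := forall x, ~ (x ∈ a /\ x ∈ b).

Definition is_upair (a b p : V) : Prop := forall z, z ∈ p <-> z = a \/ z = b.

(* Kuratowski pair p = {{a}, {a, b}} *)
Definition is_pair (a b p : V) : Prop :=
  forall z, z ∈ p <-> is_upair a a z \/ is_upair a b z.

Definition is_union (A u : V) : Prop := forall z, z ∈ u <-> exists y, y ∈ A /\ z ∈ y.
Definition is_inter (a b c : V) : Prop := forall z, z ∈ c <-> z ∈ a /\ z ∈ b.
Definition is_diff (a b c : V) : Prop := forall z, z ∈ c <-> z ∈ a /\ ~ z ∈ b.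
Definition is_prod (a b P : V) : Prop :=
  forall p, p ∈ P <-> exists x y, x ∈ a /\ y ∈ b /\ is_pair x y p.

Definition app (f x y : V) : Prop := exists p, is_pair x y p /\ p ∈ f.

(* binary operations: f(x, y) = z *)
Definition app2 (f x y z : V) : Prop := exists p, is_pair x y p /\ app f p z.

(* F is a function with domain I, that is, a family indexed by I *)
Definition is_family (I F : V) : Prop :=
  (forall p, p ∈ F -> exists i y, i ∈ I /\ is_pair i y p) /\
  (forall i, i ∈ I -> exists! y, app F i y).

Definition is_map (A B f : V) : Prop :=
  is_family A f /\ forall x y, app f x y -> y ∈ B.

Definition is_binop (A B C f : V) : Prop :=
  exists P, is_prod A B P /\ is_map P C f.

Definition is_bijection (A B f : V) : Prop :=
  is_map A B f /\
  (forall x x' y, app f x y -> app f x' y -> x = x') /\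
  (forall y, y ∈ B -> exists x, app f x y).

Definition equipotent (A B : V) : Prop := exists f, is_bijection A B f.

Definition is_family_union (I X u : V) : Prop :=
  forall z, z ∈ u <-> exists i x, i ∈ I /\ app X i x /\ z ∈ x.

(* [lt] is instantiated with membership and with relations that are sets *)
Definition well_orders (lt : V -> V -> Prop) (A : V) : Prop :=
  (forall x, x ∈ A -> ~ lt x x) /\
  (forall x y z, x ∈ A -> y ∈ A -> z ∈ A -> lt x y -> lt y z -> lt x z) /\
  (forall x y, x ∈ A -> y ∈ A -> lt x y \/ x = y \/ lt y x) /\
  (forall S, S ⊆ A -> nonempty S ->
     exists m, m ∈ S /\ forall x, x ∈ S -> m = x \/ lt m x).

Definition rel (r x y : V) : Prop := exists p, is_pair x y p /\ p ∈ r.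

Definition well_orderable (A : V) : Prop := exists r, well_orders (rel r) A.

Definition is_ordinal (a : V) : Prop :=
  (forall x, x ∈ a -> x ⊆ a) /\ well_orders mem a.

Definition is_succ (x y : V) : Prop := forall z, z ∈ y <-> z ∈ x \/ z = x.

Definition inductive_set (w : V) : Prop :=
  (exists o, o ∈ w /\ empty o) /\
  (forall x, x ∈ w -> exists y, y ∈ w /\ is_succ x y).

Definition is_omega (w : V) : Prop :=
  inductive_set w /\ forall w', inductive_set w' -> w ⊆ w'.

(* "n ∈ w" is internal: in a non-standard model [finite] is not Rocq's finiteness *)
Definition finite (A : V) : Prop :=
  exists w n, is_omega w /\ n ∈ w /\ equipotent A n.

Definition denumerable (A : V) : Prop := exists w, is_omega w /\ equipotent A w.

Definition countable (A : V) : Prop := finite A \/ denumerable A.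

Definition is_choice_function (A f : V) : Prop :=
  is_family A f /\ forall x y, app f x y -> y ∈ x.

Definition WOAC_fin : Prop :=
  forall A : V, well_orderable A -> nonempty A ->
    (forall x, x ∈ A -> nonempty x /\ finite x) ->
    exists f, is_choice_function A f.

Definition is_multiple_choice_function (J X f : V) : Prop :=
  is_family J f /\
  forall j x y, j ∈ J -> app X j x -> app f j y -> nonempty y /\ finite y /\ y ⊆ x.

Definition has_multiple_choice_function (J X : V) : Prop :=
  exists f, is_multiple_choice_function J X f.

Definition is_topology (X T : V) : Prop :=
  (forall U, U ∈ T -> U ⊆ X) /\
  X ∈ T /\
  (exists o, o ∈ T /\ empty o) /\
  (forall A u, A ⊆ T -> is_union A u -> u ∈ T) /\
  (forall U W c, U ∈ T -> W ∈ T -> is_inter U W c -> c ∈ T).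

Definition closed (X T c : V) : Prop :=
  c ⊆ X /\ exists U, U ∈ T /\ is_diff X c U.

Definition covers (A X : V) : Prop := forall x, x ∈ X -> exists U, U ∈ A /\ x ∈ U.

Definition compact (X T : V) : Prop :=
  forall A, A ⊆ T -> covers A X -> exists F, F ⊆ A /\ finite F /\ covers F X.

Definition scattered (X T : V) : Prop :=
  forall A, A ⊆ X -> nonempty A ->
    exists x U, U ∈ T /\ forall y, y ∈ U /\ y ∈ A <-> y = x.

(* the family of all non-empty closed sets is indexed by itself through the identity *)
Definition weakly_loeb (X T : V) : Prop :=
  exists C id,
    (forall c, c ∈ C <-> closed X T c /\ nonempty c) /\
    is_family C id /\ (forall c, c ∈ C -> app id c c) /\
    has_multiple_choice_function C id.

(* X and T are the families of underlying sets and of topologies, pairwise disjoint sets *)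
Definition is_direct_sum (I X T S TS : V) : Prop :=
  is_family_union I X S /\
  forall U, U ∈ TS <-> U ⊆ S /\
    forall i x t, i ∈ I -> app X i x -> app T i t ->
      exists W, W ∈ t /\ is_inter U x W.

Definition is_product (I X P : V) : Prop :=
  forall f, f ∈ P <-> is_family I f /\
    forall i x y, i ∈ I -> app X i x -> app f i y -> y ∈ x.

(* W is the inverse image of U under the i-th projection of P *)
Definition is_cylinder (P i U W : V) : Prop :=
  forall f, f ∈ W <-> f ∈ P /\ exists y, app f i y /\ y ∈ U.

Definition projections_continuous (I T P TP : V) : Prop :=
  forall i t U W, i ∈ I -> app T i t -> U ∈ t -> is_cylinder P i U W -> W ∈ TP.

(* Tychonoff topology: the coarsest one making all projections continuous *)
Definition is_product_topology (I T P TP : V) : Prop :=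
  is_topology P TP /\ projections_continuous I T P TP /\
  forall T', is_topology P T' -> projections_continuous I T P T' -> TP ⊆ T'.

End SetTheory.

Notation "a ⊆ b" := (subset a b) (at level 70, no associativity).

(* The real line of the model, given up to isomorphism as a complete ordered
   field; all components, and the sets in [r_complete], belong to the model. *)
Record complete_ordered_field (V : ZF_model) : Type := {
  real : V;
  r_add : V;
  r_mul : V;
  r_lt : V;
  r_zero : V;
  r_one : V;
  r_add_op : is_binop real real real r_add;
  r_mul_op : is_binop real real real r_mul;
  r_zero_in : r_zero ∈ real;
  r_one_in : r_one ∈ real;
  r_one_neq_zero : r_one <> r_zero;
  r_addC : forall a b c, app2 r_add a b c -> app2 r_add b a c;
  r_addA : forall a b c ab bc s,
    app2 r_add a b ab -> app2 r_add b c bc -> app2 r_add ab c s -> app2 r_add a bc s;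
  r_add0 : forall a, a ∈ real -> app2 r_add a r_zero a;
  r_addN : forall a, a ∈ real -> exists b, b ∈ real /\ app2 r_add a b r_zero;
  r_mulC : forall a b c, app2 r_mul a b c -> app2 r_mul b a c;
  r_mulA : forall a b c ab bc s,
    app2 r_mul a b ab -> app2 r_mul b c bc -> app2 r_mul ab c s -> app2 r_mul a bc s;
  r_mul1 : forall a, a ∈ real -> app2 r_mul a r_one a;
  r_mulV : forall a, a ∈ real -> a <> r_zero ->
    exists b, b ∈ real /\ app2 r_mul a b r_one;
  r_mulD : forall a b c s ab ac m,
    app2 r_add b c s -> app2 r_mul a b ab -> app2 r_mul a c ac ->
    app2 r_mul a s m -> app2 r_add ab ac m;
  r_lt_irrefl : forall a, a ∈ real -> ~ rel r_lt a a;
  r_lt_trans : forall a b c, a ∈ real -> b ∈ real -> c ∈ real ->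
    rel r_lt a b -> rel r_lt b c -> rel r_lt a c;
  r_lt_total : forall a b, a ∈ real -> b ∈ real ->
    rel r_lt a b \/ a = b \/ rel r_lt b a;
  r_lt_add : forall a b c ac bc, a ∈ real -> b ∈ real -> c ∈ real ->
    rel r_lt a b -> app2 r_add a c ac -> app2 r_add b c bc -> rel r_lt ac bc;
  r_lt_mul : forall a b ab, a ∈ real -> b ∈ real ->
    rel r_lt r_zero a -> rel r_lt r_zero b -> app2 r_mul a b ab -> rel r_lt r_zero ab;
  r_complete : forall S, S ⊆ real -> nonempty S ->
    (exists b, b ∈ real /\ forall x, x ∈ S -> rel r_lt x b \/ x = b) ->
    exists l, l ∈ real /\ (forall x, x ∈ S -> rel r_lt x l \/ x = l) /\
      forall b, b ∈ real -> (forall x, x ∈ S -> rel r_lt x b \/ x = b) ->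
        rel r_lt l b \/ l = b
}.

Arguments real {V} _.
Arguments r_add {V} _.
Arguments r_mul {V} _.
Arguments r_lt {V} _.
Arguments r_zero {V} _.
Arguments r_one {V} _.

Section Metric.
Context {V : ZF_model} (R : complete_ordered_field V).

Definition is_metric (X d : V) : Prop :=
  is_binop X X (real R) d /\
  (forall x y a, app2 d x y a -> rel (r_lt R) (r_zero R) a \/ r_zero R = a) /\
  (forall x y, x ∈ X -> y ∈ X -> (app2 d x y (r_zero R) <-> x = y)) /\
  (forall x y a, app2 d x y a -> app2 d y x a) /\
  (forall x y z a b c s, app2 d x y a -> app2 d y z b -> app2 d x z c ->
     app2 (r_add R) a b s -> rel (r_lt R) c s \/ c = s).

Definition positive (eps : V) : Prop :=
  eps ∈ real R /\ rel (r_lt R) (r_zero R) eps.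

Definition is_ball (X d x eps B : V) : Prop :=
  forall y, y ∈ B <-> y ∈ X /\ exists a, app2 d x y a /\ rel (r_lt R) a eps.

Definition is_metric_topology (X d T : V) : Prop :=
  forall U, U ∈ T <-> U ⊆ X /\
    forall x, x ∈ U -> exists eps B, positive eps /\ is_ball X d x eps B /\ B ⊆ U.

Definition metrizable (X T : V) : Prop :=
  exists d, is_metric X d /\ is_metric_topology X d T.

Definition totally_bounded (X d : V) : Prop :=
  forall eps, positive eps ->
    exists F, finite F /\
      (forall B, B ∈ F -> exists x, x ∈ X /\ is_ball X d x eps B) /\
      covers F X.

Definition metric_compact (X d : V) : Prop :=
  exists T, is_metric_topology X d T /\ compact X T.

Definition metric_scattered (X d : V) : Prop :=
  exists T, is_metric_topology X d T /\ scattered X T.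

End Metric.

(* Main.v *)
Require Import Defs.
From Stdlib Require Import Classical ClassicalEpsilon PeanoNat Lia Setoid.

(** In each compact metrizable space the Cantor-Bendixson derivatives of a closed set [Y], taken
    in the relative topology, form a chain which is well-ordered and defined without any choice.
    If the space is countable, hence scattered by a Baire category argument, the last non-empty
    derivative of [Y] is a non-empty finite set depending on [Y] and the topology only, which gives
    (a) and (b).  In a scattered totally bounded metric space every point [x] is isolated in a unique
    last derivative containing it; recording this derivative and the largest admissible
    isolating radius from a fixed reversely well-ordered set of radii assigns to [x] a key, and
    by total boundedness only finitely many points share a key.  So a well-orderable family of
    such spaces has a union mapped finite-to-one to a well-orderable set, and WOAC_fin
    orders the fibres.  For products, the well-ordering of the union makes it possible to
    prove Tychonoff's theorem with a maximal partial point none of whose basic neighbourhoods is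
    finitely covered.  The converses use discrete metrics on finite sets.

    Separation and Replacement hold in the model for first-order definable classes only, so each
    comprehension carries a proof of definability, found by the tactic [df]. *)

(** * Definability with parameters *)

(** Without choice, what may be used across a whole family is what one formula defines from the
    given data, for Replacement then collects the results. In (a) and (b) topologies are given but
    metrics are not, and a metric cannot in general be selected for every index at once; metrics
    therefore serve only to prove facts about a single space, while the finite set selected is
    computed from the topology. In (c) the metrics belong to the data, so radii may enter the keys.
    A supremum of isolating radii would be equally canonical, but ZF does not well-order the reals;
    the radii [u / 2^n] are well-ordered by the reversed order, and a fixed well-order is enough to
    single out one radius per point. Ordinals and transfinite recursion are avoided: derivatives and
    Zorn-style constructions live in a least family closed under a successor operation and unions.
    Such families increase, so a derivative is represented by its complement, the points removed so
    far. Finiteness is that of the model, whose natural numbers may be non-standard, so finite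
    selections are made by internal induction on definable statements. *)

Definition up (f : nat -> nat) (n : nat) : nat :=
  match n with O => O | S m => S (f m) end.

Fixpoint rename (f : nat -> nat) (p : formula) : formula :=
  match p with
  | f_mem i j => f_mem (f i) (f j)
  | f_eq i j => f_eq (f i) (f j)
  | f_false => f_false
  | f_and p q => f_and (rename f p) (rename f q)
  | f_or p q => f_or (rename f p) (rename f q)
  | f_imp p q => f_imp (rename f p) (rename f q)
  | f_all p => f_all (rename (up f) p)
  | f_ex p => f_ex (rename (up f) p)
  end.

Lemma sat_rename {U : Type} (E : U -> U -> Prop) (p : formula) :
  forall (f : nat -> nat) (e e' : nat -> U), (forall n, e' n = e (f n)) ->
  (sat E e (rename f p) <-> sat E e' p).
Proof.
  induction p; intros f e e' H; simpl; rewrite ?H; try tauto.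
  - now rewrite (IHp1 f e e' H), (IHp2 f e e' H).
  - now rewrite (IHp1 f e e' H), (IHp2 f e e' H).
  - now rewrite (IHp1 f e e' H), (IHp2 f e e' H).
  - assert (K : forall a, sat E (scons a e) (rename (up f) p) <-> sat E (scons a e') p).
    { intros a; apply IHp; intros [|n]; simpl; auto. }
    split; intros h a; apply K, h.
  - assert (K : forall a, sat E (scons a e) (rename (up f) p) <-> sat E (scons a e') p).
    { intros a; apply IHp; intros [|n]; simpl; auto. }
    split; intros [a h]; exists a; apply K, h.
Qed.

(* Even positions of the mixed environment are variables, odd ones are parameters. *)
Definition mix {U : Type} (e g : nat -> U) (n : nat) : U :=
  if Nat.even n then e (Nat.div2 n) else g (Nat.div2 n).

Lemma even_or_odd n : exists k, n = 2 * k \/ n = S (2 * k).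
Proof. destruct (Nat.Even_or_Odd n) as [[k h]|[k h]]; exists k; lia. Qed.

Lemma even_odd k : Nat.even (S (2 * k)) = false.
Proof. rewrite <- Nat.add_1_r. apply Nat.even_odd. Qed.

Lemma mix_even {U : Type} (e g : nat -> U) k : mix e g (2 * k) = e k.
Proof.
  unfold mix. now rewrite Nat.even_even, Nat.div2_double.
Qed.

Lemma mix_odd {U : Type} (e g : nat -> U) k : mix e g (S (2 * k)) = g k.
Proof.
  unfold mix. rewrite even_odd. now rewrite Nat.div2_succ_double.
Qed.

Section Definability.
Context {V : ZF_model}.
Local Notation env := (nat -> V).

Lemma model_inhabited : inhabited V.
Proof. destruct (zf_infinity V) as [w _]. exact (inhabits w). Qed.

(** The variables [e] and the parameters [g] are kept in separate sequences, so that elements of the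
    model can occur in a definition while binders shift the variables only. *)
Definition defn (P : env -> Prop) : Prop :=
  exists p g, forall e, P e <-> sat mem (mix e g) p.

Lemma defn_ext (P Q : env -> Prop) : (forall e, P e <-> Q e) -> defn P -> defn Q.
Proof. intros H (p & g & h). exists p, g. intros e. now rewrite <- H. Qed.

Lemma defn_rename (f : nat -> nat) (P : env -> Prop) :
  defn P -> defn (fun e => P (fun n => e (f n))).
Proof.
  intros (p & g & h).
  exists (rename (fun k => if Nat.even k then 2 * f (Nat.div2 k) else k) p), g.
  intros e. rewrite h. symmetry. apply sat_rename. intros n. cbv beta.
  destruct (even_or_odd n) as [k [-> | ->]].
  - rewrite Nat.even_even, Nat.div2_double, !mix_even. reflexivity.
  - rewrite even_odd, !mix_odd. reflexivity.
Qed.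

(** Each predicate comes with its own parameters. Interleaving them as [mix g g'] gives one common
    sequence: the k-th parameter of the first predicate moves to place 2k, that of the second to
    place 2k+1. *)
Lemma defn_common (P Q : env -> Prop) : defn P -> defn Q ->
  exists (p q : formula) (g : env), (forall e, P e <-> sat mem (mix e g) p) /\
                (forall e, Q e <-> sat mem (mix e g) q).
Proof.
  intros (p & g & hp) (q & g' & hq).
  exists (rename (fun k => if Nat.even k then k else S (2 * (2 * Nat.div2 k))) p),
         (rename (fun k => if Nat.even k then k else S (2 * S (2 * Nat.div2 k))) q), (mix g g').
  split; intros e; [rewrite hp | rewrite hq]; symmetry; apply sat_rename; intros n; cbv beta;
    destruct (even_or_odd n) as [k [-> | ->]].
  - now rewrite Nat.even_even, !mix_even.
  - now rewrite even_odd, Nat.div2_succ_double, !mix_odd, mix_even.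
  - now rewrite Nat.even_even, !mix_even.
  - now rewrite even_odd, Nat.div2_succ_double, !mix_odd.
Qed.

Lemma defn_and (P Q : env -> Prop) : defn P -> defn Q -> defn (fun e => P e /\ Q e).
Proof.
  intros HP HQ. destruct (defn_common P Q HP HQ) as (p & q & g & h & k).
  exists (f_and p q), g. intros e. simpl. now rewrite h, k.
Qed.

Lemma defn_or (P Q : env -> Prop) : defn P -> defn Q -> defn (fun e => P e \/ Q e).
Proof.
  intros HP HQ. destruct (defn_common P Q HP HQ) as (p & q & g & h & k).
  exists (f_or p q), g. intros e. simpl. now rewrite h, k.
Qed.

Lemma defn_imp (P Q : env -> Prop) : defn P -> defn Q -> defn (fun e => P e -> Q e).
Proof.
  intros HP HQ. destruct (defn_common P Q HP HQ) as (p & q & g & h & k).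
  exists (f_imp p q), g. intros e. simpl. now rewrite h, k.
Qed.

Lemma defn_false : defn (fun _ => False).
Proof. exists f_false, (fun _ => epsilon model_inhabited (fun _ => True)). now intros e. Qed.

Lemma defn_not (P : env -> Prop) : defn P -> defn (fun e => ~ P e).
Proof. intros H. exact (defn_imp _ _ H defn_false). Qed.

Lemma defn_iff (P Q : env -> Prop) : defn P -> defn Q -> defn (fun e => P e <-> Q e).
Proof. intros H K. apply defn_and; now apply defn_imp. Qed.

(** A quantifier puts [a] in front of the whole mixed sequence, which flips the parity of every
    position behind it. The renaming compensates: variable k+1, formerly at 2(k+1), is found at
    2k+1, and a parameter moves one place up. *)
Lemma defn_binder (p : formula) (a : V) (e g : env) :
  sat mem (scons a (mix e g)) (rename (fun k => if Nat.even k then Nat.pred k else S k) p) <->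
  sat mem (mix (scons a e) g) p.
Proof.
  apply sat_rename. intros n. cbv beta. destruct (even_or_odd n) as [k [-> | ->]].
  - rewrite Nat.even_even, mix_even. destruct k as [|k]; [reflexivity|].
    replace (Nat.pred (2 * S k)) with (S (2 * k)) by lia.
    symmetry. exact (mix_even e g k).
  - rewrite even_odd, mix_odd. symmetry. exact (mix_odd e g k).
Qed.

Lemma defn_all (Q : env -> V -> Prop) :
  defn (fun e => Q (fun n => e (S n)) (e 0)) -> defn (fun e => forall a, Q e a).
Proof.
  intros (p & g & h).
  exists (f_all (rename (fun k => if Nat.even k then Nat.pred k else S k) p)), g.
  intros e. simpl. split; intros H a.
  - apply defn_binder, (h (scons a e)), H.
  - apply (h (scons a e)), defn_binder, H.
Qed.

Lemma defn_ex (Q : env -> V -> Prop) :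
  defn (fun e => Q (fun n => e (S n)) (e 0)) -> defn (fun e => exists a, Q e a).
Proof.
  intros (p & g & h).
  exists (f_ex (rename (fun k => if Nat.even k then Nat.pred k else S k) p)), g.
  intros e. simpl. split; intros [a H]; exists a.
  - apply defn_binder, (h (scons a e)), H.
  - apply (h (scons a e)), defn_binder, H.
Qed.

Definition def1 (P : V -> Prop) := defn (fun e => P (e 0)).
Definition def2 (P : V -> V -> Prop) := defn (fun e => P (e 0) (e 1)).
Definition def3 (P : V -> V -> V -> Prop) := defn (fun e => P (e 0) (e 1) (e 2)).
Definition def4 (P : V -> V -> V -> V -> Prop) := defn (fun e => P (e 0) (e 1) (e 2) (e 3)).

(** The language has no function symbols, so a term is definable when its graph is; index 0 holds
    the value. *)
Definition tdef (F : env -> V) : Prop := defn (fun e => e 0 = F (fun n => e (S n))).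
Definition fun1 (F : V -> V) := def2 (fun y a => y = F a).
Definition fun2 (F : V -> V -> V) := def3 (fun y a b => y = F a b).
Definition fun3 (F : V -> V -> V -> V) := def4 (fun y a b c => y = F a b c).

Lemma tdef_rename (f : nat -> nat) (F : env -> V) :
  tdef F -> tdef (fun e => F (fun n => e (f n))).
Proof. intros H. exact (defn_rename (up f) _ H). Qed.

Lemma tdef_var n : tdef (fun e => e n).
Proof.
  exists (f_eq (2 * 0) (2 * S n)), (fun _ => epsilon model_inhabited (fun _ => True)).
  intros e. unfold sat. now rewrite !mix_even.
Qed.

Lemma tdef_const c : tdef (fun _ => c).
Proof.
  exists (f_eq (2 * 0) (S (2 * 0))), (fun _ => c).
  intros e. unfold sat. now rewrite mix_even, mix_odd.
Qed.

(** Substituting a term into a formula becomes an existential quantifier over the value of the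
    term. *)
Lemma defn_comp1 P F : def1 P -> tdef F -> defn (fun e => P (F e)).
Proof.
  intros HP HF. apply (defn_ext (fun e => exists a, a = F e /\ P a)).
  { intros e; split; [now intros (a & -> & h) | eauto]. }
  apply defn_ex, defn_and; [exact HF | exact HP].
Qed.

Lemma defn_comp2 P F G : def2 P -> tdef F -> tdef G -> defn (fun e => P (F e) (G e)).
Proof.
  intros HP HF HG.
  apply (defn_ext (fun e => exists b, b = G e /\ exists a, a = F e /\ P a b)).
  { intros e; split; [now intros (b & -> & a & -> & h) | eauto 6]. }
  apply defn_ex, defn_and; [exact HG | apply defn_ex, defn_and].
  - exact (tdef_rename S _ HF).
  - exact HP.
Qed.

Lemma defn_comp3 P F G H : def3 P -> tdef F -> tdef G -> tdef H ->
  defn (fun e => P (F e) (G e) (H e)).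
Proof.
  intros HP HF HG HH.
  apply (defn_ext (fun e => exists c, c = H e /\ exists b, b = G e /\ exists a, a = F e /\ P a b c)).
  { intros e; split; [now intros (c & -> & b & -> & a & -> & h) | eauto 8]. }
  apply defn_ex, defn_and; [exact HH | apply defn_ex, defn_and; [|apply defn_ex, defn_and]].
  - exact (tdef_rename S _ HG).
  - exact (tdef_rename (fun n => S (S n)) _ HF).
  - exact HP.
Qed.

Lemma defn_comp4 P F G H K : def4 P -> tdef F -> tdef G -> tdef H -> tdef K ->
  defn (fun e => P (F e) (G e) (H e) (K e)).
Proof.
  intros HP HF HG HH HK.
  apply (defn_ext (fun e => exists d, d = K e /\ exists c, c = H e /\ exists b, b = G e /\
    exists a, a = F e /\ P a b c d)).
  { intros e; split; [now intros (d & -> & c & -> & b & -> & a & -> & h) | eauto 10]. }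
  apply defn_ex, defn_and; [exact HK | apply defn_ex, defn_and; [|apply defn_ex, defn_and;
    [|apply defn_ex, defn_and]]].
  - exact (tdef_rename S _ HH).
  - exact (tdef_rename (fun n => S (S n)) _ HG).
  - exact (tdef_rename (fun n => S (S (S n))) _ HF).
  - exact HP.
Qed.

Lemma tdef_comp1 H F : fun1 H -> tdef F -> tdef (fun e => H (F e)).
Proof.
  intros h HF. exact (defn_comp2 (fun y a => y = H a) _ _ h (tdef_var 0) (tdef_rename S _ HF)).
Qed.

Lemma tdef_comp2 H F G : fun2 H -> tdef F -> tdef G -> tdef (fun e => H (F e) (G e)).
Proof.
  intros h HF HG. exact (defn_comp3 (fun y a b => y = H a b) _ _ _ h (tdef_var 0) (tdef_rename S _ HF) (tdef_rename S _ HG)).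
Qed.

Lemma tdef_comp3 H F G K : fun3 H -> tdef F -> tdef G -> tdef K ->
  tdef (fun e => H (F e) (G e) (K e)).
Proof.
  intros h HF HG HK.
  exact (defn_comp4 (fun y a b c => y = H a b c) _ _ _ _ h (tdef_var 0) (tdef_rename S _ HF) (tdef_rename S _ HG)
    (tdef_rename S _ HK)).
Qed.

Lemma def2_mem : def2 (@mem V).
Proof.
  exists (f_mem (2 * 0) (2 * 1)), (fun _ => epsilon model_inhabited (fun _ => True)).
  intros e. unfold sat. now rewrite !mix_even.
Qed.

Lemma def2_eq : def2 (@eq V).
Proof.
  exists (f_eq (2 * 0) (2 * 1)), (fun _ => epsilon model_inhabited (fun _ => True)).
  intros e. unfold sat. now rewrite !mix_even.
Qed.

Lemma tdef_eq (F G : env -> V) : tdef F -> tdef G -> defn (fun e => F e = G e).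
Proof. apply (defn_comp2 _ _ _ def2_eq). Qed.

(* Definite description; the default value keeps it definable for every definable [P]. *)
Definition the (P : V -> Prop) : V :=
  epsilon model_inhabited
    (fun y => (P y /\ forall z, P z -> z = y) \/
              (~ (exists u, P u /\ forall z, P z -> z = u) /\ forall z, ~ z ∈ y)).

Lemma set_ext (a b : V) : (forall z, z ∈ a <-> z ∈ b) -> a = b.
Proof. apply zf_extensionality. Qed.

(** The two alternatives exclude each other and each determines [y], the second one as the empty
    set. Hence the graph of [the] is first-order although the operator is built with the epsilon of
    the metatheory. *)
Lemma the_iff P y : y = the P <->
  (P y /\ forall z, P z -> z = y) \/
  (~ (exists u, P u /\ forall z, P z -> z = u) /\ forall z, ~ z ∈ y).
Proof.
  assert (ex : exists y, (P y /\ forall z, P z -> z = y) \/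
    (~ (exists u, P u /\ forall z, P z -> z = u) /\ forall z, ~ z ∈ y)).
  { destruct (classic (exists u, P u /\ forall z, P z -> z = u)) as [[u h]|h]; [eauto|].
    destruct (zf_infinity V) as (w & (o & _ & ho) & _). eauto. }
  assert (sp := epsilon_spec model_inhabited _ ex).
  fold (the P) in sp. split; [now intros -> |].
  intros H. destruct H as [[h1 h2]|[h1 h2]], sp as [[k1 k2]|[k1 k2]].
  - auto.
  - exfalso; eauto.
  - exfalso; eauto.
  - apply set_ext. intros z; split; intros hz; exfalso; [eapply h2 | eapply k2]; eauto.
Qed.

Lemma the_eq P y : P y -> (forall z, P z -> z = y) -> the P = y.
Proof. intros h k. symmetry. apply the_iff. auto. Qed.

Lemma the_spec P : (exists y, P y /\ forall z, P z -> z = y) -> P (the P).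
Proof. intros (y & h & k). now rewrite (the_eq P y h k). Qed.

Lemma the_set (Q : V -> Prop) : (exists b, forall x, x ∈ b <-> Q x) ->
  forall x, x ∈ the (fun b => forall x, x ∈ b <-> Q x) <-> Q x.
Proof.
  intros (b & h). apply (the_spec (fun b => forall x, x ∈ b <-> Q x)).
  exists b; split; auto. intros z hz. apply set_ext. intros x. now rewrite h, hz.
Qed.

Lemma tdef_the (P : env -> V -> Prop) :
  defn (fun e => P (fun n => e (S n)) (e 0)) -> tdef (fun e => the (P e)).
Proof.
  intros H. unfold tdef.
  eapply defn_ext; [intros e; symmetry; apply the_iff|].
  assert (Hs : forall i k, defn (fun e => P (fun n => e (k + n)) (e i))).
  { intros i k. exact (defn_rename (fun n => match n with O => i | S m => k + m end) _ H). }
  apply defn_or; apply defn_and.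
  - exact (Hs 0 1).
  - apply defn_all, defn_imp; [exact (Hs 0 2) | apply tdef_eq; [exact (tdef_var 0)|exact (tdef_var 1)]].
  - apply defn_not, defn_ex, defn_and; [exact (Hs 0 2)|].
    apply defn_all, defn_imp; [exact (Hs 0 3) | apply tdef_eq; [exact (tdef_var 0)|exact (tdef_var 1)]].
  - apply defn_all, defn_not. apply (defn_comp2 _ _ _ def2_mem); [exact (tdef_var 0)|exact (tdef_var 1)].
Qed.

(** Total in [P]: if no such set exists, [the] falls back on its default value. Definability is
    asked for only when membership is unfolded, in [in_sep]. *)
Definition sep (a : V) (P : V -> Prop) : V := the (fun b => forall x, x ∈ b <-> x ∈ a /\ P x).

Lemma in_sep a P : def1 P -> forall x, x ∈ sep a P <-> x ∈ a /\ P x.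
Proof.
  intros (p & g & h). apply the_set.
  (* Only variable 0 of [P] is read, so the remaining variables may be filled with anything; [g]
     serves as filler. *)
  destruct (zf_separation V (rename (fun k => if Nat.even k then Nat.pred k else S k) p) (mix g g) a) as [b hb].
  exists b. intros x. rewrite hb.
  rewrite (h (scons x g)), <- (defn_binder p x g g). reflexivity.
Qed.

Definition image (a : V) (F : V -> V) : V :=
  the (fun b => forall y, y ∈ b <-> exists x, x ∈ a /\ y = F x).

Lemma in_image a F : fun1 F -> forall y, y ∈ image a F <-> exists x, x ∈ a /\ y = F x.
Proof.
  intros HF. apply the_set.
  (* [fun1] puts the value at index 0 and the argument at index 1, Replacement the other way round;
     this renaming swaps them. *)
  assert (H := defn_rename (fun n => match n with O => 1 | _ => 0 end) _ HF).
  destruct H as (p & g & h). simpl in h.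
  set (fb := fun k => if Nat.even k then Nat.pred k else S k).
  assert (K : forall x y, sat mem (scons x (scons y (mix g g))) (rename (up fb) (rename fb p)) <-> y = F x).
  { intros x y. rewrite (h (scons x (scons y g))).
    rewrite (sat_rename mem (rename fb p) (up fb) _ (scons x (mix (scons y g) g))).
    - apply defn_binder.
    - intros [|n]; [reflexivity|]. simpl.
      destruct (even_or_odd n) as [k [-> | ->]]; unfold fb.
      + rewrite Nat.even_even, mix_even. destruct k as [|k]; [reflexivity|].
        replace (Nat.pred (2 * S k)) with (S (2 * k)) by lia.
        symmetry. exact (mix_even g g k).
      + rewrite even_odd, mix_odd. symmetry. exact (mix_odd g g k). }
  destruct (zf_replacement V (rename (up fb) (rename fb p)) (mix g g) a) as [b hb].
  { intros x y y' _ h1 h2. apply K in h1, h2. congruence. }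
  exists b. intros y. rewrite hb. split; intros (x & hx & hy); exists x; split; auto; now apply K.
Qed.

Lemma tdef_sep (A : env -> V) (P : env -> V -> Prop) : tdef A ->
  defn (fun e => P (fun n => e (S n)) (e 0)) -> tdef (fun e => sep (A e) (P e)).
Proof.
  intros HA HP. apply tdef_the, defn_all, defn_iff.
  - apply (defn_comp2 _ _ _ def2_mem); [exact (tdef_var 0)|exact (tdef_var 1)].
  - apply defn_and.
    + apply (defn_comp2 _ _ _ def2_mem); [exact (tdef_var 0)|exact (tdef_rename (fun n => S (S n)) _ HA)].
    + exact (defn_rename (fun n => match n with O => 0 | S m => S (S m) end) _ HP).
Qed.

Lemma tdef_image (A : env -> V) (F : env -> V -> V) : tdef A ->
  tdef (fun e => F (fun n => e (S n)) (e 0)) -> tdef (fun e => image (A e) (F e)).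
Proof.
  intros HA HF. apply tdef_the, defn_all, defn_iff.
  - apply (defn_comp2 _ _ _ def2_mem); [exact (tdef_var 0)|exact (tdef_var 1)].
  - apply defn_ex, defn_and.
    + apply (defn_comp2 _ _ _ def2_mem); [exact (tdef_var 0)|exact (tdef_rename (fun n => S (S (S n))) _ HA)].
    + apply tdef_eq; [exact (tdef_var 1)|].
      exact (tdef_rename (fun n => match n with O => 0 | S m => S (S (S m)) end) _ HF).
Qed.

End Definability.

Create HintDb dfdb discriminated.
Global Hint Resolve def2_mem def2_eq : dfdb.

Ltac df_head := solve [assumption | auto with dfdb nocore].

(** A hook for shapes with an argument that is a predicate or a function, such as
    [well_orders (rel r) A] and [lam a F]; it is filled in once their definability is known. *)
Ltac df_extra := fail.

Ltac df_step :=
  match goal with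
  | |- defn (fun e => @?P e /\ @?Q e) => apply (defn_and P Q)
  | |- defn (fun e => @?P e \/ @?Q e) => apply (defn_or P Q)
  | |- defn (fun e => ~ @?P e) => apply (defn_not P)
  | |- defn (fun e => @?P e <-> @?Q e) => apply (defn_iff P Q)
  | |- defn (fun e => ex (@?Q e)) => apply (defn_ex Q)
  | |- defn (fun e => forall a, @?Q e a) => apply (defn_all Q)
  | |- defn (fun e => @?P e -> @?Q e) => apply (defn_imp P Q)
  | |- defn (fun e => False) => apply defn_false
  | |- defn (fun e => unique _ _) => unfold unique
  | |- tdef (fun e => e ?n) => apply (tdef_var n)
  | |- tdef (fun e => ?c) => apply (tdef_const c)
  | |- tdef (fun e => the (@?P e)) => apply (tdef_the P)
  | |- tdef (fun e => sep (@?A e) (@?P e)) => apply (tdef_sep A P)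
  | |- tdef (fun e => image (@?A e) (@?P e)) => apply (tdef_image A P)
  | |- defn (fun e => ?P (@?F e)) => apply (defn_comp1 P F); [df_head|]
  | |- defn (fun e => ?P (@?F e) (@?G e)) => apply (defn_comp2 P F G); [df_head| |]
  | |- defn (fun e => ?P (@?F e) (@?G e) (@?H e)) => apply (defn_comp3 P F G H); [df_head| | |]
  | |- defn (fun e => ?P (@?F e) (@?G e) (@?H e) (@?K e)) =>
      apply (defn_comp4 P F G H K); [df_head| | | |]
  | |- tdef (fun e => ?P (@?F e)) => apply (tdef_comp1 P F); [df_head|]
  | |- tdef (fun e => ?P (@?F e) (@?G e)) => apply (tdef_comp2 P F G); [df_head| |]
  | |- tdef (fun e => ?P (@?F e) (@?G e) (@?H e)) => apply (tdef_comp3 P F G H); [df_head| | |]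
  | |- def1 _ => red
  | |- def2 _ => red
  | |- def3 _ => red
  | |- def4 _ => red
  | |- fun1 ?F => change (tdef (fun e => F (e 0)))
  | |- fun2 ?F => change (tdef (fun e => F (e 0) (e 1)))
  | |- fun3 ?F => change (tdef (fun e => F (e 0) (e 1) (e 2)))
  end.

Ltac df := intros; repeat (first [df_head | df_extra | df_step]; cbv beta).

(** * Sets, pairs and functions *)

Section BasicSets.
Context {V : ZF_model}.
Implicit Types a b c x y z f p : V.

Lemma def2_subset : def2 (@subset V). Proof. unfold subset. df. Qed.
Lemma def1_nonempty : def1 (@nonempty V). Proof. unfold nonempty. df. Qed.
Lemma def1_empty : def1 (@empty V). Proof. unfold empty. df. Qed.
Lemma def2_disjoint : def2 (@disjoint V). Proof. unfold disjoint. df. Qed.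
Lemma def3_is_upair : def3 (@is_upair V). Proof. unfold is_upair. df. Qed.
Hint Resolve def2_subset def1_nonempty def1_empty def2_disjoint def3_is_upair : dfdb.
Lemma def3_is_pair : def3 (@is_pair V). Proof. unfold is_pair. df. Qed.
Lemma def2_is_union : def2 (@is_union V). Proof. unfold is_union. df. Qed.
Lemma def3_is_inter : def3 (@is_inter V). Proof. unfold is_inter. df. Qed.
Lemma def3_is_diff : def3 (@is_diff V). Proof. unfold is_diff. df. Qed.
Hint Resolve def3_is_pair def2_is_union def3_is_inter def3_is_diff : dfdb.
Lemma def3_app : def3 (@app V). Proof. unfold app. df. Qed.
Hint Resolve def3_app : dfdb.
Lemma def2_is_family : def2 (@is_family V). Proof. unfold is_family. df. Qed.
Hint Resolve def2_is_family : dfdb.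
Lemma def3_is_map : def3 (@is_map V). Proof. unfold is_map. df. Qed.
Hint Resolve def3_is_map : dfdb.
Lemma def3_is_bijection : def3 (@is_bijection V). Proof. unfold is_bijection. df. Qed.
Hint Resolve def3_is_bijection : dfdb.
Lemma def2_equipotent : def2 (@equipotent V). Proof. unfold equipotent. df. Qed.
Lemma def1_inductive : def1 (@inductive_set V). Proof. unfold inductive_set, is_succ. df. Qed.
Hint Resolve def2_equipotent def1_inductive : dfdb.
Lemma def1_is_omega : def1 (@is_omega V). Proof. unfold is_omega. df. Qed.
Hint Resolve def1_is_omega : dfdb.
Lemma def1_finite : def1 (@finite V). Proof. unfold finite. df. Qed.
Lemma def2_is_topology : def2 (@is_topology V). Proof. unfold is_topology. df. Qed.
Hint Resolve def1_finite def2_is_topology : dfdb.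
Lemma def3_closed : def3 (@closed V). Proof. unfold closed. df. Qed.
Lemma def2_covers : def2 (@covers V). Proof. unfold covers. df. Qed.
Lemma def4_is_cylinder : def4 (@is_cylinder V). Proof. unfold is_cylinder. df. Qed.
Hint Resolve def3_closed def2_covers def4_is_cylinder : dfdb.
Lemma def4_projections_continuous : def4 (@projections_continuous V).
Proof. unfold projections_continuous. df. Qed.
Lemma def2_well_orders_rel : def2 (fun r A : V => well_orders (rel r) A).
Proof. unfold well_orders. df. Qed.

Definition zero : V := the (@empty V).
Definition upair a b : V := the (is_upair a b).
Definition union a : V := the (is_union a).
Definition power a : V := the (fun p => forall y, y ∈ p <-> y ⊆ a).

Lemma in_zero x : ~ x ∈ zero.
Proof.
  apply (the_spec (@empty V)). destruct (zf_infinity V) as (w & (o & _ & ho) & _).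
  exists o; split; auto. intros z hz. apply set_ext; intros t; split; intros h; exfalso; [eapply hz|eapply ho]; eauto.
Qed.
Lemma in_upair a b x : x ∈ upair a b <-> x = a \/ x = b.
Proof. exact (the_set (fun x => x = a \/ x = b) (zf_pairing V a b) x). Qed.
Lemma in_union a x : x ∈ union a <-> exists y, y ∈ a /\ x ∈ y.
Proof. exact (the_set (fun x => exists y, y ∈ a /\ x ∈ y) (zf_union V a) x). Qed.
Lemma in_power a x : x ∈ power a <-> x ⊆ a.
Proof. exact (the_set (fun x => x ⊆ a) (zf_power V a) x). Qed.

Definition sing a := upair a a.
Definition cup a b := union (upair a b).
Definition cap a b := sep a (fun x => x ∈ b).
Definition diff a b := sep a (fun x => ~ x ∈ b).
Definition pair a b := upair (sing a) (upair a b).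

Lemma in_sing a x : x ∈ sing a <-> x = a.
Proof. unfold sing. rewrite in_upair. tauto. Qed.
Lemma in_cup a b x : x ∈ cup a b <-> x ∈ a \/ x ∈ b.
Proof.
  unfold cup. rewrite in_union. split.
  - intros (y & h & k). apply in_upair in h as [-> | ->]; auto.
  - intros [h|h]; [exists a|exists b]; rewrite in_upair; auto.
Qed.
Lemma in_cap a b x : x ∈ cap a b <-> x ∈ a /\ x ∈ b.
Proof. apply (in_sep a (fun x => x ∈ b)). df. Qed.
Lemma in_diff a b x : x ∈ diff a b <-> x ∈ a /\ ~ x ∈ b.
Proof. apply (in_sep a (fun x => ~ x ∈ b)). df. Qed.

Lemma fun2_upair : fun2 (@upair). Proof. unfold upair. df. Qed.
Lemma fun1_union : fun1 (@union). Proof. unfold union. df. Qed.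
Lemma fun1_power : fun1 (@power). Proof. unfold power. df. Qed.
Hint Resolve fun2_upair fun1_union fun1_power : dfdb.
Lemma fun1_sing : fun1 (@sing). Proof. unfold sing. df. Qed.
Lemma fun2_cup : fun2 (@cup). Proof. unfold cup. df. Qed.
Lemma fun2_cap : fun2 (@cap). Proof. unfold cap. df. Qed.
Lemma fun2_diff : fun2 (@diff). Proof. unfold diff. df. Qed.
Hint Resolve fun1_sing fun2_cup fun2_cap fun2_diff : dfdb.
Lemma fun2_pair : fun2 (@pair). Proof. unfold pair. df. Qed.
Hint Resolve fun2_pair : dfdb.

Lemma upair_iff a b p : is_upair a b p <-> p = upair a b.
Proof.
  split.
  - intros h. apply set_ext. intros z. now rewrite (h z), in_upair.
  - intros ->. intros z. apply in_upair.
Qed.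

Lemma pair_iff a b p : is_pair a b p <-> p = pair a b.
Proof.
  unfold is_pair. split.
  - intros h. apply set_ext. intros z. unfold pair, sing. now rewrite in_upair, (h z), (upair_iff a a z), (upair_iff a b z).
  - intros -> z. unfold pair, sing. now rewrite in_upair, (upair_iff a a z), (upair_iff a b z).
Qed.

Lemma pair_inj a b c d : pair a b = pair c d -> a = c /\ b = d.
Proof.
  intros h.
  assert (k : forall z, (z = sing a \/ z = upair a b) <-> (z = sing c \/ z = upair c d)).
  { intros z. rewrite <- (in_upair (sing a) (upair a b) z), <- (in_upair (sing c) (upair c d) z). fold (pair a b) (pair c d). now rewrite h. }
  assert (ac : a = c).
  { destruct (proj1 (k (sing a)) (or_introl eq_refl)) as [e|e].
    - apply in_sing. rewrite <- e. now apply in_sing.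
    - symmetry. apply in_sing. rewrite e. apply in_upair; auto. }
  subst c. split; auto.
  assert (bb : b ∈ upair a d -> d ∈ upair a b -> b = d).
  { intros h1 h2. apply in_upair in h1, h2. intuition congruence. }
  apply bb.
  - destruct (proj1 (k (upair a b)) (or_intror eq_refl)) as [e|e].
    + assert (hb : b ∈ upair a b) by (apply in_upair; auto). rewrite e in hb.
      apply in_sing in hb. subst. apply in_upair; auto.
    + rewrite <- e. apply in_upair; auto.
  - destruct (proj2 (k (upair a d)) (or_intror eq_refl)) as [e|e].
    + assert (hb : d ∈ upair a d) by (apply in_upair; auto). rewrite e in hb.
      apply in_sing in hb. subst. apply in_upair; auto.
    + rewrite <- e. apply in_upair; auto.
Qed.

Lemma app_iff f x y : app f x y <-> pair x y ∈ f.
Proof.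
  unfold app. split.
  - intros (p & h & k). apply pair_iff in h. now subst.
  - intros h. exists (pair x y). split; auto. now apply pair_iff.
Qed.
Lemma rel_iff f x y : rel f x y <-> pair x y ∈ f.
Proof. apply app_iff. Qed.
Lemma app2_iff f x y z : app2 f x y z <-> app f (pair x y) z.
Proof.
  unfold app2. split.
  - intros (p & h & k). apply pair_iff in h. now subst.
  - intros h. exists (pair x y). split; auto. now apply pair_iff.
Qed.

Definition prod a b := sep (power (power (cup a b))) (fun p => exists x y, x ∈ a /\ y ∈ b /\ p = pair x y).
Lemma in_prod a b p : p ∈ prod a b <-> exists x y, x ∈ a /\ y ∈ b /\ p = pair x y.
Proof.
  unfold prod. rewrite in_sep by df. split; [tauto|]. intros h; split; auto.
  destruct h as (x & y & hx & hy & ->). apply in_power. intros z hz. apply in_power. intros t ht.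
  apply in_cup. unfold pair in hz. apply in_upair in hz as [-> | ->].
  - apply in_sing in ht. subst; auto.
  - apply in_upair in ht as [-> | ->]; auto.
Qed.
Lemma pair_in_prod a b x y : pair x y ∈ prod a b <-> x ∈ a /\ y ∈ b.
Proof.
  rewrite in_prod. split.
  - intros (x' & y' & hx & hy & e). apply pair_inj in e as [-> ->]. auto.
  - intros [hx hy]. eauto 6.
Qed.
Lemma fun2_prod : fun2 (@prod). Proof. unfold prod. df. Qed.
Hint Resolve fun2_prod : dfdb.
Lemma prod_iff a b p : is_prod a b p <-> p = prod a b.
Proof.
  unfold is_prod. assert (K : forall q, (exists x y, x ∈ a /\ y ∈ b /\ is_pair x y q) <-> q ∈ prod a b).
  { intros q. rewrite in_prod. split; intros (x & y & h & k & l); exists x, y; repeat split; auto;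
      now apply pair_iff. }
  split.
  - intros h. apply set_ext. intros z. now rewrite (h z), K.
  - intros -> q. now rewrite K.
Qed.

Definition pi1 p := the (fun x => exists y, p = pair x y).
Definition pi2 p := the (fun y => exists x, p = pair x y).
Lemma pi1_pair x y : pi1 (pair x y) = x.
Proof. apply the_eq; eauto. intros z (t & e). now apply pair_inj in e as [-> _]. Qed.
Lemma pi2_pair x y : pi2 (pair x y) = y.
Proof. apply the_eq; eauto. intros z (t & e). now apply pair_inj in e as [_ ->]. Qed.
Lemma fun1_pi1 : fun1 (@pi1). Proof. unfold pi1. df. Qed.
Lemma fun1_pi2 : fun1 (@pi2). Proof. unfold pi2. df. Qed.
Hint Resolve fun1_pi1 fun1_pi2 : dfdb.

Definition ap f x := the (fun y => pair x y ∈ f).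
Lemma fun2_ap : fun2 (@ap). Proof. unfold ap. df. Qed.
Hint Resolve fun2_ap : dfdb.

Lemma family_app I f i y : is_family I f -> i ∈ I -> (app f i y <-> y = ap f i).
Proof.
  intros [h k] hi. destruct (k i hi) as (z & hz & uz).
  assert (e : ap f i = z).
  { apply the_eq; [now apply app_iff|]. intros t ht. symmetry. now apply uz, app_iff. }
  rewrite e. split.
  - intros hy. symmetry. now apply uz.
  - now intros ->.
Qed.

Lemma family_ap I f i : is_family I f -> i ∈ I -> app f i (ap f i).
Proof. intros h k. now apply (family_app I). Qed.

Lemma family_dom I f i y : is_family I f -> app f i y -> i ∈ I.
Proof.
  intros [h _] k. apply app_iff in k. destruct (h _ k) as (i' & y' & hi & e).
  apply pair_iff, pair_inj in e as [-> _]. auto.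
Qed.

Definition lam a (F : V -> V) := image a (fun x => pair x (F x)).
Lemma app_lam a F x y : fun1 F -> (app (lam a F) x y <-> x ∈ a /\ y = F x).
Proof.
  intros HF. rewrite app_iff. unfold lam. rewrite in_image by df. split.
  - intros (t & h & e). apply pair_inj in e as [-> ->]. auto.
  - intros [h ->]. eauto.
Qed.
Lemma lam_family a F : fun1 F -> is_family a (lam a F).
Proof.
  intros HF. split.
  - intros p hp. unfold lam in hp. rewrite in_image in hp by df. destruct hp as (x & hx & ->).
    exists x, (F x). split; auto. now apply pair_iff.
  - intros i hi. exists (F i). split; [now apply app_lam|]. intros y hy. now apply app_lam in hy as [_ ->].
Qed.
Lemma ap_lam a F x : fun1 F -> x ∈ a -> ap (lam a F) x = F x.
Proof.
  intros HF hx. symmetry. apply (family_app a); auto; [now apply lam_family|]. now apply app_lam.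
Qed.
Lemma tdef_lam (A : (nat -> V) -> V) (F : (nat -> V) -> V -> V) : tdef A ->
  tdef (fun e => F (fun n => e (S n)) (e 0)) -> tdef (fun e => lam (A e) (F e)).
Proof.
  intros HA HF. apply tdef_image; auto. apply (tdef_comp2 _ _ _ fun2_pair); auto. apply tdef_var.
Qed.

Lemma not_nonempty a : ~ nonempty a -> a = zero.
Proof.
  intros h. apply set_ext. intros z; split; intros k; exfalso; [apply h; now exists z | now apply in_zero in k].
Qed.

Lemma subset_antisym a b : a ⊆ b -> b ⊆ a -> a = b.
Proof. intros h k. apply set_ext. split; auto. Qed.

Lemma mem_irrefl x : ~ x ∈ x.
Proof.
  intros h. destruct (zf_foundation V (sing x)) as (y & hy & k).
  - exists x. now apply in_sing.
  - apply in_sing in hy. subst y. apply k. exists x. split; auto. now apply in_sing.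
Qed.

End BasicSets.

Global Hint Resolve def2_subset def1_nonempty def1_empty def2_disjoint def3_is_upair
  def3_is_pair def2_is_union def3_is_inter def3_is_diff def3_app def2_is_family def3_is_map def3_is_bijection def2_equipotent def1_inductive def1_is_omega def1_finite def2_is_topology
  def3_closed def2_covers def4_is_cylinder def4_projections_continuous def2_well_orders_rel
  fun2_upair fun1_union fun1_power fun1_sing fun2_cup fun2_cap fun2_diff fun2_pair
  fun2_prod fun1_pi1 fun1_pi2 fun2_ap : dfdb.

Ltac df_extra ::=
  match goal with
  | |- defn (fun e => well_orders (rel (@?F e)) (@?G e)) =>
      apply (defn_comp2 (fun r A => well_orders (rel r) A) F G def2_well_orders_rel)
  | |- tdef (fun e => lam (@?A e) (@?P e)) => apply (tdef_lam A P)
  end.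

(** * Finite sets *)

Section Finiteness.
Context {V : ZF_model}.
Implicit Types a b c x y z f p n w A B F : V.

Definition suc x := cup x (sing x).
Lemma in_suc x z : z ∈ suc x <-> z ∈ x \/ z = x.
Proof. unfold suc. now rewrite in_cup, in_sing. Qed.
Lemma fun1_suc : fun1 (@suc). Proof. unfold suc. df. Qed.
Hint Resolve fun1_suc : dfdb.

Lemma is_succ_iff x y : is_succ x y <-> y = suc x.
Proof.
  split.
  - intros h. apply set_ext. intros z. now rewrite (h z), in_suc.
  - intros -> z. apply in_suc.
Qed.

Lemma empty_iff x : empty x <-> x = zero.
Proof.
  split.
  - intros h. apply not_nonempty. intros [z hz]. exact (h z hz).
  - intros ->. exact in_zero.
Qed.

Lemma inductive_iff w : inductive_set w <-> zero ∈ w /\ forall x, x ∈ w -> suc x ∈ w.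
Proof.
  split; intros [h k]; split.
  - destruct h as (o & h & e). apply empty_iff in e. now subst.
  - intros x hx. destruct (k x hx) as (y & hy & e). apply is_succ_iff in e. now subst.
  - exists zero. split; auto. now apply empty_iff.
  - intros x hx. exists (suc x). split; auto. now apply is_succ_iff.
Qed.

Lemma omega_exists : exists w, @is_omega V w.
Proof.
  destruct (zf_infinity V) as (w0 & hw). change (inductive_set w0) in hw.
  exists (sep w0 (fun n => forall w, inductive_set w -> n ∈ w)). split.
  - apply inductive_iff in hw as [h k]. apply inductive_iff. split.
    + rewrite in_sep by df. split; auto. intros w hw'. now apply inductive_iff in hw' as [].
    + intros x hx. rewrite in_sep in * by df. destruct hx as [hx hx']. split; auto.
      intros w hw1. assert (hw2 := hw1). apply inductive_iff in hw2 as [_ hw2]. auto.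
  - intros w hw1 x hx. rewrite in_sep in hx by df. now apply hx.
Qed.

(** Minimality of [w] can only be applied to a set, hence the requirement [def1 P]. Being internal,
    this induction also reaches the non-standard members of [w]. *)
Lemma omega_ind w (P : V -> Prop) : is_omega w -> def1 P -> P zero ->
  (forall n, n ∈ w -> P n -> P (suc n)) -> forall n, n ∈ w -> P n.
Proof.
  intros [hw hm] hP h0 hs n hn.
  assert (k : w ⊆ sep w P).
  { apply inductive_iff in hw as [k0 ks]. apply hm, inductive_iff. split.
    - rewrite in_sep by df. auto.
    - intros x hx. rewrite in_sep in * by df. destruct hx. auto. }
  apply k in hn. rewrite in_sep in hn by df. tauto.
Qed.

Lemma equipotent_intro A B (R : V -> V -> Prop) : def2 R ->
  (forall x, x ∈ A -> exists y, y ∈ B /\ R x y) ->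
  (forall y, y ∈ B -> exists x, x ∈ A /\ R x y) ->
  (forall x y y', x ∈ A -> y ∈ B -> y' ∈ B -> R x y -> R x y' -> y = y') ->
  (forall x x' y, x ∈ A -> x' ∈ A -> y ∈ B -> R x y -> R x' y -> x = x') ->
  equipotent A B.
Proof.
  intros hR ht hs hf hi.
  exists (sep (prod A B) (fun p => exists x y, p = pair x y /\ R x y)).
  assert (K : forall x y, app (sep (prod A B) (fun p => exists x y, p = pair x y /\ R x y)) x y <->
    x ∈ A /\ y ∈ B /\ R x y).
  { intros x y. rewrite app_iff, in_sep by df. rewrite pair_in_prod. split.
    - intros [[hx hy] (x' & y' & e & r)]. apply pair_inj in e as [-> ->]. auto.
    - intros (hx & hy & r). eauto 6. }
  repeat split.
  - intros p hp. rewrite in_sep in hp by df. destruct hp as [hp _].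
    apply in_prod in hp as (x & y & hx & hy & ->). exists x, y. split; auto. now apply pair_iff.
  - intros x hx. destruct (ht x hx) as (y & hy & r). exists y. split; [now apply K|].
    intros y' hy'. apply K in hy' as (_ & hy' & r'). eauto.
  - intros x y h. now apply K in h.
  - intros x x' y h h'. apply K in h as (? & ? & ?), h' as (? & ? & ?). eauto.
  - intros y hy. destruct (hs y hy) as (x & hx & r). exists x. now apply K.
Qed.

Lemma equipotent_elim A B : equipotent A B -> exists f,
  (forall x, x ∈ A -> exists y, y ∈ B /\ app f x y) /\
  (forall y, y ∈ B -> exists x, x ∈ A /\ app f x y) /\
  (forall x y y', app f x y -> app f x y' -> y = y') /\
  (forall x x' y, app f x y -> app f x' y -> x = x').
Proof.
  intros (f & [hf hm] & hi & hs). exists f. repeat split; auto.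
  - intros x hx. exists (ap f x). assert (k := family_ap A f x hf hx). eauto.
  - intros y hy. destruct (hs y hy) as [x h]. exists x. split; auto. eapply family_dom; eauto.
  - intros x y y' h h'. assert (hx := family_dom _ _ _ _ hf h).
    apply (family_app A f) in h, h'; auto. congruence.
Qed.

Lemma fin_zero : @finite V zero.
Proof.
  destruct omega_exists as [w hw]. exists w, zero. split; auto. split.
  - destruct hw as [hw _]. now apply inductive_iff in hw as [].
  - apply (equipotent_intro _ _ (fun x y => x = y)); [df|..];
      intros x; intros; exfalso; eapply in_zero; eauto.
Qed.

Lemma fin_add F x : finite F -> finite (cup F (sing x)).
Proof.
  intros hF. destruct (classic (x ∈ F)) as [hx|hx].
  { replace (cup F (sing x)) with F; auto. apply set_ext. intros z. rewrite in_cup, in_sing.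
    split; [tauto|]. now intros [h | ->]. }
  destruct hF as (w & n & hw & hn & e). exists w, (suc n). split; auto. split.
  { destruct hw as [hw _]. apply inductive_iff in hw as [_ hw]. auto. }
  destruct (equipotent_elim _ _ e) as (f & ht & hs & hf & hi).
  apply (equipotent_intro _ _ (fun y z => (y ∈ F /\ z ∈ n /\ app f y z) \/ (y = x /\ z = n))); [df|..].
  - intros y hy. rewrite in_cup, in_sing in hy. destruct hy as [hy | ->].
    + destruct (ht y hy) as (z & hz & r). exists z. rewrite in_suc. auto.
    + exists n. rewrite in_suc. auto.
  - intros y hy. rewrite in_suc in hy. destruct hy as [hy | ->].
    + destruct (hs y hy) as (z & hz & r). exists z. rewrite in_cup. auto.
    + exists x. rewrite in_cup, in_sing. auto.
  - intros y z z' _ _ _ [(h1 & h2 & h3)|[-> ->]] [(k1 & k2 & k3)|[? ->]]; subst; auto; try tauto. eauto.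
  - intros y z z' _ _ _ [(h1 & h2 & h3)|[-> ->]] [(k1 & k2 & k3)|[-> ?]]; subst; auto;
      try (exfalso; now apply (mem_irrefl n)). eauto.
Qed.

Lemma fin_ind (P : V -> Prop) : def1 P -> P zero ->
  (forall F x, finite F -> P F -> ~ x ∈ F -> P (cup F (sing x))) ->
  forall F, finite F -> P F.
Proof.
  intros hP h0 hs F (w & n & hw & hn & e).
  (* The induction is on [n] for all [F] at once, since removing the preimage of [n] changes the
     set; [finite F] is carried along because a premise of the step asks for it. *)
  enough (K : forall n, n ∈ w -> forall F, equipotent F n -> finite F /\ P F) by (now apply (K n)).
  clear F n hn e. apply (omega_ind w (fun n => forall F, equipotent F n -> finite F /\ P F)); auto; [df| |].
  - intros F e. apply equipotent_elim in e as (f & ht & _).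
    replace F with (@zero V); [split; auto using fin_zero|].
    symmetry. apply not_nonempty. intros [x hx]. destruct (ht x hx) as (y & hy & _).
    now apply in_zero in hy.
  - intros n hn IH F e. apply equipotent_elim in e as (f & ht & hsu & hf & hi).
    destruct (hsu n) as (x & hx & hxn). { apply in_suc; auto. }
    destruct (IH (diff F (sing x))) as [hfin hPF].
    { apply (equipotent_intro _ _ (fun y z => app f y z)); [df|..].
      - intros y hy. rewrite in_diff, in_sing in hy. destruct hy as [hy hyx].
        destruct (ht y hy) as (z & hz & r). exists z. split; auto.
        apply in_suc in hz as [hz | ->]; auto. exfalso. eauto.
      - intros z hz. destruct (hsu z) as (y & hy & r). { apply in_suc; auto. }
        exists y. rewrite in_diff, in_sing. repeat split; auto. intros ->.
        assert (z = n) by eauto. subst. now apply (mem_irrefl n).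
      - eauto.
      - eauto. }
    assert (eF : F = cup (diff F (sing x)) (sing x)).
    { apply set_ext. intros z. rewrite in_cup, in_diff, in_sing.
      split; [tauto|]. intros [[h _] | ->]; auto. }
    rewrite eF. split; [now apply fin_add|]. apply hs; auto. rewrite in_diff, in_sing. tauto.
Qed.

Lemma fin_sing x : finite (sing x).
Proof.
  replace (sing x) with (cup zero (sing x)); [apply fin_add, fin_zero|].
  apply set_ext. intros z. rewrite in_cup. split; auto. intros [h|h]; auto. now apply in_zero in h.
Qed.

Lemma fin_at_most_one B : (forall y y', y ∈ B -> y' ∈ B -> y = y') -> finite B.
Proof.
  intros h. destruct (classic (nonempty B)) as [[x hx]|k].
  - replace B with (sing x); [apply fin_sing|]. apply set_ext. intros z. rewrite in_sing.
    split; [now intros -> | auto].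
  - rewrite (not_nonempty _ k). apply fin_zero.
Qed.

Lemma fin_subset F B : finite F -> B ⊆ F -> finite B.
Proof.
  intros hF. revert F hF B. apply (fin_ind (fun F => forall B, B ⊆ F -> finite B)); [df| |].
  - intros B h. replace B with (@zero V); [apply fin_zero|]. symmetry. apply not_nonempty.
    intros [x hx]. now apply h, in_zero in hx.
  - intros F x hF IH hx B hB.
    assert (K : finite (diff B (sing x))).
    { apply IH. intros z. rewrite in_diff, in_sing. intros [h k]. apply hB in h.
      rewrite in_cup, in_sing in h. tauto. }
    destruct (classic (x ∈ B)) as [h|h].
    + replace B with (cup (diff B (sing x)) (sing x)); [now apply fin_add|].
      apply set_ext. intros z. rewrite in_cup, in_diff, in_sing.
      split; [|tauto]. intros [[k _] | ->]; auto.
    + replace B with (diff B (sing x)); auto. apply set_ext. intros z. rewrite in_diff, in_sing.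
      split; [tauto|]. intros k. split; auto. now intros ->.
Qed.

Lemma fin_cup A B : finite A -> finite B -> finite (cup A B).
Proof.
  intros hA hB. revert B hB. apply (fin_ind (fun B => finite (cup A B))); [df| |].
  - replace (cup A zero) with A; auto. apply set_ext. intros z. rewrite in_cup.
    split; auto. intros [h|h]; auto. now apply in_zero in h.
  - intros F x _ IH _. replace (cup A (cup F (sing x))) with (cup (cup A F) (sing x)); [now apply fin_add|].
    apply set_ext. intros z. rewrite !in_cup. tauto.
Qed.

(** [R] may be partial, which suits coverings by finitely many sets each of which contains at most
    one point of [B]. *)
Lemma fin_relation F (R : V -> V -> Prop) : def2 R -> finite F ->
  (forall x y y', R x y -> R x y' -> y = y') ->
  forall B, (forall y, y ∈ B -> exists x, x ∈ F /\ R x y) -> finite B.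
Proof.
  intros hR hF hf. revert F hF.
  apply (fin_ind (fun F => forall B, (forall y, y ∈ B -> exists x, x ∈ F /\ R x y) -> finite B)); [df| |].
  - intros B h. replace B with (@zero V); [apply fin_zero|]. symmetry. apply not_nonempty.
    intros [y hy]. destruct (h y hy) as (x & hx & _). now apply in_zero in hx.
  - intros F x _ IH _ B hB.
    apply (fin_subset (cup (sep B (fun y => exists x, x ∈ F /\ R x y)) (sep B (R x)))).
    + apply fin_cup.
      * apply IH. intros y hy. rewrite in_sep in hy by df. tauto.
      * apply fin_at_most_one. intros y y' hy hy'. rewrite in_sep in * by df.
        destruct hy, hy'. eauto.
    + intros y hy. rewrite in_cup. rewrite !in_sep by df. destruct (hB y hy) as (x' & hx' & r).
      rewrite in_cup, in_sing in hx'. destruct hx' as [hx' | ->]; eauto 6.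
Qed.

Lemma fin_image F (G : V -> V) : fun1 G -> finite F -> finite (image F G).
Proof.
  intros hG hF. apply (fin_relation F (fun x y => y = G x)); [df|auto|congruence|].
  intros y hy. rewrite in_image in hy by df. exact hy.
Qed.

Lemma fin_union A : finite A -> (forall B, B ∈ A -> finite B) -> finite (union A).
Proof.
  intros hA. revert A hA. apply (fin_ind (fun A => (forall B, B ∈ A -> finite B) -> finite (union A))); [df| |].
  - intros _. replace (union zero) with (@zero V); [apply fin_zero|].
    apply set_ext. intros z. rewrite in_union. split; [intros h; now apply in_zero in h|].
    intros (y & hy & _). now apply in_zero in hy.
  - intros F x _ IH _ h. replace (union (cup F (sing x))) with (cup (union F) x).
    + apply fin_cup; [apply IH; intros; apply h; rewrite in_cup; auto|].
      apply h. rewrite in_cup, in_sing. auto.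
    + apply set_ext. intros z. rewrite in_cup, !in_union. split.
      * intros [(y & hy & hz)|hz]; [exists y | exists x]; rewrite in_cup, in_sing; auto.
      * intros (y & hy & hz). rewrite in_cup, in_sing in hy. destruct hy as [hy | ->]; eauto.
Qed.

Lemma fin_prod A B : finite A -> finite B -> finite (prod A B).
Proof.
  intros hA hB. apply (fin_subset (union (image A (fun x => image B (pair x))))).
  - apply fin_union; [apply fin_image; [df|auto]|].
    intros C hC. rewrite in_image in hC by df. destruct hC as (x & _ & ->). apply fin_image; [df|auto].
  - intros p hp. apply in_prod in hp as (x & y & hx & hy & ->). apply in_union.
    exists (image B (pair x)). split; rewrite in_image by df; eauto.
Qed.

Lemma fin_power A : finite A -> finite (power A).
Proof.
  revert A. apply (fin_ind (fun A => finite (power A))); [df| |].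
  - apply fin_at_most_one. intros y y' h h'. apply in_power in h, h'.
    assert (K : forall y, y ⊆ zero -> y = @zero V).
    { intros z hz. apply not_nonempty. intros [t ht]. now apply hz, in_zero in ht. }
    rewrite (K y h). symmetry. auto.
  - intros F x _ IH hx.
    apply (fin_subset (cup (power F) (image (power F) (fun B => cup B (sing x))))).
    + apply fin_cup; auto. apply fin_image; [df|auto].
    + intros B hB. apply in_power in hB. rewrite in_cup, in_power. rewrite in_image by df.
      assert (K : diff B (sing x) ⊆ F).
      { intros z. rewrite in_diff, in_sing. intros [h k]. apply hB in h. rewrite in_cup, in_sing in h. tauto. }
      destruct (classic (x ∈ B)) as [h|h].
      * right. exists (diff B (sing x)). rewrite in_power. split; auto.
        apply set_ext. intros z. rewrite in_cup, in_diff, in_sing.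
        split; [tauto|]. intros [[l _] | ->]; auto.
      * left. intros z hz. apply K. rewrite in_diff, in_sing. split; auto. now intros ->.
Qed.

(** In the compactness arguments [F] is a finite subcover and [O] a chain. Directedness replaces the
    choice of a member of [O] for every member of [F]. *)
Lemma fin_directed (Rl : V -> V -> Prop) F O : def2 Rl -> finite F -> nonempty O ->
  (forall a b, a ∈ O -> b ∈ O -> exists c, c ∈ O /\ forall x, Rl x a \/ Rl x b -> Rl x c) ->
  (forall x, x ∈ F -> exists a, a ∈ O /\ Rl x a) ->
  exists a, a ∈ O /\ forall x, x ∈ F -> Rl x a.
Proof.
  intros hR hF hO hd. revert F hF.
  apply (fin_ind (fun F => (forall x, x ∈ F -> exists a, a ∈ O /\ Rl x a) ->
    exists a, a ∈ O /\ forall x, x ∈ F -> Rl x a)); [df| |].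
  - intros _. destruct hO as [a ha]. exists a. split; auto. intros x hx. now apply in_zero in hx.
  - intros F x _ IH _ h. destruct IH as (a & ha & ka).
    { intros y hy. apply h. rewrite in_cup; auto. }
    destruct (h x) as (b & hb & kb). { rewrite in_cup, in_sing; auto. }
    destruct (hd a b ha hb) as (c & hc & kc). exists c. split; auto.
    intros y hy. rewrite in_cup, in_sing in hy. destruct hy as [hy | ->]; auto.
Qed.

End Finiteness.
Global Hint Resolve fun1_suc : dfdb.

(** * Well-orders *)

Section WellOrders.
Context {V : ZF_model}.
Implicit Types a b c x y z f p n w A B F K M S : V.

Lemma well_orders_ext (L L' : V -> V -> Prop) A :
  (forall x y, x ∈ A -> y ∈ A -> (L x y <-> L' x y)) -> well_orders L A -> well_orders L' A.
Proof.
  intros h (hi & ht & hc & hl). repeat split.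
  - intros x hx. rewrite <- h by auto. auto.
  - intros x y z hx hy hz. rewrite <- !h by auto. eauto.
  - intros x y hx hy. rewrite <- !h by auto. eauto.
  - intros S hS hn. destruct (hl S hS hn) as (m & hm & k). exists m. split; auto.
    intros x hx. rewrite <- h by auto. auto.
Qed.

Lemma well_orders_subset L A B : B ⊆ A -> well_orders L A -> well_orders L B.
Proof.
  intros h (hi & ht & hc & hl). repeat split; eauto.
  intros S hS hn. apply hl; auto. intros x hx. auto.
Qed.

Lemma well_orderable_intro (L : V -> V -> Prop) A : def2 L -> well_orders L A -> well_orderable A.
Proof.
  intros hL h. exists (sep (prod A A) (fun p => exists x y, p = pair x y /\ L x y)).
  revert h. apply well_orders_ext. intros x y hx hy.
  rewrite rel_iff, in_sep by df. rewrite pair_in_prod. split; eauto 6.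
  intros [_ (x' & y' & e & r)]. now apply pair_inj in e as [-> ->].
Qed.

Lemma well_orderable_subset A B : B ⊆ A -> well_orderable A -> well_orderable B.
Proof. intros h [r hr]. exists r. revert hr. now apply well_orders_subset. Qed.

Lemma well_orders_pull (L : V -> V -> Prop) A K (G : V -> V) : fun1 G ->
  (forall x, x ∈ K -> G x ∈ A) -> (forall x y, x ∈ K -> y ∈ K -> G x = G y -> x = y) ->
  well_orders L A -> well_orders (fun x y => L (G x) (G y)) K.
Proof.
  intros hG hm hinj (hi & ht & hc & hl). repeat split.
  - auto.
  - intros x y z hx hy hz. eauto.
  - intros x y hx hy. destruct (hc (G x) (G y)) as [h|[h|h]]; auto.
  - intros S hS [s hs]. destruct (hl (image S G)) as (m & hm' & k).
    + intros y hy. rewrite in_image in hy by df. destruct hy as (x & hx & ->). auto.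
    + exists (G s). rewrite in_image by df. eauto.
    + rewrite in_image in hm' by df. destruct hm' as (x & hx & ->). exists x. split; auto.
      intros y hy. destruct (k (G y)); auto. rewrite in_image by df. eauto.
Qed.

(** A single formula [rho] orders all fibres, so no well-order has to be chosen fibre by fibre. *)
Lemma well_orderable_lex K (pi : V -> V) (rho : V -> V -> Prop) : fun1 pi -> def2 rho ->
  well_orderable (image K pi) ->
  (forall c, well_orders rho (sep K (fun k => pi k = c))) -> well_orderable K.
Proof.
  intros hpi hrho [r (hi & ht & hc & hl)] hf.
  assert (ip : forall x, x ∈ K -> pi x ∈ image K pi) by (intros x hx; rewrite in_image by df; eauto).
  assert (is : forall x c, x ∈ sep K (fun k => pi k = c) <-> x ∈ K /\ pi x = c).
  { intros x c. now rewrite in_sep by df. }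
  apply (well_orderable_intro (fun x y => rel r (pi x) (pi y) \/ (pi x = pi y /\ rho x y))); [df|].
  repeat split.
  - intros x hx [h|[_ h]]; [now apply (hi (pi x)); auto|].
    destruct (hf (pi x)) as (hi' & _). apply (hi' x); auto. now apply is.
  - intros x y z hx hy hz [h|[e h]] [k|[e' k]].
    + left. apply (ht _ (pi y) _); auto.
    + left. now rewrite <- e'.
    + left. now rewrite e.
    + right. split; [congruence|]. destruct (hf (pi x)) as (_ & ht' & _).
      apply (ht' x y z); auto; apply is; split; auto; congruence.
  - intros x y hx hy. destruct (hc (pi x) (pi y)) as [h|[h|h]]; auto.
    destruct (hf (pi x)) as (_ & _ & hc' & _).
    destruct (hc' x y) as [k|[k|k]]; auto; apply is; auto.
  - intros S hS [s hs]. destruct (hl (image S pi)) as (m & hm & k).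
    { intros y hy. rewrite in_image in hy by df. destruct hy as (x & hx & ->). auto. }
    { exists (pi s). rewrite in_image by df. eauto. }
    rewrite in_image in hm by df. destruct hm as (x0 & hx0 & ->).
    destruct (hf (pi x0)) as (_ & _ & _ & hl').
    destruct (hl' (sep S (fun x => pi x = pi x0))) as (m & hm & k').
    { intros y hy. rewrite in_sep in hy by df. apply is. destruct hy. auto. }
    { exists x0. rewrite in_sep by df. auto. }
    rewrite in_sep in hm by df. destruct hm as [hm em]. exists m. split; auto.
    intros x hx. destruct (k (pi x)) as [e|e].
    + rewrite in_image by df. eauto.
    + destruct (k' x) as [e'|e']; auto; [rewrite in_sep by df; auto|]. right. right. split; congruence.
    + right. left. now rewrite em.
Qed.

(** Values are compared through their least preimages. The formula avoids naming these: some
    preimage of [y] precedes every preimage of [y']. *)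
Lemma well_orderable_image M (F : V -> V) : fun1 F -> well_orderable M -> well_orderable (image M F).
Proof.
  intros hF [r (hi & ht & hc & hl)].
  apply (well_orderable_intro (fun y y' => exists x, x ∈ M /\ F x = y /\
    forall x', x' ∈ M -> F x' = y' -> rel r x x')); [df|].
  assert (least : forall y, y ∈ image M F -> exists m, m ∈ M /\ F m = y /\
    forall x, x ∈ M -> F x = y -> m = x \/ rel r m x).
  { intros y hy. rewrite in_image in hy by df. destruct hy as (x & hx & ->).
    destruct (hl (sep M (fun z => F z = F x))) as (m & hm & k).
    - intros z hz. rewrite in_sep in hz by df. tauto.
    - exists x. rewrite in_sep by df. auto.
    - rewrite in_sep in hm by df. exists m. split; [tauto|]. split; [tauto|].
      intros z hz e. apply k. rewrite in_sep by df. auto. }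
  repeat split.
  - intros y hy (x & hx & e & h). apply (hi x); auto.
  - intros y1 y2 y3 _ _ h3 (x & hx & e & h) (x' & hx' & e' & h').
    exists x. repeat split; auto. intros z hz ez. apply (ht x x' z); auto.
  - intros y y' hy hy'. destruct (least y hy) as (m & hm & em & km).
    destruct (least y' hy') as (m' & hm' & em' & km').
    destruct (hc m m') as [h|[h|h]]; auto.
    + left. exists m. repeat split; auto. intros x hx e. destruct (km' x hx e) as [->|l]; auto.
      apply (ht m m' x); auto.
    + right. left. congruence.
    + right. right. exists m'. repeat split; auto. intros x hx e. destruct (km x hx e) as [->|l]; auto.
      apply (ht m' m x); auto.
  - intros S hS [y hy]. destruct (hl (sep M (fun x => F x ∈ S))) as (m & hm & k).
    + intros z hz. rewrite in_sep in hz by df. tauto.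
    + assert (hy' := hS _ hy). rewrite in_image in hy' by df. destruct hy' as (x & hx & ->).
      exists x. rewrite in_sep by df. auto.
    + rewrite in_sep in hm by df. destruct hm as [hm hm']. exists (F m). split; auto.
      intros z hz. destruct (classic (F m = z)) as [e|e]; auto. right. exists m. repeat split; auto.
      intros x hx ex. destruct (k x) as [->|l]; auto; [|now subst z].
      rewrite in_sep by df. split; auto. now rewrite ex.
Qed.

Lemma well_orderable_prod A B : well_orderable A -> well_orderable B -> well_orderable (prod A B).
Proof.
  intros hA [r hr].
  apply (well_orderable_lex _ pi1 (fun x y => rel r (pi2 x) (pi2 y))); [df|df| |].
  - revert hA. apply well_orderable_subset. intros x hx. rewrite in_image in hx by df.
    destruct hx as (p & hp & ->). apply in_prod in hp as (x & y & hx & hy & ->). now rewrite pi1_pair.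
  - intros c. apply (well_orders_pull (rel r) B); auto; [df| |].
    + intros x hx. rewrite in_sep in hx by df. destruct hx as [hx _].
      apply in_prod in hx as (y & z & hy & hz & ->). now rewrite pi2_pair.
    + intros x x' hx hx'. rewrite in_sep in * by df. destruct hx as [hx e], hx' as [hx' e'].
      apply in_prod in hx as (y & z & hy & hz & ->). apply in_prod in hx' as (y' & z' & hy' & hz' & ->).
      rewrite pi1_pair in *. rewrite !pi2_pair. congruence.
Qed.

Lemma fin_well_orderable F : finite F -> well_orderable F.
Proof.
  revert F. apply (fin_ind (fun F => well_orderable F)); [unfold well_orderable; df| |].
  - exists zero. repeat split.
    + intros x hx. now apply in_zero in hx.
    + intros x y z hx. now apply in_zero in hx.
    + intros x y hx. now apply in_zero in hx.
    + intros S hS [s hs]. now apply hS, in_zero in hs.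
  - intros F x _ [r (hi & ht & hc & hl)] hx.
    apply (well_orderable_intro (fun y z => (y ∈ F /\ z ∈ F /\ rel r y z) \/ (y ∈ F /\ z = x))); [df|].
    repeat split.
    + intros y hy [(h & _ & k)|[h e]]; [eapply hi; eauto|congruence].
    + intros y z t hy hz h't [(h1 & h2 & h3)|[h1 ->]] [(k1 & k2 & k3)|[k1 ->]]; try tauto.
      left. eauto 6.
    + intros y z hy hz. rewrite in_cup, in_sing in hy, hz. destruct hy as [hy| ->], hz as [hz| ->]; auto.
      destruct (hc y z) as [h|[h|h]]; auto 7.
    + intros S hS [s hs]. destruct (classic (nonempty (cap S F))) as [hn|hn].
      * destruct (hl (cap S F)) as (m & hm & k); auto.
        { intros z hz. now apply in_cap in hz. }
        apply in_cap in hm as [hm hm']. exists m. split; auto. intros z hz.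
        assert (hz' := hS z hz). rewrite in_cup, in_sing in hz'. destruct hz' as [hz' | ->]; auto.
        destruct (k z); auto. apply in_cap; auto.
      * assert (K : forall z, z ∈ S -> z = x).
        { intros z hz. assert (hz' := hS z hz). rewrite in_cup, in_sing in hz'. destruct hz' as [hz' | ]; auto.
          exfalso. apply hn. exists z. apply in_cap; auto. }
        exists s. split; auto. intros z hz. left. rewrite (K s hs). symmetry; auto.
Qed.

Definition least_of (r S : V) : V := the (fun m => m ∈ S /\ forall x, x ∈ S -> m = x \/ rel r m x).
Lemma fun2_least_of : fun2 least_of. Proof. unfold least_of. df. Qed.
Hint Resolve fun2_least_of : dfdb.

Lemma least_spec r A S : well_orders (rel r) A -> S ⊆ A -> nonempty S ->
  least_of r S ∈ S /\ forall x, x ∈ S -> least_of r S = x \/ rel r (least_of r S) x.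
Proof.
  intros (hi & ht & hc & hl) hS hn. apply (the_spec (fun m => m ∈ S /\ forall x, x ∈ S -> m = x \/ rel r m x)).
  destruct (hl S hS hn) as (m & hm & k). exists m. repeat split; auto.
  intros z [hz kz]. destruct (k z hz) as [e|e]; auto. destruct (kz m hm) as [e'|e']; auto.
  exfalso. apply (hi m); auto. apply (ht m z m); auto.
Qed.

(** The well-orders of a fibre, taken as relations on that fibre, form a finite non-empty set
    [LO c]. [WOAC_fin] picks one for all keys simultaneously, and the lexicographic order does the
    rest. *)
Lemma finite_to_one_well_orderable M (key : V -> V) : @WOAC_fin V -> fun1 key ->
  well_orderable (image M key) -> (forall c, finite (sep M (fun x => key x = c))) ->
  well_orderable M.
Proof.
  intros AC hk hw hf.
  set (LO := fun c => sep (power (prod (sep M (fun x => key x = c)) (sep M (fun x => key x = c))))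
    (fun r => well_orders (rel r) (sep M (fun x => key x = c)))).
  assert (hLO : fun1 LO) by (unfold LO; df).
  destruct (classic (nonempty M)) as [[m0 hm0]|hn].
  2:{ rewrite (not_nonempty _ hn). apply fin_well_orderable, fin_zero. }
  destruct (AC (image (image M key) LO)) as (g & hg & hg').
  - now apply well_orderable_image.
  - exists (LO (key m0)). rewrite in_image by df. exists (key m0). rewrite in_image by df. eauto.
  - intros x hx. rewrite in_image in hx by df. destruct hx as (c & _ & ->). split.
    + destruct (fin_well_orderable _ (hf c)) as [r hr].
      (* A well-order found for the fibre may contain pairs from outside; it is cut down to the
         fibre so as to belong to [LO c]. *)
      exists (sep (prod (sep M (fun x => key x = c)) (sep M (fun x => key x = c))) (fun p => p ∈ r)).
      unfold LO. rewrite in_sep by df. rewrite in_power. split.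
      * intros p hp. rewrite in_sep in hp by df. tauto.
      * revert hr. apply well_orders_ext. intros x y hx hy. rewrite !rel_iff. rewrite in_sep by df.
        rewrite pair_in_prod. tauto.
    + apply (fin_subset (power (prod (sep M (fun x => key x = c)) (sep M (fun x => key x = c))))).
      * now apply fin_power, fin_prod.
      * intros r hr. unfold LO in hr. rewrite in_sep in hr by df. tauto.
  - apply (well_orderable_lex M key (fun x y => rel (ap g (LO (key x))) x y)); auto; [df|].
    intros c. destruct (classic (nonempty (sep M (fun x => key x = c)))) as [[m hm]|hn].
    + assert (kc : c ∈ image M key).
      { rewrite in_sep in hm by df. rewrite in_image by df. destruct hm; eauto. }
      assert (hr : ap g (LO c) ∈ LO c).
      { apply hg'. apply (family_ap (image (image M key) LO)); auto. rewrite in_image by df. eauto. }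
      unfold LO at 2 in hr. rewrite in_sep in hr by df. destruct hr as [_ hr]. revert hr.
      apply well_orders_ext. intros x y hx hy. rewrite in_sep in hx by df. destruct hx as [_ ->]. tauto.
    + apply not_nonempty in hn. rewrite hn. repeat split.
      * intros x hx. now apply in_zero in hx.
      * intros x y z hx. now apply in_zero in hx.
      * intros x y hx. now apply in_zero in hx.
      * intros S hS [s hs]. now apply hS, in_zero in hs.
Qed.

End WellOrders.
Global Hint Resolve fun2_least_of : dfdb.

(** * Towers *)

Section Towers.
Context {V : ZF_model}.
Implicit Types B C D M X : V.

Definition admissible (phi : V -> V) (A : V) : Prop :=
  (forall C, C ∈ A -> phi C ∈ A) /\ forall B, B ⊆ A -> union B ∈ A.

(** The substitute, in the manner of Zermelo and Bourbaki, for iterating [phi] along the ordinals.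
    Limit stages are unions, and the empty set enters as the union of the empty subfamily, so
    [admissible] has no base clause. *)
Definition tower X (phi : V -> V) : V :=
  sep (power X) (fun C => forall A, admissible phi A -> C ∈ A).

Section Tower.
Context (X : V) (phi : V -> V).
Hypothesis phi_def : fun1 phi.
Hypothesis phi_infl : forall C, C ⊆ X -> C ⊆ phi C.
Hypothesis phi_sub : forall C, C ⊆ X -> phi C ⊆ X.

Lemma def1_admissible : def1 (admissible phi).
Proof. unfold admissible. df. Qed.
Hint Resolve def1_admissible : dfdb.

Lemma in_tower C : C ∈ tower X phi <-> C ⊆ X /\ forall A, admissible phi A -> C ∈ A.
Proof. unfold tower. rewrite in_sep by df. now rewrite in_power. Qed.

Lemma tower_sub C : C ∈ tower X phi -> C ⊆ X.
Proof. intros h. now apply in_tower in h. Qed.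

Lemma tower_step C : C ∈ tower X phi -> phi C ∈ tower X phi.
Proof.
  intros h. apply in_tower in h as [h k]. apply in_tower. split; auto.
  intros A hA. assert (hA' := hA). destruct hA'. auto.
Qed.

Lemma tower_union B : B ⊆ tower X phi -> union B ∈ tower X phi.
Proof.
  intros h. apply in_tower. split.
  - intros x hx. apply in_union in hx as (C & hC & hx). apply h, tower_sub in hC. auto.
  - intros A hA. assert (hA' := hA). destruct hA' as [_ hA']. apply hA'. intros C hC.
    apply h, in_tower in hC as [_ hC]. auto.
Qed.

Lemma tower_ind (P : V -> Prop) : def1 P ->
  (forall C, C ∈ tower X phi -> P C -> P (phi C)) ->
  (forall B, B ⊆ tower X phi -> (forall C, C ∈ B -> P C) -> P (union B)) ->
  forall C, C ∈ tower X phi -> P C.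
Proof.
  intros hP h1 h2 C hC. assert (hC' := hC). apply in_tower in hC' as [_ hC'].
  specialize (hC' (sep (tower X phi) P)). rewrite in_sep in hC' by df. apply hC'. split.
  - intros D hD. rewrite in_sep in * by df. destruct hD. split; auto. now apply tower_step.
  - intros B hB. rewrite in_sep by df. split.
    + apply tower_union. intros D hD. apply hB in hD. rewrite in_sep in hD by df. tauto.
    + apply h2; intros D hD; apply hB in hD; rewrite in_sep in hD by df; tauto.
Qed.

Let good C := forall D, D ∈ tower X phi -> D ⊆ C -> D <> C -> phi D ⊆ C.

(** Tower induction on [D]: from a proper subset of [C], goodness keeps the next stage inside [C];
    from [C] itself the next stage is [phi C]; a union lies inside [C] unless some member has
    already passed [phi C]. *)
Lemma good_cmp C : C ∈ tower X phi -> good C -> forall D, D ∈ tower X phi -> D ⊆ C \/ phi C ⊆ D.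
Proof.
  intros hC g. apply (tower_ind (fun D => D ⊆ C \/ phi C ⊆ D)); [df| |].
  - intros D hD [h|h].
    + destruct (classic (D = C)) as [->|n]; [right; intros x; auto | left; now apply g].
    + right. intros x hx. apply phi_infl; auto. now apply tower_sub.
  - intros B hB h. destruct (classic (exists D, D ∈ B /\ phi C ⊆ D)) as [(D & hD & k)|n].
    + right. intros x hx. apply in_union. eauto.
    + left. intros x hx. apply in_union in hx as (D & hD & hx). destruct (h D hD) as [k|k]; auto.
      exfalso; eauto.
Qed.

Lemma all_good C : C ∈ tower X phi -> good C.
Proof.
  apply (tower_ind good); [unfold good; df| |].
  - intros D hD g E hE h n. destruct (good_cmp D hD g E hE) as [k|k].
    + destruct (classic (E = D)) as [->|n']; [intros x; auto|].
      intros x hx. apply phi_infl; [now apply tower_sub|]. now apply (g E).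
    + exfalso. apply n. now apply subset_antisym.
  - intros B hB h D hD k n.
    destruct (classic (exists C, C ∈ B /\ D ⊆ C)) as [(E & hE & l)|m].
    + destruct (classic (D = E)) as [->|n'].
      * destruct (good_cmp E hD (h E hE) (union B) (tower_union B hB)) as [l'|l']; auto.
        exfalso. apply n. now apply subset_antisym.
      * intros x hx. apply in_union. exists E. split; auto. now apply (h E hE D).
    + exfalso. apply n. apply subset_antisym; auto. intros x hx. apply in_union in hx as (E & hE & hx).
      destruct (good_cmp E (hB _ hE) (h E hE) D hD) as [l|l]; [exfalso; eauto|].
      apply l, phi_infl; auto. now apply tower_sub, hB.
Qed.

Lemma tower_lt C D : C ∈ tower X phi -> D ∈ tower X phi -> D ⊆ C -> D <> C -> phi D ⊆ C.
Proof. intros hC hD. now apply all_good. Qed.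

Lemma tower_chain C D : C ∈ tower X phi -> D ∈ tower X phi -> C ⊆ D \/ D ⊆ C.
Proof.
  intros hC hD. destruct (good_cmp C hC (all_good C hC) D hD) as [h|h]; auto.
  left. intros x hx. apply h, phi_infl; auto. now apply tower_sub.
Qed.

Lemma tower_fixpoint_top C D : C ∈ tower X phi -> phi C ⊆ C -> D ∈ tower X phi -> D ⊆ C.
Proof.
  intros hC h. revert D. apply (tower_ind (fun D => D ⊆ C)); [df| |].
  - intros D hD k. destruct (classic (D = C)) as [->|n]; auto. now apply tower_lt.
  - intros B hB k x hx. apply in_union in hx as (D & hD & hx). now apply (k D).
Qed.

Lemma tower_top : union (tower X phi) ∈ tower X phi /\ phi (union (tower X phi)) ⊆ union (tower X phi).
Proof.
  assert (h : union (tower X phi) ∈ tower X phi) by (apply tower_union; intros x; auto).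
  split; auto. intros x hx. apply in_union. exists (phi (union (tower X phi))). split; auto.
  now apply tower_step.
Qed.

(** Let [B] be the set of stages below all of [S]; its union is again such a stage. Were it not in
    [S], its successor would also lie below all of [S] by [tower_lt], so it would be a fixed point,
    hence the top of the tower, hence equal to any element of [S]. *)
Lemma tower_well_ordered : well_orders (fun C D => C ⊆ D /\ C <> D) (tower X phi).
Proof.
  repeat split.
  - intros C _ [_ h]. auto.
  - destruct H2 as [h2 _], H3 as [h3 _]. intros t ht. auto.
  - intros ->. destruct H2 as [h2 n2], H3 as [h3 n3]. apply n2. now apply subset_antisym.
  - intros C D hC hD. destruct (classic (C = D)); auto.
    destruct (tower_chain C D hC hD); auto.
  - intros S hS [s hs].
    set (B := sep (tower X phi) (fun C => forall D, D ∈ S -> C ⊆ D)).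
    assert (hB : forall C, C ∈ B <-> C ∈ tower X phi /\ forall D, D ∈ S -> C ⊆ D).
    { intros C. unfold B. now rewrite in_sep by df. }
    assert (hU : union B ∈ tower X phi) by (apply tower_union; intros C hC; now apply hB in hC).
    assert (hle : forall D, D ∈ S -> union B ⊆ D).
    { intros D hD x hx. apply in_union in hx as (C & hC & hx). apply hB in hC as [_ hC]. now apply (hC D). }
    destruct (classic (union B ∈ S)) as [h|h].
    + exists (union B). split; auto. intros D hD. destruct (classic (union B = D)); auto.
    + exfalso. apply h. replace (union B) with s; auto. apply subset_antisym; [|now apply hle].
      apply tower_fixpoint_top; auto. intros x hx. apply in_union.
      exists (phi (union B)). split; auto. apply hB. split; [now apply tower_step|].
      intros D hD. apply tower_lt; auto. intros e. apply h. now rewrite e.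
Qed.

End Tower.

(** [phi] adjoins the least element of [M] that preserves [Fam], if there is one, so the well-order
    of [M] does the work of choice. Every step gains at most one point, and the top of the tower
    admits no further point. The empty chain supplies the start [Fam zero]. *)
Lemma zorn_well_orderable M (Fam : V -> Prop) : well_orderable M -> def1 Fam ->
  (forall B, (forall C, C ∈ B -> C ⊆ M /\ Fam C) ->
     (forall C D, C ∈ B -> D ∈ B -> C ⊆ D \/ D ⊆ C) -> Fam (union B)) ->
  exists p, p ⊆ M /\ Fam p /\ forall m, m ∈ M -> Fam (cup p (sing m)) -> m ∈ p.
Proof.
  intros [r hr] hF hc.
  set (phi := fun C => cup C (sep M (fun m => ~ m ∈ C /\ Fam (cup C (sing m)) /\
    forall m', m' ∈ M -> ~ m' ∈ C -> Fam (cup C (sing m')) -> m = m' \/ rel r m m'))).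
  assert (phi_def : fun1 phi) by (unfold phi; df).
  assert (phiE : forall C x, x ∈ phi C <-> x ∈ C \/ x ∈ M /\ ~ x ∈ C /\ Fam (cup C (sing x)) /\
    forall m', m' ∈ M -> ~ m' ∈ C -> Fam (cup C (sing m')) -> x = m' \/ rel r x m').
  { intros C x. unfold phi. rewrite in_cup. now rewrite in_sep by df. }
  assert (i1 : forall C, C ⊆ M -> C ⊆ phi C) by (intros C _ x hx; apply phiE; auto).
  assert (i2 : forall C, C ⊆ M -> phi C ⊆ M).
  { intros C h x hx. apply phiE in hx as [hx|[hx _]]; auto. }
  assert (uniq : forall C x y, x ∈ phi C -> y ∈ phi C -> ~ x ∈ C -> ~ y ∈ C -> x = y).
  { intros C x y hx hy nx ny. apply phiE in hx, hy. destruct hx as [hx|(hx & _ & hx1 & hx2)]; [tauto|].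
    destruct hy as [hy|(hy & _ & hy1 & hy2)]; [tauto|].
    destruct (hx2 y hy ny hy1) as [e|e]; auto. destruct (hy2 x hx nx hx1) as [e'|e']; auto.
    destruct hr as (hi & ht & _). exfalso. apply (hi x); auto. apply (ht x y x); auto. }
  assert (inF : forall C, C ∈ tower M phi -> Fam C).
  { apply tower_ind; auto.
    - intros C hC h. destruct (classic (exists x, x ∈ phi C /\ ~ x ∈ C)) as [(x & hx & nx)|n].
      + replace (phi C) with (cup C (sing x)).
        * apply phiE in hx. tauto.
        * apply set_ext. intros z. rewrite in_cup, in_sing. split.
          -- intros [k| ->]; auto. apply i1; auto. now apply (tower_sub M phi).
          -- intros hz. destruct (classic (z ∈ C)) as [|k]; auto. right. eauto.
      + replace (phi C) with C; auto. apply subset_antisym; [apply i1; now apply (tower_sub M phi)|].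
        intros z hz. apply NNPP. eauto.
    - intros B hB h. apply hc.
      + intros C hC. split; auto. apply (tower_sub M phi); auto.
      + intros C D hC hD. apply (tower_chain M phi); auto. }
  destruct (tower_top M phi) as [ht hfix]; auto.
  set (p := union (tower M phi)) in *. exists p.
  assert (hpM : p ⊆ M) by (now apply (tower_sub M phi)).
  repeat split; auto. intros m hm hFm. apply NNPP. intros hn.
  destruct hr as (_ & _ & _ & hl).
  destruct (hl (sep M (fun m => ~ m ∈ p /\ Fam (cup p (sing m))))) as (m0 & h0 & k0).
  { intros x hx. rewrite in_sep in hx by df. tauto. }
  { exists m. rewrite in_sep by df. auto. }
  rewrite in_sep in h0 by df. destruct h0 as (h0 & n0 & f0). apply n0, hfix, phiE. right.
  repeat split; auto. intros m' hm' nm' fm'. apply k0. rewrite in_sep by df. auto.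
Qed.

End Towers.

(** * Real numbers and metrics *)

Section BinaryOperations.
Context {V : ZF_model}.
Implicit Types A B C f x y z : V.

Definition op f x y : V := ap f (pair x y).
Lemma fun3_op : fun3 op. Proof. unfold op. df. Qed.

Lemma binop_app2 A B C f x y z : is_binop A B C f -> x ∈ A -> y ∈ B ->
  (app2 f x y z <-> z = op f x y).
Proof.
  intros (P & hP & hf & _) hx hy. apply prod_iff in hP. subst P. rewrite app2_iff.
  apply (family_app (prod A B)); auto. now apply pair_in_prod.
Qed.

Lemma binop_in A B C f x y : is_binop A B C f -> x ∈ A -> y ∈ B -> op f x y ∈ C.
Proof.
  intros hf hx hy. assert (h : app2 f x y (op f x y)) by (now apply (binop_app2 A B C)).
  destruct hf as (P & _ & _ & hf). apply app2_iff in h. eauto.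
Qed.

End BinaryOperations.
Global Hint Resolve fun3_op : dfdb.

Section Reals.
Context {V : ZF_model} (R : complete_ordered_field V).
Implicit Types a b c d e g h x y z : V.
Local Notation "0" := (r_zero R).
Local Notation "a + b" := (op (r_add R) a b).
Local Notation "a * b" := (op (r_mul R) a b).
Local Notation "a < b" := (rel (r_lt R) a b).
Local Notation Re := (real R).

Definition rle a b : Prop := a < b \/ a = b.
Local Notation "a <= b" := (rle a b).
Lemma def2_rle : def2 rle. Proof. unfold rle. df. Qed.
Hint Resolve def2_rle : dfdb.

Lemma zero_real : 0 ∈ Re. Proof. apply r_zero_in. Qed.
Lemma add_real a b : a ∈ Re -> b ∈ Re -> a + b ∈ Re.
Proof. intros; eapply binop_in; eauto using r_add_op. Qed.
Lemma mul_real a b : a ∈ Re -> b ∈ Re -> a * b ∈ Re.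
Proof. intros; eapply binop_in; eauto using r_mul_op. Qed.
Hint Resolve zero_real add_real mul_real : core.

Lemma add_iff a b c : a ∈ Re -> b ∈ Re -> (app2 (r_add R) a b c <-> c = a + b).
Proof. apply binop_app2 with Re, r_add_op. Qed.
Lemma mul_iff a b c : a ∈ Re -> b ∈ Re -> (app2 (r_mul R) a b c <-> c = a * b).
Proof. apply binop_app2 with Re, r_mul_op. Qed.

Lemma addC a b : a ∈ Re -> b ∈ Re -> a + b = b + a.
Proof.
  intros ha hb. assert (h : app2 (r_add R) a b (a + b)) by now apply add_iff.
  apply r_addC in h. now apply add_iff in h.
Qed.
Lemma addA a b c : a ∈ Re -> b ∈ Re -> c ∈ Re -> (a + b) + c = a + (b + c).
Proof.
  intros ha hb hc. symmetry. symmetry. apply add_iff; auto.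
  apply (r_addA V R a b c (a + b) (b + c)); apply add_iff; auto.
Qed.
Lemma add0 a : a ∈ Re -> a + 0 = a.
Proof. intros ha. symmetry. apply add_iff; auto. now apply r_add0. Qed.
Lemma add0l a : a ∈ Re -> 0 + a = a.
Proof. intros ha. rewrite addC; auto. now apply add0. Qed.
Lemma addN a : a ∈ Re -> exists b, b ∈ Re /\ a + b = 0.
Proof.
  intros ha. destruct (r_addN V R a ha) as (b & hb & h). exists b. split; auto.
  symmetry. now apply add_iff.
Qed.

Lemma lt_irrefl a : a ∈ Re -> ~ a < a. Proof. apply r_lt_irrefl. Qed.
Lemma lt_trans a b c : a ∈ Re -> b ∈ Re -> c ∈ Re -> a < b -> b < c -> a < c.
Proof. apply r_lt_trans. Qed.
Lemma lt_total a b : a ∈ Re -> b ∈ Re -> a < b \/ a = b \/ b < a.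
Proof. apply r_lt_total. Qed.
Lemma lt_add a b c : a ∈ Re -> b ∈ Re -> c ∈ Re -> a < b -> a + c < b + c.
Proof. intros ha hb hc h. apply (r_lt_add V R a b c); auto; apply add_iff; auto. Qed.
Lemma lt_addl a b c : a ∈ Re -> b ∈ Re -> c ∈ Re -> a < b -> c + a < c + b.
Proof. intros. rewrite (addC c a), (addC c b); auto. now apply lt_add. Qed.

Lemma le_refl a : a <= a. Proof. now right. Qed.
Lemma le_lt_trans a b c : a ∈ Re -> b ∈ Re -> c ∈ Re -> a <= b -> b < c -> a < c.
Proof. intros ha hb hc [h|<-]; auto. now apply lt_trans. Qed.
Lemma lt_le_trans a b c : a ∈ Re -> b ∈ Re -> c ∈ Re -> a < b -> b <= c -> a < c.
Proof. intros ha hb hc h [k|<-]; auto. now apply lt_trans with b. Qed.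
Lemma le_trans a b c : a ∈ Re -> b ∈ Re -> c ∈ Re -> a <= b -> b <= c -> a <= c.
Proof. intros ha hb hc h [k|<-]; auto. left. now apply le_lt_trans with b. Qed.
Lemma not_lt a b : a ∈ Re -> b ∈ Re -> (~ a < b <-> b <= a).
Proof.
  intros ha hb. split.
  - intros h. destruct (lt_total a b) as [k|[k|k]]; auto; [tauto|right; auto|left; auto].
  - intros h k. apply (lt_irrefl a); auto. now apply (lt_le_trans a b a).
Qed.
Lemma not_le a b : a ∈ Re -> b ∈ Re -> (~ a <= b <-> b < a).
Proof. intros ha hb. rewrite <- not_lt by auto. split; [apply NNPP | tauto]. Qed.

Lemma add_lt_lt a b c d : a ∈ Re -> b ∈ Re -> c ∈ Re -> d ∈ Re -> a < b -> c < d -> a + c < b + d.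
Proof.
  intros. apply (lt_trans _ (b + c)); auto; [now apply lt_add | now apply lt_addl].
Qed.
Lemma add_le_le a b c d : a ∈ Re -> b ∈ Re -> c ∈ Re -> d ∈ Re -> a <= b -> c <= d -> a + c <= b + d.
Proof.
  intros ? ? ? ? [h|<-] [k|<-].
  - left. now apply add_lt_lt.
  - left. now apply lt_add.
  - left. now apply lt_addl.
  - apply le_refl.
Qed.
Lemma add_le_lt a b c d : a ∈ Re -> b ∈ Re -> c ∈ Re -> d ∈ Re -> a <= b -> c < d -> a + c < b + d.
Proof. intros ? ? ? ? [h|<-] k; [now apply add_lt_lt | now apply lt_addl]. Qed.
Lemma double_lt a b : a ∈ Re -> b ∈ Re -> (a + a < b + b <-> a < b).
Proof.
  intros ha hb. split; [|intros; now apply add_lt_lt].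
  intros h. destruct (lt_total a b) as [k|[->|k]]; auto.
  - exfalso. now apply (lt_irrefl (b + b)); auto.
  - exfalso. apply (lt_irrefl (a + a)); auto. apply (lt_trans _ (b + b)); auto. now apply add_lt_lt.
Qed.
Lemma sub_pos a b : a ∈ Re -> b ∈ Re -> a < b -> exists d, positive R d /\ a + d = b.
Proof.
  intros ha hb h. destruct (addN a ha) as (n & hn & e). exists (b + n). split; [split; auto|].
  - rewrite <- e. now apply lt_add.
  - rewrite (addC b n), <- addA, e; auto. now apply add0l.
Qed.

Lemma half_exists h : h ∈ Re -> exists g, g ∈ Re /\ g + g = h.
Proof.
  intros hh. set (one := r_one R). assert (h1 : one ∈ Re) by apply r_one_in.
  assert (h2 : one + one <> 0).
  { intros e. destruct (lt_total 0 one) as [k|[k|k]]; auto.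
    - apply (lt_irrefl 0); auto. rewrite <- e at 2. rewrite <- (add0 0) at 1; auto. now apply add_lt_lt.
    - now apply (r_one_neq_zero V R).
    - apply (lt_irrefl 0); auto. rewrite <- e at 1. rewrite <- (add0 0) at 1; auto. now apply add_lt_lt. }
  destruct (r_mulV V R (one + one)) as (c & hc & e); auto. exists (h * c). split; auto.
  assert (M1 : forall a, a ∈ Re -> a * one = a).
  { intros a ha. symmetry. apply mul_iff; auto. now apply r_mul1. }
  assert (MD : forall a b c, a ∈ Re -> b ∈ Re -> c ∈ Re -> a * b + a * c = a * (b + c)).
  { intros a b c' ha hb hc'. symmetry. apply add_iff; auto.
    apply (r_mulD V R a b c' (b + c')); try apply add_iff; try apply mul_iff; auto. }
  rewrite MD by auto.
  replace (c + c) with one; [now apply M1|].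
  rewrite <- (M1 c hc), MD by auto. apply mul_iff; auto. now apply r_mulC.
Qed.

Lemma unit_exists : exists u, positive R u.
Proof.
  assert (h1 := r_one_in V R). destruct (lt_total 0 (r_one R)) as [k|[k|k]]; auto.
  - exists (r_one R). now split.
  - exfalso. now apply (r_one_neq_zero V R).
  (* The sign of [r_one R] is not determined: were it negative, its opposite would serve. *)
  - destruct (sub_pos (r_one R) 0) as (d & hd & _); eauto.
Qed.

Lemma positive_add_lt a d : a ∈ Re -> positive R d -> a < a + d.
Proof. intros ha [hd k]. rewrite <- (add0 a) at 1; auto. now apply lt_addl. Qed.

Lemma half_pos h g : h ∈ Re -> g ∈ Re -> g + g = h -> positive R h -> positive R g.
Proof.
  intros hh hg e [_ k]. split; auto. apply double_lt; auto. rewrite add0, e; auto.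
Qed.

Lemma min_pos a b : positive R a -> positive R b -> exists c, positive R c /\ c <= a /\ c <= b.
Proof.
  intros ha hb. destruct (classic (a <= b)) as [h|h].
  - exists a. split; auto using le_refl.
  - apply not_le in h; try apply ha; try apply hb. exists b. repeat split; try apply hb; auto using le_refl.
    now left.
Qed.

(* The set of all [u / 2^n]. *)
Definition halves u : V := sep Re (fun e => forall H, H ⊆ Re -> u ∈ H ->
  (forall h g, h ∈ H -> g ∈ Re -> g + g = h -> g ∈ H) -> e ∈ H).

Section Halves.
Context (u : V) (hu : positive R u).
Local Notation E := (halves u).

Lemma in_halves e : e ∈ E <-> e ∈ Re /\ forall H, H ⊆ Re -> u ∈ H ->
  (forall h g, h ∈ H -> g ∈ Re -> g + g = h -> g ∈ H) -> e ∈ H.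
Proof. unfold halves. now rewrite in_sep by df. Qed.

Lemma halves_base : u ∈ E.
Proof. apply in_halves. destruct hu. auto. Qed.
Lemma halves_step h g : h ∈ E -> g ∈ Re -> g + g = h -> g ∈ E.
Proof.
  intros hh hg e. apply in_halves in hh as [hh k]. apply in_halves. split; auto.
  intros H h1 h2 h3. apply (h3 h); auto.
Qed.

Lemma halves_ind (P : V -> Prop) : def1 P -> P u ->
  (forall h g, h ∈ E -> P h -> g ∈ E -> g + g = h -> P g) -> forall e, e ∈ E -> P e.
Proof.
  intros hP h0 hs e he. assert (he' := he). apply in_halves in he' as [_ k].
  enough (K : e ∈ sep E P) by (rewrite in_sep in K by df; tauto). apply k.
  - intros x hx. rewrite in_sep in hx by df. destruct hx as [hx _]. now apply in_halves in hx.
  - rewrite in_sep by df. split; auto using halves_base.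
  - intros h g hh hg ee. rewrite in_sep in * by df. destruct hh as [hh hp].
    assert (g ∈ E) by (now apply (halves_step h)). eauto.
Qed.

Lemma halves_pos e : e ∈ E -> positive R e.
Proof.
  revert e. apply halves_ind; auto; [unfold positive; df|].
  intros h g hh hp hg e. apply (half_pos h); auto; [apply hp|]. now apply in_halves in hg.
Qed.

Lemma halves_real e : e ∈ E -> e ∈ Re.
Proof. intros h. now apply halves_pos. Qed.
Hint Resolve halves_real : core.

(** The Archimedean property, from completeness. Otherwise the supremum [l] of the lower bounds of
    [E] is positive. As the half of each member of [E] is in [E], [l + l] is a lower bound too,
    against [l < l + l]. *)
Lemma halves_coinitial eps : positive R eps -> exists e, e ∈ E /\ e < eps.
Proof.
  intros he. apply NNPP. intros hn.
  set (S := sep Re (fun x => forall e, e ∈ E -> x <= e)).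
  assert (hS : forall x, x ∈ S <-> x ∈ Re /\ forall e, e ∈ E -> x <= e).
  { intros x. unfold S. now rewrite in_sep by df. }
  assert (hSe : eps ∈ S).
  { apply hS. split; [apply he|]. intros e h. apply not_lt; auto; [apply he|]. eauto. }
  destruct (r_complete V R S) as (l & hl & hub & hleast).
  - intros x hx. now apply hS in hx.
  - now exists eps.
  - exists u. split; [apply hu|]. intros x hx. apply hS in hx as [_ hx]. apply hx, halves_base.
  - change (forall x, x ∈ S -> x <= l) in hub.
    change (forall b, b ∈ Re -> (forall x, x ∈ S -> x <= b) -> l <= b) in hleast.
    assert (lpos : positive R l).
    { split; auto. apply (lt_le_trans _ eps); auto; apply he. }
    assert (hlE : forall e, e ∈ E -> l <= e).
    { intros e h. apply hleast; auto. intros x hx. apply hS in hx as [_ hx]. auto. }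
    assert (hll : l + l ∈ S).
    { apply hS. split; auto. intros e h. destruct (half_exists e) as (g & hg & eg); auto.
      rewrite <- eg. assert (l <= g) by (apply hlE, (halves_step e); auto). now apply add_le_le. }
    apply (lt_irrefl l); auto. apply (lt_le_trans _ (l + l)); auto. now apply positive_add_lt.
Qed.

Lemma pos_double h : positive R h -> h < h + h.
Proof. intros k. apply positive_add_lt; auto. apply k. Qed.

Lemma halves_le e : e ∈ E -> e <= u.
Proof.
  revert e. apply halves_ind; [df|apply le_refl|]. intros h g hh IH hg e.
  apply (le_trans _ h); auto; [apply hu|]. left. rewrite <- e. apply pos_double. now apply halves_pos.
Qed.

(** The halves are not indexed by exponents, so discreteness is derived from the closure definition.
    Induction on [h] shows that every larger member is at least [h + h]; [cmp] turns this into the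
    dichotomy by looking at the double of [e]. *)
Lemma halves_gap : forall h, h ∈ E -> forall e, e ∈ E -> h <= e \/ e + e <= h.
Proof.
  assert (cmp : forall h, h ∈ E -> (forall e, e ∈ E -> h < e -> h + h <= e) ->
    forall e, e ∈ E -> h <= e \/ e + e <= h).
  { intros h hh good. apply (halves_ind (fun e => h <= e \/ e + e <= h)); [df| |].
    - left. now apply halves_le.
    - intros f g hf IH hg e.
      destruct (classic (f <= h)) as [k|k]; [right; now rewrite e|].
      apply not_le in k; auto. left. apply good in k; auto. rewrite <- e in k.
      apply not_lt; auto. intros l. apply (double_lt g h) in l; auto. revert l. now apply not_lt; auto. }
  enough (K : forall h, h ∈ E -> forall e, e ∈ E -> h < e -> h + h <= e) by eauto.
  apply (halves_ind (fun h => forall e, e ∈ E -> h < e -> h + h <= e)); [df| |].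
  - intros e he k. exfalso. revert k. apply not_lt; auto; [apply hu|]. now apply halves_le.
  - intros h g hh good hg e f hf k. rewrite e. destruct (cmp h hh good f hf) as [l|l]; auto.
    exfalso. rewrite <- e in l. revert l. apply not_le; auto. now apply double_lt; auto.
Qed.

Lemma halves_max : well_orders (fun x y => y < x) E.
Proof.
  repeat split.
  - intros x hx. apply lt_irrefl; auto.
  - intros x y z hx hy hz h k. apply (lt_trans _ y); auto.
  - intros x y hx hy. destruct (lt_total x y) as [h|[h|h]]; auto.
  - intros S hS [s hs].
    (* [halves_ind] descends from [u], so the induction runs over a threshold [e] that some element
       of [S] reaches. If the threshold [h] is not reached but its half [g] is, the gap between [g]
       and [h] makes the element found a maximum. *)
    enough (K : forall e, e ∈ E -> (exists s, s ∈ S /\ e <= s) -> exists m, m ∈ S /\ forall x, x ∈ S -> x <= m).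
    { destruct (K s) as (m & hm & k); auto.
      { exists s. split; auto using le_refl. }
      exists m. split; auto. intros x hx. destruct (k x hx); auto. }
    apply (halves_ind (fun e => (exists s, s ∈ S /\ e <= s) -> exists m, m ∈ S /\ forall x, x ∈ S -> x <= m)); [df| |].
    + intros (t & ht & k). exists t. split; auto. intros x hx.
      apply (le_trans _ u); auto; [apply hu|]. now apply halves_le; auto.
    + intros h g hh IH hg e (t & ht & k).
      destruct (classic (exists s, s ∈ S /\ h <= s)) as [l|l]; auto.
      exists t. split; auto. intros x hx. apply (le_trans _ g); auto.
      destruct (halves_gap h hh x) as [m|m]; auto; [exfalso; eauto|].
      apply not_lt; auto. intros n. apply (double_lt g x) in n; auto. rewrite e in n.
      revert n. apply not_lt; auto.
Qed.
End Halves.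

(** All that is needed of the radii: they are positive, arbitrarily small and well-ordered. The
    order is reversed because they descend to 0. *)
Lemma gauge_exists : exists E, (forall e, e ∈ E -> positive R e) /\
  (forall eps, positive R eps -> exists e, e ∈ E /\ e < eps) /\
  well_orders (fun x y => y < x) E.
Proof.
  destruct unit_exists as [u hu]. exists (halves u).
  repeat split; try apply (halves_pos u hu); auto; try apply (halves_coinitial u hu); auto;
    apply (halves_max u hu).
Qed.

Definition dist d x y : V := op d x y.
Definition ball X d x e : V := sep X (fun y => dist d x y < e).
Definition cball X d x e : V := sep X (fun y => dist d x y <= e).
Definition mtop X d : V := sep (power X) (fun U => forall x, x ∈ U -> exists e,
  positive R e /\ ball X d x e ⊆ U).

Lemma def1_positive : def1 (positive R). Proof. unfold positive. df. Qed.
Hint Resolve def1_positive : dfdb.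
Lemma in_ball X d x e y : y ∈ ball X d x e <-> y ∈ X /\ dist d x y < e.
Proof. unfold ball. now rewrite in_sep by df. Qed.
Lemma in_cball X d x e y : y ∈ cball X d x e <-> y ∈ X /\ dist d x y <= e.
Proof. unfold cball. now rewrite in_sep by df. Qed.
Lemma fun2_mtop : fun2 mtop. Proof. unfold mtop, ball. df. Qed.
Hint Resolve fun2_mtop : dfdb.
Lemma in_mtop X d U : U ∈ mtop X d <-> U ⊆ X /\ forall x, x ∈ U -> exists e,
  positive R e /\ ball X d x e ⊆ U.
Proof. unfold mtop, ball. rewrite in_sep by df. now rewrite in_power. Qed.

Section Metric.
Context (X d : V) (hd : is_metric R X d).

Lemma dist_real x y : x ∈ X -> y ∈ X -> dist d x y ∈ Re.
Proof. intros. destruct hd as (h & _). eapply binop_in; eauto. Qed.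
Hint Resolve dist_real : core.
Lemma dist_app2 x y a : x ∈ X -> y ∈ X -> (app2 d x y a <-> a = dist d x y).
Proof. intros. destruct hd as (h & _). eapply binop_app2; eauto. Qed.
Lemma dist_xx x : x ∈ X -> dist d x x = 0.
Proof. intros h. symmetry. apply dist_app2; auto. destruct hd as (_ & _ & k & _). now apply k. Qed.
Lemma dist_zero x y : x ∈ X -> y ∈ X -> dist d x y = 0 -> x = y.
Proof. intros h h' e. destruct hd as (_ & _ & k & _). apply k; auto. now apply dist_app2. Qed.
Lemma dist_sym x y : x ∈ X -> y ∈ X -> dist d x y = dist d y x.
Proof. intros h h'. destruct hd as (_ & _ & _ & k & _). apply dist_app2; auto. apply k. now apply dist_app2. Qed.
Lemma dist_ge0 x y : x ∈ X -> y ∈ X -> 0 <= dist d x y.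
Proof. intros h h'. destruct hd as (_ & k & _). apply (k x y). now apply dist_app2. Qed.
Lemma dist_pos x y : x ∈ X -> y ∈ X -> x <> y -> positive R (dist d x y).
Proof.
  intros hx hy n. split; auto. destruct (dist_ge0 x y hx hy) as [h|h]; auto.
  exfalso. apply n, dist_zero; auto.
Qed.
Lemma dist_tri x y z : x ∈ X -> y ∈ X -> z ∈ X -> dist d x z <= dist d x y + dist d y z.
Proof.
  intros hx hy hz. destruct hd as (_ & _ & _ & _ & k).
  apply (k x y z (dist d x y) (dist d y z)); try apply dist_app2; auto. apply add_iff; auto.
Qed.

Lemma mtop_iff T : is_metric_topology R X d T <-> T = mtop X d.
Proof.
  assert (K : forall x e B, x ∈ X -> (is_ball R X d x e B <-> B = ball X d x e)).
  { intros x e B hx. assert (K : forall y, (y ∈ X /\ exists a, app2 d x y a /\ a < e) <-> y ∈ ball X d x e).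
    { intros y. rewrite in_ball. split; intros [hy k]; split; auto.
      - destruct k as (a & h & k). apply dist_app2 in h; auto. now subst.
      - exists (dist d x y). split; auto. now apply dist_app2. }
    split.
    - intros h. apply set_ext. intros y. now rewrite (h y), K.
    - intros -> y. now rewrite K. }
  assert (K' : forall U, U ∈ mtop X d <-> U ⊆ X /\
    forall x, x ∈ U -> exists eps B, positive R eps /\ is_ball R X d x eps B /\ B ⊆ U).
  { intros U. rewrite in_mtop. split; intros [h k]; split; auto; intros x hx.
    - destruct (k x hx) as (e & he & l). exists e, (ball X d x e). rewrite K; auto.
    - destruct (k x hx) as (e & B & he & hB & l). apply K in hB; auto. subst. eauto. }
  split.
  - intros h. apply set_ext. intros U. now rewrite (h U), K'.
  - intros -> U. apply K'.
Qed.

Lemma ball_open x e : x ∈ X -> e ∈ Re -> ball X d x e ∈ mtop X d.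
Proof.
  intros hx he. apply in_mtop. split; [intros y hy; now apply in_ball in hy|].
  intros y hy. apply in_ball in hy as [hy k]. apply sub_pos in k as (r & hr & e'); auto.
  exists r. split; auto. intros z hz. apply in_ball in hz as [hz k]. apply in_ball. split; auto.
  rewrite <- e'. apply (le_lt_trans _ (dist d x y + dist d y z)); auto using dist_tri.
  all: destruct hr; auto. now apply lt_addl; auto.
Qed.

Lemma cball_closed x e : x ∈ X -> e ∈ Re -> diff X (cball X d x e) ∈ mtop X d.
Proof.
  intros hx he. apply in_mtop. split; [intros y hy; now apply in_diff in hy|].
  intros y hy. rewrite in_diff, in_cball in hy. destruct hy as [hy k].
  assert (k' : e < dist d x y) by (apply not_le; auto; tauto). apply sub_pos in k' as (r & hr & e'); auto.
  destruct hr as [hr hr0].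
  exists r. split; [now split|]. intros z hz. apply in_ball in hz as [hz l].
  rewrite in_diff, in_cball. split; auto. intros [_ m].
  apply (lt_irrefl (dist d x y)); auto.
  apply (le_lt_trans _ (dist d x z + dist d z y)); auto using dist_tri.
  rewrite <- e'. apply add_le_lt; auto. now rewrite dist_sym.
Qed.

Lemma mtop_full : X ∈ mtop X d.
Proof.
  apply in_mtop. split; [intros x; auto|]. intros x hx. destruct unit_exists as [u hu].
  exists u. split; auto. intros y hy. now apply in_ball in hy.
Qed.

Lemma ball_mono x e e' : x ∈ X -> e ∈ Re -> e' ∈ Re -> e <= e' -> ball X d x e ⊆ ball X d x e'.
Proof.
  intros hx he he' h y hy. apply in_ball in hy as [hy k]. apply in_ball. split; auto.
  apply (lt_le_trans _ e); auto.
Qed.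

Lemma mtop_cap U W : U ∈ mtop X d -> W ∈ mtop X d -> cap U W ∈ mtop X d.
Proof.
  rewrite !in_mtop. intros [hU kU] [hW kW]. split.
  - intros x hx. apply in_cap in hx as [hx _]. auto.
  - intros x hx. apply in_cap in hx as [hx hx']. destruct (kU x hx) as (e & he & l), (kW x hx') as (e' & he' & l').
    destruct (min_pos e e' he he') as (c & hc & m & m'). exists c. split; auto.
    intros y hy. apply in_cap. split; [apply l|apply l'].
    + apply (ball_mono x c e); auto; try apply hc; apply he.
    + apply (ball_mono x c e'); auto; try apply hc; apply he'.
Qed.

Lemma center_ball x e : x ∈ X -> positive R e -> x ∈ ball X d x e.
Proof. intros hx [he h]. apply in_ball. rewrite dist_xx; auto. Qed.

Lemma totally_bounded_compact : compact X (mtop X d) -> totally_bounded R X d.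
Proof.
  intros hc eps he. destruct (hc (image X (fun x => ball X d x eps))) as (F & hF & fF & cF).
  - intros B hB. rewrite in_image in hB by (unfold ball; df). destruct hB as (x & hx & ->).
    apply ball_open; auto. apply he.
  - intros x hx. exists (ball X d x eps). split; [|now apply center_ball].
    rewrite in_image by (unfold ball; df). eauto.
  - exists F. repeat split; auto. intros B hB. apply hF in hB.
    rewrite in_image in hB by (unfold ball; df). destruct hB as (x & hx & ->).
    exists x. split; auto. intros y. rewrite in_ball. split; intros [hy k]; split; auto.
    + exists (dist d x y). split; auto. now apply dist_app2.
    + destruct k as (a & h & k). apply dist_app2 in h; auto. now subst.
Qed.

(* A ball of radius e/2 contains at most one point of an e-separated set. *)
Lemma finite_separated e B : totally_bounded R X d -> positive R e -> B ⊆ X ->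
  (forall x y, x ∈ B -> y ∈ B -> dist d x y < e -> x = y) -> finite B.
Proof.
  intros ht he hB hs. assert (he' := proj1 he). destruct (half_exists e he') as (h & hh & eh).
  assert (hp : positive R h) by (apply (half_pos e); auto).
  destruct (ht h hp) as (F & fF & bF & cF).
  apply (fin_relation F (fun b x => b ∈ F /\ x ∈ b /\ x ∈ B)); auto; [df| |].
  - intros b x y (hb & hxb & hx) (_ & hyb & hy). destruct (bF b hb) as (c & hc & ball).
    apply ball in hxb as [hx' (a & ha & la)], hyb as [hy' (a' & ha' & la')].
    apply dist_app2 in ha, ha'; auto. subst a a'. apply hs; auto.
    apply (le_lt_trans _ (dist d x c + dist d c y)); auto using dist_tri.
    rewrite <- eh. apply add_lt_lt; auto. now rewrite dist_sym.
  - intros x hx. destruct (cF x (hB x hx)) as (b & hb & k). eauto.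
Qed.

End Metric.

(** * Two-valued metrics on finite sets *)

Section Discrete.
Context (u : V) (hu : positive R u).
Implicit Types A p : V.

(** The case distinction is written with [the] rather than with a classical test, so that the metric
    is a definable function of the underlying set. *)
Definition dval (p : V) : V := the (fun v => (pi1 p = pi2 p /\ v = 0) \/ (pi1 p <> pi2 p /\ v = u)).
Lemma fun1_dval : fun1 dval. Proof. unfold dval. df. Qed.
Hint Resolve fun1_dval : dfdb.
Definition dm A : V := lam (prod A A) dval.
Lemma fun1_dm : fun1 dm. Proof. unfold dm. df. Qed.

Lemma dval_eq x : dval (pair x x) = 0.
Proof. apply the_eq; rewrite pi1_pair, pi2_pair; [auto|]. intros z [[_ h]|[h _]]; tauto. Qed.
Lemma dval_ne x y : x <> y -> dval (pair x y) = u.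
Proof. intros n. apply the_eq; rewrite pi1_pair, pi2_pair; [auto|]. intros z [[h _]|[_ h]]; tauto. Qed.
Lemma dval_real x y : dval (pair x y) ∈ Re.
Proof. destruct (classic (x = y)) as [->|n]; [rewrite dval_eq | rewrite dval_ne]; auto. apply hu. Qed.
Lemma dval_ge0 x y : 0 <= dval (pair x y).
Proof. destruct (classic (x = y)) as [->|n]; [rewrite dval_eq | rewrite dval_ne]; auto using le_refl. left. apply hu. Qed.
Lemma dval_le x y : dval (pair x y) <= u.
Proof. destruct (classic (x = y)) as [->|n]; [rewrite dval_eq | rewrite dval_ne]; auto using le_refl. left. apply hu. Qed.

Lemma dm_app2 A x y a : app2 (dm A) x y a <-> x ∈ A /\ y ∈ A /\ a = dval (pair x y).
Proof. rewrite app2_iff. unfold dm. rewrite app_lam by df. rewrite pair_in_prod. tauto. Qed.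

Lemma dm_metric A : is_metric R A (dm A).
Proof.
  repeat split.
  - exists (prod A A). split; [now apply prod_iff|]. split; [apply lam_family; df|].
    intros p v h. unfold dm in h. rewrite app_lam in h by df. destruct h as [h ->].
    apply in_prod in h as (x & y & _ & _ & ->). apply dval_real.
  - intros x y a h. apply dm_app2 in h as (_ & _ & ->). apply dval_ge0.
  - intros h. apply dm_app2 in h as (_ & _ & h). apply NNPP. intros n. rewrite dval_ne in h; auto.
    destruct hu as [hu1 hu2]. rewrite <- h in hu2. now apply (lt_irrefl 0).
  - intros ->. apply dm_app2. rewrite dval_eq. auto.
  - intros x y a h. apply dm_app2 in h as (hx & hy & ->). apply dm_app2. repeat split; auto.
    destruct (classic (x = y)) as [->|n]; auto. rewrite !dval_ne; auto.
  - intros x y z a b c s h k l m. apply dm_app2 in h as (hx & hy & ->), k as (_ & hz & ->), l as (_ & _ & ->).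
    apply add_iff in m; auto using dval_real. subst s.
    change (dval (pair x z) <= dval (pair x y) + dval (pair y z)).
    destruct (classic (x = y)) as [->|n].
    + rewrite dval_eq, add0l; auto using le_refl, dval_real.
    + rewrite (dval_ne x y n). rewrite <- (add0 (dval (pair x z))); auto using dval_real.
      apply add_le_le; auto using dval_real, dval_le, dval_ge0. apply hu.
Qed.

Lemma dm_mtop A U : U ∈ mtop A (dm A) <-> U ⊆ A.
Proof.
  rewrite in_mtop. split; [tauto|]. intros h. split; auto. intros x hx. exists u. split; auto.
  intros y hy. apply in_ball in hy as [hy k].
  assert (e : dist (dm A) x y = dval (pair x y)).
  { symmetry. apply (dist_app2 A _ (dm_metric A)); auto. now apply dm_app2; auto. }
  rewrite e in k. destruct (classic (x = y)) as [->|n]; auto. rewrite dval_ne in k; auto.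
  exfalso. apply (lt_irrefl u); auto. apply hu.
Qed.

Lemma dm_scattered A : metric_scattered R A (dm A).
Proof.
  exists (mtop A (dm A)). split; [apply mtop_iff; auto using dm_metric|].
  intros B hB [x hx]. exists x, (sing x). split.
  - apply dm_mtop. intros y hy. apply in_sing in hy. subst. auto.
  - intros y. rewrite in_sing. split; [tauto|]. now intros ->.
Qed.

Lemma finite_compact A (T : V) : finite A -> compact A T.
Proof.
  intros hA O hO. revert A hA. apply (fin_ind (fun A => covers O A -> exists F, F ⊆ O /\ finite F /\ covers F A)); [df| |].
  - intros _. exists zero. repeat split.
    + intros x hx. now apply in_zero in hx.
    + apply fin_zero.
    + intros x hx. now apply in_zero in hx.
  - intros F x _ IH _ hc. destruct IH as (G & h1 & h2 & h3).
    { intros y hy. apply hc. rewrite in_cup. auto. }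
    destruct (hc x) as (U & hU & hx). { rewrite in_cup, in_sing. auto. }
    exists (cup G (sing U)). repeat split.
    + intros W hW. rewrite in_cup, in_sing in hW. destruct hW as [hW| ->]; auto.
    + now apply fin_add.
    + intros y hy. rewrite in_cup, in_sing in hy. destruct hy as [hy| ->].
      * destruct (h3 y hy) as (W & hW & k). exists W. rewrite in_cup. auto.
      * exists U. rewrite in_cup, in_sing. auto.
Qed.

Lemma dm_compact A : finite A -> metric_compact R A (dm A).
Proof.
  intros h. exists (mtop A (dm A)). split; [apply mtop_iff; auto using dm_metric|]. now apply finite_compact.
Qed.

End Discrete.
End Reals.
Global Hint Resolve def2_rle def1_positive fun2_mtop fun1_dm : dfdb.

(** * Cantor-Bendixson derivatives *)

Section CantorBendixson.
Context {V : ZF_model}.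
Implicit Types X Y T C D U W x y z : V.

(** [C] consists of the points already removed from [Y], and those isolated in the remainder are
    added. Working with removed parts makes the operation inflationary, as a tower requires. *)
Definition cbstep Y T C : V := cup C (sep Y (fun x =>
  exists U, U ∈ T /\ forall y, y ∈ U /\ y ∈ diff Y C <-> y = x)).
Lemma fun3_cbstep : fun3 cbstep. Proof. unfold cbstep. df. Qed.
Hint Resolve fun3_cbstep : dfdb.

(* The complements in [Y] of the members are the iterated derivatives of [Y]. *)
Definition cbtower Y T : V := tower Y (cbstep Y T).
Lemma fun2_cbtower : fun2 cbtower. Proof. unfold cbtower, tower, admissible. df. Qed.
Hint Resolve fun2_cbtower : dfdb.

Lemma in_cbstep Y T C x : x ∈ cbstep Y T C <-> x ∈ C \/ x ∈ Y /\
  exists U, U ∈ T /\ forall y, y ∈ U /\ y ∈ diff Y C <-> y = x.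
Proof. unfold cbstep. rewrite in_cup. now rewrite in_sep by df. Qed.

Section Fixed.
Context (Y T : V).

Lemma cbstep_def : fun1 (cbstep Y T). Proof. df. Qed.
Lemma cbstep_infl C : C ⊆ Y -> C ⊆ cbstep Y T C.
Proof. intros _ x hx. apply in_cbstep. auto. Qed.
Lemma cbstep_sub C : C ⊆ Y -> cbstep Y T C ⊆ Y.
Proof. intros h x hx. apply in_cbstep in hx as [hx|[hx _]]; auto. Qed.
Hint Resolve cbstep_def cbstep_infl cbstep_sub : core.

Lemma cbtower_chain C D : C ∈ cbtower Y T -> D ∈ cbtower Y T -> C ⊆ D \/ D ⊆ C.
Proof. apply tower_chain; auto. Qed.
Lemma cbtower_sub C : C ∈ cbtower Y T -> C ⊆ Y.
Proof. apply tower_sub; auto. Qed.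
Lemma cbtower_step C : C ∈ cbtower Y T -> cbstep Y T C ∈ cbtower Y T.
Proof. apply tower_step; auto. Qed.
Lemma cbtower_union B : B ⊆ cbtower Y T -> union B ∈ cbtower Y T.
Proof. apply tower_union; auto. Qed.
Lemma cbtower_well_ordered : well_orders (fun C D => C ⊆ D /\ C <> D) (cbtower Y T).
Proof. apply tower_well_ordered; auto. Qed.

(** Derivatives are relatively closed: the neighbourhood isolating a newly removed [x] contains no
    other remaining point, so its whole trace on [Y] has been removed after the step. *)
Lemma cbtower_open : forall C, C ∈ cbtower Y T -> forall x, x ∈ C ->
  exists U, U ∈ T /\ x ∈ U /\ forall y, y ∈ U -> y ∈ Y -> y ∈ C.
Proof.
  apply (tower_ind Y (cbstep Y T) cbstep_def cbstep_sub (fun C => forall x, x ∈ C ->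
    exists U, U ∈ T /\ x ∈ U /\ forall y, y ∈ U -> y ∈ Y -> y ∈ C)); [df| |].
  - intros C hC h x hx. apply in_cbstep in hx as [hx|(hx & U & hU & k)].
    + destruct (h x hx) as (U & hU & hxU & k). exists U. repeat split; auto.
      intros y h1 h2. apply in_cbstep. auto.
    + exists U. repeat split; auto; [now apply k|]. intros y h1 h2. apply in_cbstep.
      destruct (classic (y ∈ C)) as [l|l]; auto. right. split; auto.
      assert (y = x) by (apply k; rewrite in_diff; auto). subst y. eauto.
  - intros B hB h x hx. apply in_union in hx as (C & hC & hx).
    destruct (h C hC x hx) as (U & hU & hxU & k). exists U. repeat split; auto.
    intros y h1 h2. apply in_union. eauto.
Qed.

End Fixed.

(** The stages other than [Y] are those that leave a remainder. In the compact case their union is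
    the last of them. Only [Y] and [T] enter, so the definition is uniform over families. *)
Definition last_derivative Y T : V := diff Y (union (sep (cbtower Y T) (fun C => C <> Y))).
Lemma fun2_last_derivative : fun2 last_derivative. Proof. unfold last_derivative. df. Qed.
Hint Resolve fun2_last_derivative : dfdb.

Lemma last_derivative_spec X T Y : closed X T Y -> nonempty Y -> compact X T -> scattered X T ->
  nonempty (last_derivative Y T) /\ finite (last_derivative Y T) /\ last_derivative Y T ⊆ Y.
Proof.
  intros [hYX (U0 & hU0 & hd0)] hY hc hs.
  set (F := sep (cbtower Y T) (fun C => C <> Y)).
  assert (hF : forall C, C ∈ F <-> C ∈ cbtower Y T /\ C <> Y).
  { intros C. unfold F. now rewrite in_sep by df. }
  change (last_derivative Y T) with (diff Y (union F)).
  assert (h0 : zero ∈ F).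
  { apply hF. split.
    - replace zero with (@union V zero).
      + apply cbtower_union. intros x hx. now apply in_zero in hx.
      + apply set_ext. intros z. rewrite in_union. split; [|intros h; now apply in_zero in h].
        intros (y & hy & _). now apply in_zero in hy.
    - intros e. destruct hY as [y hy]. rewrite <- e in hy. now apply in_zero in hy. }
  assert (hU : union F ∈ cbtower Y T).
  { apply cbtower_union. intros C hC. now apply hF in hC. }
  assert (out : forall x, x ∈ X -> ~ x ∈ Y -> x ∈ U0 /\ forall y, y ∈ U0 -> ~ y ∈ Y).
  { intros x hx nx. split; [now apply hd0|]. intros y hy. now apply hd0 in hy. }
  (* Stages are relatively open. If those in [F] exhausted [Y], the corresponding open sets and the
     complement of [Y] would cover [X]; [F] being a chain, one member would contain the trace on [Y]
     of a finite subcover, and so be [Y]. *)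
  assert (hne : union F <> Y).
  { intros e.
    destruct (hc (sep T (fun U => exists C, C ∈ F /\ forall y, y ∈ U -> y ∈ Y -> y ∈ C))) as (G & hG & fG & cG).
    - intros U hU'. rewrite in_sep in hU' by df. tauto.
    - intros x hx. destruct (classic (x ∈ Y)) as [k|k].
      + rewrite <- e in k. apply in_union in k as (C & hC & k).
        destruct (cbtower_open Y T C) with (x := x) as (U & hU' & hxU & l); auto; [now apply hF|].
        exists U. rewrite in_sep by df. split; eauto.
      + destruct (out x hx k) as [h1 h2]. exists U0. rewrite in_sep by df. split; auto. split; auto.
        exists zero. split; auto. intros y h3 h4. exfalso. exact (h2 y h3 h4).
    - destruct (fin_directed (fun U C => forall y, y ∈ U -> y ∈ Y -> y ∈ C) G F) as (C & hC & k); auto.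
      + df.
      + now exists zero.
      + intros a b ha hb. destruct (cbtower_chain Y T a b) as [l|l]; [now apply hF|now apply hF| |].
        * exists b. split; auto. intros U [m|m]; auto.
        * exists a. split; auto. intros U [m|m]; auto.
      + intros U hU'. apply hG in hU'. rewrite in_sep in hU' by df. tauto.
      + apply hF in hC as [hC n]. apply n. apply subset_antisym; [now apply (cbtower_sub Y T)|].
        intros y hy. destruct (cG y (hYX y hy)) as (U & hU' & hyU). now apply (k U). }
  (* [union F] is the largest stage in [F]. If the step after it did not reach [Y], it would belong
     to [F] and so remove nothing, whereas scatteredness gives the remainder an isolated point. Thus
     the step removes everything left. *)
  assert (hiso : forall x, x ∈ Y -> ~ x ∈ union F ->
    exists U, U ∈ T /\ forall y, y ∈ U /\ y ∈ diff Y (union F) <-> y = x).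
  { assert (e : cbstep Y T (union F) = Y).
    { apply NNPP. intros n.
      assert (hst : cbstep Y T (union F) ⊆ union F).
      { intros x hx. apply in_union. exists (cbstep Y T (union F)). split; auto.
        apply hF. split; auto. now apply cbtower_step. }
      assert (hsub := cbtower_sub Y T _ hU).
      assert (hnn : nonempty (diff Y (union F))).
      { apply NNPP. intros m. apply hne. apply subset_antisym; auto. intros y hy. apply NNPP.
        intros l. apply m. exists y. now apply in_diff. }
      destruct (hs (diff Y (union F))) as (x & U & hU' & k); auto.
      { intros y hy. apply in_diff in hy. apply hYX. tauto. }
      assert (hx : x ∈ diff Y (union F)) by (now apply k). apply in_diff in hx as [hx nx].
      apply nx, hst, in_cbstep. right. eauto. }
    intros x hx nx. rewrite <- e in hx. apply in_cbstep in hx as [hx|[_ hx]]; tauto. }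
  split; [|split].
  - apply NNPP. intros m. apply hne. apply subset_antisym; [now apply (cbtower_sub Y T)|]. intros y hy. apply NNPP.
    intros l. apply m. exists y. now apply in_diff.
  (* The remainder is closed and discrete: [X] is covered by open sets that meet it in at most one
     point, and a finite subcover bounds its size. *)
  - destruct (hc (sep T (fun U => forall y y', y ∈ U -> y' ∈ U -> y ∈ diff Y (union F) ->
      y' ∈ diff Y (union F) -> y = y'))) as (G & hG & fG & cG).
    + intros U hU'. rewrite in_sep in hU' by df. tauto.
    + intros x hx. destruct (classic (x ∈ Y)) as [k|k]; [destruct (classic (x ∈ union F)) as [l|l]|].
      * destruct (cbtower_open Y T (union F) hU x l) as (U & hU' & hxU & m).
        exists U. rewrite in_sep by df. repeat split; auto.
        intros y y' h1 h2 h3. apply in_diff in h3 as [h3 h4]. exfalso; auto.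
      * destruct (hiso x k l) as (U & hU' & m). exists U. rewrite in_sep by df. repeat split; auto.
        -- intros y y' h1 h2 h3 h4. transitivity x; [|symmetry]; apply m; auto.
        -- now apply m.
      * destruct (out x hx k) as [h1 h2]. exists U0. rewrite in_sep by df. repeat split; auto.
        intros y y' h3 h4 h5. apply in_diff in h5 as [h5 _]. exfalso. exact (h2 y h3 h5).
    + apply (fin_relation G (fun U x => U ∈ G /\ x ∈ U /\ x ∈ diff Y (union F))); auto; [df| |].
      * intros U x x' (h1 & h2 & h3) (_ & h4 & h5). apply hG in h1. rewrite in_sep in h1 by df.
        destruct h1 as [_ h1]. auto.
      * intros x hx. assert (hx' := hx). apply in_diff in hx' as [hx' _].
        destruct (cG x (hYX x hx')) as (U & hU' & k). eauto.
  - intros x hx. now apply in_diff in hx.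
Qed.

(** The union of the stages missing [x] is again a stage missing [x], hence the largest one; its
    complement is the last derivative that contains [x]. *)
Definition stage X T x : V := union (sep (cbtower X T) (fun C => ~ x ∈ C)).
Lemma fun3_stage : fun3 stage. Proof. unfold stage. df. Qed.

(** A further step that still missed [x] would be contained in [stage X T x] and remove nothing,
    although scatteredness provides an isolated point of the remainder. So the next step removes
    [x], which means that [x] is isolated there. *)
Lemma stage_spec X T x : scattered X T -> x ∈ X -> stage X T x ∈ cbtower X T /\ ~ x ∈ stage X T x /\
  exists U, U ∈ T /\ forall y, y ∈ U /\ y ∈ diff X (stage X T x) <-> y = x.
Proof.
  intros hs hx.
  assert (hF : forall C, C ∈ sep (cbtower X T) (fun C => ~ x ∈ C) <-> C ∈ cbtower X T /\ ~ x ∈ C).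
  { intros C. now rewrite in_sep by df. }
  assert (h1 : stage X T x ∈ cbtower X T).
  { apply cbtower_union. intros C hC. now apply hF in hC. }
  assert (h2 : ~ x ∈ stage X T x).
  { intros h. apply in_union in h as (C & hC & h). now apply hF in hC. }
  repeat split; auto.
  assert (h3 : x ∈ cbstep X T (stage X T x)).
  { apply NNPP. intros n.
    destruct (hs (diff X (stage X T x))) as (y & U & hU & k).
    - intros y hy. now apply in_diff in hy.
    - exists x. now apply in_diff.
    - assert (hy : y ∈ diff X (stage X T x)) by (now apply k). apply in_diff in hy as [hy ny].
      apply ny, in_union. exists (cbstep X T (stage X T x)). split.
      + apply hF. split; auto. now apply cbtower_step.
      + apply in_cbstep. right. eauto. }
  apply in_cbstep in h3 as [h3|[_ h3]]; tauto.
Qed.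

End CantorBendixson.
Global Hint Resolve fun2_cbtower fun2_last_derivative fun3_stage : dfdb.

(** * Countable compact metric spaces are scattered *)

Section CountableCompact.
Context {V : ZF_model}.
Implicit Types X A S r n m w x y z : V.

Lemma omega_mem_trans w : is_omega w -> forall n, n ∈ w -> forall m, m ∈ n -> m ⊆ n.
Proof.
  intros hw. apply (omega_ind w (fun n => forall m, m ∈ n -> m ⊆ n)); auto; [df| |].
  - intros m hm. now apply in_zero in hm.
  - intros n hn IH m hm x hx. apply in_suc in hm as [hm| ->]; apply in_suc; auto. left. now apply (IH m).
Qed.

Lemma omega_finite w : is_omega w -> forall n, n ∈ w -> finite n.
Proof.
  intros hw. apply (omega_ind w finite); auto; [df|apply fin_zero|]. intros n _ h. now apply fin_add.
Qed.

Lemma omega_total w : is_omega w -> forall n, n ∈ w -> forall m, m ∈ w -> n ∈ m \/ n = m \/ m ∈ n.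
Proof.
  intros hw.
  assert (z : forall m, m ∈ w -> zero = m \/ zero ∈ m).
  { apply (omega_ind w (fun m => zero = m \/ zero ∈ m)); auto; [df|]. intros m _ [<-|h]; right; apply in_suc; auto. }
  assert (s : forall m, m ∈ w -> forall n, n ∈ m -> suc n = m \/ suc n ∈ m).
  { apply (omega_ind w (fun m => forall n, n ∈ m -> suc n = m \/ suc n ∈ m)); auto; [df| |].
    - intros n hn. now apply in_zero in hn.
    - intros m _ IH n hn. apply in_suc in hn as [hn| ->]; auto. destruct (IH n hn) as [<-|h]; right; apply in_suc; auto. }
  apply (omega_ind w (fun n => forall m, m ∈ w -> n ∈ m \/ n = m \/ m ∈ n)); auto; [df| |].
  - intros m hm. destruct (z m hm); auto.
  - intros n hn IH m hm. destruct (IH m hm) as [h|[<-|h]].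
    + destruct (s m hm n h); auto.
    + right; right. apply in_suc; auto.
    + right; right. apply in_suc; auto.
Qed.

Lemma omega_well_ordered w : is_omega w -> well_orders mem w.
Proof.
  intros hw. repeat split.
  - intros x _. apply mem_irrefl.
  - intros x y z hx hy hz h k. now apply (omega_mem_trans w hw z hz y).
  - intros x y hx hy. exact (omega_total w hw x hx y hy).
  - intros S hS hn. destruct (zf_foundation V S hn) as (m & hm & k). exists m. split; auto.
    intros x hx. destruct (omega_total w hw m (hS m hm) x (hS x hx)) as [h|[h|h]]; auto. exfalso; eauto.
Qed.

(** An order of type at most omega, treating finite and denumerable spaces alike. Finiteness of the
    initial segments is what will stop an endless increase of minima below a fixed point. *)
Lemma countable_order X : countable X -> exists r, well_orders (rel r) X /\
  forall z, z ∈ X -> finite (sep X (fun x => rel r x z)).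
Proof.
  intros [hX|(w & hw & e)].
  - destruct (fin_well_orderable X hX) as [r hr]. exists r. split; auto. intros z _.
    apply (fin_subset X); auto. intros x hx. rewrite in_sep in hx by df. tauto.
  - destruct e as (f & [hf hm] & hi & hs).
    assert (hv : forall x, x ∈ X -> ap f x ∈ w) by (intros x hx; eapply hm, family_ap; eauto).
    assert (hinj : forall x y, x ∈ X -> y ∈ X -> ap f x = ap f y -> x = y).
    { intros x y hx hy E. apply (hi x y (ap f x)); [|rewrite E]; now apply (family_ap X). }
    assert (W : well_orders (fun x y => ap f x ∈ ap f y) X).
    { apply (well_orders_pull mem w X (ap f)); auto using omega_well_ordered. df. }
    exists (sep (prod X X) (fun p => ap f (pi1 p) ∈ ap f (pi2 p))).
    assert (K : forall x y, x ∈ X -> y ∈ X ->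
      (ap f x ∈ ap f y <-> rel (sep (prod X X) (fun p => ap f (pi1 p) ∈ ap f (pi2 p))) x y)).
    { intros x y hx hy. rewrite rel_iff, in_sep by df. rewrite pair_in_prod, pi1_pair, pi2_pair. tauto. }
    split; [revert W; now apply well_orders_ext|].
    intros z hz. apply (fin_relation (ap f z) (fun y x => x ∈ X /\ y = ap f x)).
    + df.
    + apply (omega_finite w); auto.
    + intros y x x' [h ->] [h' E]. auto.
    + intros x hx. rewrite in_sep in hx by df. destruct hx as [hx k]. apply K in k; auto. eauto.
Qed.

Lemma fin_max r X : well_orders (rel r) X -> forall S, finite S -> S ⊆ X -> nonempty S ->
  exists m, m ∈ S /\ forall x, x ∈ S -> x = m \/ rel r x m.
Proof.
  intros (hi & ht & hc & _).
  apply (fin_ind (fun S => S ⊆ X -> nonempty S -> exists m, m ∈ S /\ forall x, x ∈ S -> x = m \/ rel r x m)); [df| |].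
  - intros _ [x hx]. now apply in_zero in hx.
  - intros S x _ IH _ hS _.
    assert (hx : x ∈ X). { apply hS. rewrite in_cup, in_sing. auto. }
    assert (hS' : S ⊆ X). { intros y hy. apply hS. rewrite in_cup. auto. }
    destruct (classic (nonempty S)) as [hn|hn].
    + destruct IH as (m & hm & k); auto. destruct (hc m x) as [h|[h|h]]; auto.
      * exists x. rewrite in_cup, in_sing. split; auto. intros y hy. rewrite in_cup, in_sing in hy.
        destruct hy as [hy|hy]; auto. right. destruct (k y hy) as [->|l]; auto. apply (ht y m x); auto.
      * subst m. exists x. rewrite in_cup, in_sing. split; auto. intros y hy. rewrite in_cup, in_sing in hy.
        destruct hy as [hy|hy]; auto.
      * exists m. rewrite in_cup, in_sing. split; auto. intros y hy. rewrite in_cup, in_sing in hy.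
        destruct hy as [hy| ->]; auto.
    + exists x. rewrite in_cup, in_sing. split; auto. intros y hy. rewrite in_cup, in_sing in hy.
      destruct hy as [hy| ->]; auto. exfalso. apply hn. now exists y.
Qed.

Context (R : complete_ordered_field V).

(* A set [A] without isolated points would yield a chain of nested closed balls whose
   interiors meet [A], the minimum of each ball being missed by the next one.  By compactness all
   of them share a point [z]; but only finitely many points precede [z]. *)
Lemma countable_compact_scattered X d : is_metric R X d -> countable X -> compact X (mtop R X d) ->
  scattered X (mtop R X d).
Proof.
  intros hd hcount hc A hA hnA. apply NNPP. intros hiso.
  destruct (countable_order X hcount) as (r & hr & hfin).
  destruct (gauge_exists R) as (E & Epos & Eco & Ewo).
  apply (well_orderable_intro (fun x y => rel (r_lt R) y x)) in Ewo; [|df].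
  assert (Xwo : well_orderable X) by (now exists r).
  destruct (well_orderable_prod X E Xwo Ewo) as [r2 hr2].
  (* A candidate is a centre in [A] and a radius in [E] whose closed ball stays in [O] and misses
     the least point of [O]. The well-order [r2] of such pairs makes [psi] a definable selection,
     which replaces dependent choice. *)
  set (cand := fun O => sep (prod X E) (fun q => pi1 q ∈ O /\ pi1 q ∈ A /\
    cball R X d (pi1 q) (pi2 q) ⊆ diff O (sing (least_of r O)))).
  assert (cand_def : fun1 cand) by (unfold cand, cball; df).
  assert (in_cand : forall O x e, pair x e ∈ cand O <-> (x ∈ X /\ e ∈ E) /\ x ∈ O /\ x ∈ A /\
    cball R X d x e ⊆ diff O (sing (least_of r O))).
  { intros O x e. unfold cand. rewrite in_sep by (unfold cball; df). now rewrite pair_in_prod, pi1_pair, pi2_pair. }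
  assert (cand_sub : forall O, cand O ⊆ prod X E).
  { intros O q hq. unfold cand in hq. rewrite in_sep in hq by (unfold cball; df). tauto. }
  clearbody cand.
  set (psi := fun O => ball R X d (pi1 (least_of r2 (cand O))) (pi2 (least_of r2 (cand O)))).
  assert (psi_def : fun1 psi) by (unfold psi, ball; df).
  assert (psiE : forall O, psi O = ball R X d (pi1 (least_of r2 (cand O))) (pi2 (least_of r2 (cand O)))) by reflexivity.
  clearbody psi.
  (* The shrinking balls are recorded by their complements, since a tower increases. Where no
     candidate exists, [phi] changes nothing. *)
  set (phi := fun C => cup C (sep X (fun y => nonempty (cand (diff X C)) /\ ~ y ∈ psi (diff X C)))).
  assert (phi_def : fun1 phi) by (unfold phi; df).
  assert (in_phi : forall C y, y ∈ phi C <-> y ∈ C \/ y ∈ X /\ nonempty (cand (diff X C)) /\ ~ y ∈ psi (diff X C)).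
  { intros C y. unfold phi. rewrite in_cup. now rewrite in_sep by df. }
  assert (i1 : forall C, C ⊆ X -> C ⊆ phi C) by (intros C _ x hx; apply in_phi; auto).
  assert (i2 : forall C, C ⊆ X -> phi C ⊆ X).
  { intros C h x hx. apply in_phi in hx as [hx|[hx _]]; auto. }
  (* The complement of a union stage need not be open or meet [A]. [O] retains the complements that
     are and do; it is a chain and will be closed under [psi]. *)
  set (O := sep (power X) (fun U => diff X U ∈ tower X phi /\ U ∈ mtop R X d /\ nonempty (cap U A))).
  assert (inO : forall U, U ∈ O <-> U ⊆ X /\ diff X U ∈ tower X phi /\ U ∈ mtop R X d /\ nonempty (cap U A)).
  { intros U. unfold O. rewrite in_sep by df. now rewrite in_power. }
  assert (diffK : forall U, U ⊆ X -> diff X (diff X U) = U).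
  { intros U h. apply set_ext. intros z. rewrite !in_diff. split.
    - intros [h1 h2]. apply NNPP. tauto.
    - intros k. split; auto. tauto. }
  assert (minO : forall U, U ∈ O -> least_of r U ∈ U /\
    forall x, x ∈ U -> least_of r U = x \/ rel r (least_of r U) x).
  { intros U hU. apply inO in hU as (h1 & _ & _ & (a & ha)). apply (least_spec r X U); auto.
    exists a. now apply in_cap in ha. }
  assert (candO : forall U, U ∈ O -> nonempty (cand U)).
  { intros U hU. assert (hU' := hU). apply inO in hU' as (h1 & _ & h2 & (a & ha)).
    apply in_cap in ha as [ha ha']. destruct (minO U hU) as [hm _].
    (* The least point of [U] is going to be dropped, so a second point of [A] in [U] is needed;
       without one, [a] would be isolated in [A]. *)
    assert (hx : exists x, x ∈ U /\ x ∈ A /\ x <> least_of r U).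
    { destruct (classic (a = least_of r U)) as [e|e]; [|eauto].
      apply NNPP. intros n. apply hiso. exists a, U. split; auto. intros y. split; [|intros ->; auto].
      intros [hy hy']. apply NNPP. intros l. apply n. exists y. repeat split; auto. congruence. }
    destruct hx as (x & hxU & hxA & hxm).
    apply in_mtop in h2 as [_ h2]. destruct (h2 x hxU) as (r1 & hr1 & k1).
    assert (hxX : x ∈ X) by auto. assert (hmX : least_of r U ∈ X) by auto.
    assert (hr2' : positive R (dist d x (least_of r U))) by (apply (dist_pos R X); auto).
    destruct (min_pos R _ _ hr1 hr2') as (c & hcp & l1 & l2).
    destruct (Eco c hcp) as (e & he & lt).
    assert (eR : e ∈ real R) by now apply Epos.
    assert (cR : c ∈ real R) by apply hcp.
    assert (rR : r1 ∈ real R) by apply hr1.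
    exists (pair x e). apply in_cand. repeat split; auto.
    intros y hy. apply in_cball in hy as [hy ly].
    assert (dR : dist d x y ∈ real R) by (apply (dist_real R X); auto).
    assert (ltc : rel (r_lt R) (dist d x y) c) by (apply (le_lt_trans R _ e); auto).
    rewrite in_diff, in_sing. split.
    - apply k1, in_ball. split; auto. apply (lt_le_trans R _ c); auto.
    - intros ->. apply (lt_irrefl R c); auto. apply (le_lt_trans R _ (dist d x (least_of r U))); auto. }
  assert (psiO : forall U, U ∈ O -> exists x e, x ∈ X /\ e ∈ real R /\ x ∈ A /\ x ∈ psi U /\
    psi U = ball R X d x e /\ cball R X d x e ⊆ diff U (sing (least_of r U))).
  { intros U hU. assert (hq : least_of r2 (cand U) ∈ cand U).
    { apply (least_spec r2 (prod X E)); auto. }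
    assert (hq' := cand_sub U _ hq). rewrite psiE. apply in_prod in hq' as (x & e & hx & he & eq). rewrite eq in *.
    rewrite pi1_pair, pi2_pair. apply in_cand in hq as (_ & h1 & h2 & h3).
    exists x, e. repeat split; auto; try now apply Epos. apply (center_ball R X); auto. }
  assert (ballc : forall x e, ball R X d x e ⊆ cball R X d x e).
  { intros x e y hy. apply in_ball in hy as [hy k]. apply in_cball. split; auto. now left. }
  assert (stepO : forall U, U ∈ O -> psi U ∈ O).
  { intros U hU. assert (hU' := hU). apply inO in hU' as (h1 & h2 & _).
    destruct (psiO U hU) as (x & e & hx & he & hxA & hxp & eq & sub).
    apply inO. repeat split.
    - rewrite eq. intros y hy. now apply in_ball in hy.
    - replace (diff X (psi U)) with (phi (diff X U)); [now apply tower_step|].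
      apply set_ext. intros y. rewrite in_phi, (diffK U h1), !in_diff. split.
      + intros [[k1 k2]|(k1 & _ & k2)]; auto. split; auto. intros k. rewrite eq in k.
        apply ballc, sub, in_diff in k. tauto.
      + intros [k1 k2]. right. auto.
    - rewrite eq. now apply ball_open.
    - exists x. apply in_cap. auto. }
  assert (XO : X ∈ O).
  { apply inO. repeat split; [intros x; auto| |now apply mtop_full|].
    - replace (diff X X) with (@union V zero).
      + apply tower_union; auto. intros x hx. now apply in_zero in hx.
      + apply set_ext. intros z. rewrite in_union, in_diff. split; [|tauto].
        intros (y & hy & _). now apply in_zero in hy.
    - destruct hnA as [a ha]. exists a. apply in_cap. auto. }
  assert (chainO : forall U W, U ∈ O -> W ∈ O -> U ⊆ W \/ W ⊆ U).
  { intros U W hU hW. apply inO in hU as (h1 & h2 & _), hW as (k1 & k2 & _).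
    assert (sw : forall U W, U ⊆ X -> diff X W ⊆ diff X U -> U ⊆ W).
    { intros U' W' h3 h4 x hx. apply NNPP. intros n.
      assert (l : x ∈ diff X U') by (apply h4, in_diff; auto). apply in_diff in l. tauto. }
    destruct (tower_chain X phi phi_def i1 i2 (diff X U) (diff X W)) as [l|l]; auto. }
  (* Otherwise the complements of the closed balls chosen inside the members of [O] cover [X]. By
     the chain property a finite subcover is disjoint from one member of [O], whose least point is
     then left uncovered. *)
  assert (hz : exists z, z ∈ X /\ forall U, U ∈ O -> z ∈ U).
  { apply NNPP. intros hn.
    destruct (hc (sep (mtop R X d) (fun W => exists U, U ∈ O /\ disjoint W U))) as (G & hG & fG & cG).
    - intros U hU. rewrite in_sep in hU by df. tauto.
    - intros z hz. apply NNPP. intros hn'. apply hn. exists z. split; auto. intros U hU.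
      apply NNPP. intros nU. apply hn'.
      destruct (psiO U hU) as (x & e & hx & he & hxA & hxp & eq & sub).
      exists (diff X (cball R X d x e)). split.
      + rewrite in_sep by df. split; [now apply cball_closed|]. exists (psi U). split; auto.
        intros y [h1 h2]. rewrite eq in h2. apply in_diff in h1 as [_ h1]. apply h1, ballc, h2.
      + apply in_diff. split; auto. intros k. apply sub, in_diff in k. tauto.
    - destruct (fin_directed disjoint G O) as (U & hU & k); auto.
      + df.
      + now exists X.
      + intros a b ha hb. destruct (chainO a b ha hb) as [l|l]; [exists a|exists b]; split; auto;
          intros W [m|m] y [h1 h2]; apply (m y); auto.
      + intros W hW. apply hG in hW. rewrite in_sep in hW by df. tauto.
      + destruct (minO U hU) as [hm _]. apply inO in hU as (hU & _).
        destruct (cG _ (hU _ hm)) as (W & hW & l). apply (k W hW (least_of r U)). auto. }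
  destruct hz as (z & hzX & hz).
  assert (hr' := hr). destruct hr' as (hi & ht & _).
  (* No minimum of a member of [O] exceeds [z], so the minima form a finite set. Its maximum is the
     minimum of some [U], but [psi U] lies in [U] without that point and has a larger minimum. *)
  destruct (fin_max r X hr (image O (least_of r))) as (m & hm & km).
  - apply (fin_subset (cup (sep X (fun x => rel r x z)) (sing z))); [now apply fin_add, hfin|].
    intros x hx. rewrite in_image in hx by df. destruct hx as (U & hU & ->).
    rewrite in_cup, in_sing. rewrite in_sep by df. destruct (minO U hU) as [h k].
    destruct (k z (hz U hU)) as [l|l]; auto. left. split; auto. apply inO in hU as [hU _]. auto.
  - intros x hx. rewrite in_image in hx by df. destruct hx as (U & hU & ->).
    destruct (minO U hU) as [h _]. apply inO in hU as [hU _]. auto.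
  - exists (least_of r X). rewrite in_image by df. eauto.
  - rewrite in_image in hm by df. destruct hm as (U & hU & ->).
    destruct (psiO U hU) as (x & e & hx & he & hxA & hxp & eq & sub).
    destruct (minO U hU) as [h1 h2]. destruct (minO (psi U) (stepO U hU)) as [h3 _].
    assert (h4 := h3). rewrite eq in h4. apply ballc, sub in h4. rewrite <- eq in h4.
    rewrite in_diff, in_sing in h4. destruct h4 as [h4 h5].
    assert (UX : U ⊆ X) by (now apply inO in hU).
    destruct (h2 _ h4) as [l|l]; [congruence|].
    destruct (km (least_of r (psi U))) as [l'|l'].
    + rewrite in_image by df. eauto.
    + congruence.
    + apply (hi (least_of r U)); auto. apply (ht _ (least_of r (psi U)) _); auto.
Qed.

End CountableCompact.

(** * Multiple choice *)

Section MultipleChoice.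
Context {V : ZF_model} (R : complete_ordered_field V).
Implicit Types I X T S TS C c i t x y z : V.

Lemma metrizable_scattered X T : metrizable R X T -> countable X -> compact X T -> scattered X T.
Proof.
  intros (d & hd & hT) hX hc. apply mtop_iff in hT; auto. subst T.
  now apply countable_compact_scattered.
Qed.

Lemma metrizable_closed_full X T : metrizable R X T -> closed X T X.
Proof.
  intros (d & hd & hT). apply mtop_iff in hT; auto. subst T. split; [intros x; auto|].
  exists zero. split.
  - apply in_mtop. split; intros x hx; now apply in_zero in hx.
  - intros x. split; [intros hx; now apply in_zero in hx | tauto].
Qed.

Lemma denumerable_nonempty X : denumerable X -> nonempty X.
Proof.
  intros (w & [hw _] & e). apply inductive_iff in hw as [h0 _].
  apply equipotent_elim in e as (f & _ & hs & _). destruct (hs _ h0) as (x & hx & _). now exists x.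
Qed.

Lemma multiple_choice_intro I X (F : V -> V) : fun1 F -> is_family I X ->
  (forall i, i ∈ I -> nonempty (F i) /\ finite (F i) /\ F i ⊆ ap X i) ->
  has_multiple_choice_function I X.
Proof.
  intros hF hX h. exists (lam I F). split; [now apply lam_family|].
  intros i x y hi hx hy. apply (family_app I) in hx; auto. apply app_lam in hy as [_ ->]; auto.
  subst x. auto.
Qed.

Lemma denumerable_compact_multiple_choice I X T : is_family I X -> is_family I T ->
  (forall i x t, i ∈ I -> app X i x -> app T i t -> denumerable x /\ metrizable R x t /\ compact x t) ->
  has_multiple_choice_function I X.
Proof.
  intros hX hT h. apply (multiple_choice_intro I X (fun i => last_derivative (ap X i) (ap T i))); auto; [df|].
  intros i hi. destruct (h i (ap X i) (ap T i)) as (h1 & h2 & h3); eauto using family_ap.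
  apply (last_derivative_spec (ap X i) (ap T i) (ap X i)); auto.
  - now apply metrizable_closed_full.
  - now apply denumerable_nonempty.
  - apply metrizable_scattered; auto. now right.
Qed.

(** The well-order of [al] singles out the least summand that a non-empty closed [c] meets. The
    trace of [c] is closed there, and its last derivative is the finite set assigned to [c]. *)
Lemma direct_sum_weakly_loeb al X T S TS : well_orders mem al -> is_family al X -> is_family al T ->
  (forall i x t, i ∈ al -> app X i x -> app T i t ->
     nonempty x /\ countable x /\ compact x t /\ metrizable R x t) ->
  is_direct_sum al X T S TS -> weakly_loeb S TS.
Proof.
  intros hal hX hT h [hS hTS].
  set (C := sep (power S) (fun c => closed S TS c /\ nonempty c)).
  assert (hC : forall c, c ∈ C <-> closed S TS c /\ nonempty c).
  { intros c. unfold C. rewrite in_sep by df. rewrite in_power. split; [tauto|].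
    intros hc. repeat split; try apply hc. }
  exists C, (lam C (fun c => c)). split; auto.
  assert (idf : fun1 (fun c : V => c)) by df.
  split; [now apply lam_family|]. split.
  { intros c hc. now apply app_lam. }
  set (ind := fun c => the (fun g => g ∈ al /\ nonempty (cap c (ap X g)) /\
    forall h, h ∈ al -> nonempty (cap c (ap X h)) -> g = h \/ g ∈ h)).
  assert (ind_def : fun1 ind) by (unfold ind; df).
  assert (hind : forall c, c ∈ C -> ind c ∈ al /\ nonempty (cap c (ap X (ind c)))).
  { intros c hc. apply hC in hc as [[hcS _] [z hz]].
    assert (hz' := hcS z hz). apply hS in hz' as (i & x & hi & hx & hzx).
    apply (family_app al) in hx; auto. subst x.
    destruct hal as (hirr & htr & _ & hl). destruct (hl (sep al (fun g => nonempty (cap c (ap X g))))) as (m & hm & k).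
    - intros g hg. rewrite in_sep in hg by df. tauto.
    - exists i. rewrite in_sep by df. split; auto. exists z. now apply in_cap.
    - rewrite in_sep in hm by df. destruct hm as [hm hm'].
      assert (k' : forall h, h ∈ al -> nonempty (cap c (ap X h)) -> m = h \/ m ∈ h).
      { intros g hg hn. apply k. rewrite in_sep by df. auto. }
      enough (e : ind c = m) by (rewrite e; auto).
      apply the_eq; auto. intros g (hg & hn & kg). destruct (k' g hg hn) as [|l]; auto.
      destruct (kg m hm hm') as [|l']; auto. exfalso. apply (hirr g); auto. now apply (htr g m g). }
  clearbody ind.
  apply (multiple_choice_intro C _ (fun c => last_derivative (cap c (ap X (ind c))) (ap T (ind c))));
    [df|now apply lam_family|].
  intros c hc. rewrite ap_lam by auto. destruct (hind c hc) as [hi hn].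
  destruct (h (ind c) (ap X (ind c)) (ap T (ind c))) as (_ & h2 & h3 & h4); eauto using family_ap.
  destruct (last_derivative_spec (ap X (ind c)) (ap T (ind c)) (cap c (ap X (ind c)))) as (k1 & k2 & k3); auto.
  - apply hC in hc as [[hcS (W & hW & dW)] _]. split; [intros z hz; now apply in_cap in hz|].
    apply hTS in hW as [_ hW].
    destruct (hW (ind c) (ap X (ind c)) (ap T (ind c))) as (W' & hW' & iW); eauto using family_ap.
    exists W'. split; auto. intros z. rewrite (iW z), (dW z), in_cap. split; [tauto|].
    intros [l1 l2]. repeat split; auto. apply hS. exists (ind c), (ap X (ind c)). eauto using family_ap.
  - now apply metrizable_scattered.
  - repeat split; auto. intros z hz. apply k3, in_cap in hz. tauto.
Qed.

End MultipleChoice.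

(** * Unions of scattered spaces *)

Section ScatteredUnions.
Context {V : ZF_model} (R : complete_ordered_field V).
Implicit Types A S X D U M E s x y p d : V.

Lemma scattered_union_well_orderable S X D U : @WOAC_fin V ->
  well_orderable S -> is_family S X -> is_family S D ->
  (forall s, s ∈ S -> is_metric R (ap X s) (ap D s) /\ scattered (ap X s) (mtop R (ap X s) (ap D s)) /\
     totally_bounded R (ap X s) (ap D s)) ->
  (forall x, x ∈ U <-> exists s, s ∈ S /\ x ∈ ap X s) -> well_orderable U.
Proof.
  intros AC hS hX hD h hU.
  destruct (gauge_exists R) as (E & Epos & Eco & Ewo).
  apply (well_orderable_intro (fun x y => rel (r_lt R) y x)) in Ewo; [|df].
  assert (Ewo' := Ewo). destruct Ewo' as [rE hrE].
  (* Points are tagged with their index, because the spaces may overlap and a key depends on the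
     space in which a point is considered. *)
  set (M := sep (prod S U) (fun p => pi2 p ∈ ap X (pi1 p))).
  assert (hM : forall p, p ∈ M <-> exists s x, s ∈ S /\ x ∈ ap X s /\ p = pair s x).
  { intros p. unfold M. rewrite in_sep by df. rewrite in_prod. split.
    - intros [(s & x & hs & hx & ->) k]. rewrite pi1_pair, pi2_pair in k. eauto 6.
    - intros (s & x & hs & hx & ->). rewrite pi1_pair, pi2_pair. split; auto.
      exists s, x. repeat split; auto. apply hU. eauto. }
  clearbody M.
  enough (MW : well_orderable M).
  { replace U with (image M pi2); [apply well_orderable_image; [df|auto]|].
    apply set_ext. intros x. rewrite in_image by df. rewrite hU. split.
    - intros (p & hp & ->). apply hM in hp as (s & y & hs & hy & ->). rewrite pi2_pair. eauto.
    - intros (s & hs & hx). exists (pair s x). rewrite pi2_pair. split; auto. apply hM. eauto 6. }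
  set (st := fun p => stage (ap X (pi1 p)) (mtop R (ap X (pi1 p)) (ap D (pi1 p))) (pi2 p)).
  assert (st_def : fun1 st) by (unfold st; df).
  assert (stE : forall s x, st (pair s x) = stage (ap X s) (mtop R (ap X s) (ap D s)) x).
  { intros s x. unfold st. now rewrite pi1_pair, pi2_pair. }
  clearbody st.
  (* A radius is admissible if its ball isolates the point among those outside its stage. Below,
     [least_of rE] extracts one admissible radius; being determined by a fixed well-order of [E] is
     all that the argument asks of it. *)
  set (radii := fun p => sep E (fun e => forall y, y ∈ ball R (ap X (pi1 p)) (ap D (pi1 p)) (pi2 p) e ->
    ~ y ∈ st p -> y = pi2 p)).
  assert (radii_def : fun1 radii) by (unfold radii, ball; df).
  assert (in_radii : forall s x e, e ∈ radii (pair s x) <-> e ∈ E /\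
    forall y, y ∈ ball R (ap X s) (ap D s) x e -> ~ y ∈ st (pair s x) -> y = x).
  { intros s x e. unfold radii. rewrite in_sep by (unfold ball; df). now rewrite pi1_pair, pi2_pair. }
  clearbody radii.
  assert (hst : forall s x, s ∈ S -> x ∈ ap X s ->
    st (pair s x) ∈ cbtower (ap X s) (mtop R (ap X s) (ap D s)) /\ ~ x ∈ st (pair s x) /\
    least_of rE (radii (pair s x)) ∈ radii (pair s x)).
  { intros s x hs hx. destruct (h s hs) as (h1 & h2 & h3).
    destruct (stage_spec _ _ x h2 hx) as (k1 & k2 & W & hW & k3). rewrite <- stE in k1, k2, k3.
    repeat split; auto. apply (least_spec rE E); auto.
    - intros e he. now apply in_radii in he.
    - assert (hxW : x ∈ W) by (now apply k3). apply in_mtop in hW as [hW1 hW].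
      destruct (hW x hxW) as (e & he & l). destruct (Eco e he) as (e' & he' & lt).
      exists e'. apply in_radii. split; auto. intros y hy hn. apply k3. rewrite in_diff.
      assert (hyW : y ∈ W).
      { apply l. apply (ball_mono R _ _ h1 x e' e); auto; [now apply Epos | apply he | now left]. }
      auto. }
  set (key := fun p => pair (pair (pi1 p) (st p)) (least_of rE (radii p))).
  assert (key_def : fun1 key) by (unfold key; df).
  assert (keyE : forall p, key p = pair (pair (pi1 p) (st p)) (least_of rE (radii p))) by reflexivity.
  clearbody key.
  apply (finite_to_one_well_orderable M key); auto.
  - apply (well_orderable_subset (prod (image M (fun p => pair (pi1 p) (st p))) E)).
    { intros k hk. rewrite in_image in hk by df. destruct hk as (p & hp & ->). rewrite keyE.
      apply pair_in_prod. split; [rewrite in_image by df; eauto|].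
      apply hM in hp as (s & x & hs & hx & ->). destruct (hst s x hs hx) as (_ & _ & k).
      now apply in_radii in k. }
    apply well_orderable_prod; auto.
    (* Index and stage are compared lexicographically. Stages of one space are ordered by inclusion,
       an order given by the same formula for every index. *)
    apply (well_orderable_lex _ pi1 (fun p q => pi2 p ⊆ pi2 q /\ pi2 p <> pi2 q)); [df|df| |].
    + revert hS. apply well_orderable_subset. intros s hs. rewrite in_image in hs by df.
      destruct hs as (q & hq & ->). rewrite in_image in hq by df. destruct hq as (p & hp & ->).
      apply hM in hp as (s & x & hs & hx & ->). now rewrite !pi1_pair.
    + intros c. apply (well_orders_pull (fun C C' => C ⊆ C' /\ C <> C') (cbtower (ap X c) (mtop R (ap X c) (ap D c))));
        [df| | |apply cbtower_well_ordered].
      * intros q hq. rewrite in_sep in hq by df. destruct hq as [hq <-]. rewrite in_image in hq by df.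
        destruct hq as (p & hp & ->). apply hM in hp as (s & x & hs & hx & ->).
        rewrite !pi1_pair, pi2_pair. now apply hst.
      * intros q q' hq hq' e. rewrite in_sep in hq, hq' by df. destruct hq as [hq hc], hq' as [hq' hc'].
        rewrite in_image in hq, hq' by df. destruct hq as (p & hp & ->), hq' as (p' & hp' & ->).
        rewrite pi1_pair in hc, hc'. rewrite !pi2_pair in e. congruence.
  - intros c. destruct (classic (nonempty (sep M (fun x => key x = c)))) as [[p0 hp0]|hn].
    2:{ rewrite (not_nonempty _ hn). apply fin_zero. }
    rewrite in_sep in hp0 by df. destruct hp0 as [hp0 <-]. apply hM in hp0 as (s & x0 & hs & hx0 & ->).
    set (C0 := st (pair s x0)). set (e0 := least_of rE (radii (pair s x0))).
    destruct (h s hs) as (h1 & h2 & h3).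
    (* Two points of one space with equal keys share the stage and the radius [e0]. Each is the only
       point outside that stage in its ball of radius [e0], so distinct ones are at least [e0] apart
       and total boundedness applies. *)
    assert (fin : finite (sep (ap X s) (fun x => st (pair s x) = C0 /\ least_of rE (radii (pair s x)) = e0))).
    { apply (finite_separated R (ap X s) (ap D s) h1 e0); auto.
      - apply Epos. destruct (hst s x0 hs hx0) as (_ & _ & k). now apply in_radii in k.
      - intros x hx. rewrite in_sep in hx by df. tauto.
      - intros x y hx hy lt. rewrite in_sep in hx, hy by df. destruct hx as (hx & c1 & c2), hy as (hy & c3 & c4).
        destruct (hst s x hs hx) as (_ & _ & k). rewrite c2 in k. apply in_radii in k as [_ k].
        symmetry. apply k; [now apply in_ball|]. rewrite c1, <- c3. now apply hst. }
    apply (fin_subset (image (sep (ap X s) (fun x => st (pair s x) = C0 /\ least_of rE (radii (pair s x)) = e0)) (pair s)));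
      [apply fin_image; [df|auto]|].
    intros p hp. rewrite in_sep in hp by df. destruct hp as [hp e]. apply hM in hp as (s' & x & hs' & hx & ->).
    rewrite !keyE, !pi1_pair in e. apply pair_inj in e as [e e2]. apply pair_inj in e as [-> e1].
    rewrite in_image by df. exists x. split; auto. rewrite in_sep by df. auto.
Qed.

Lemma metric_scattered_iff X d : is_metric R X d -> (metric_scattered R X d <-> scattered X (mtop R X d)).
Proof.
  intros hd. split.
  - intros (T & hT & k). apply mtop_iff in hT; auto. now subst.
  - intros h. exists (mtop R X d). split; auto. now apply mtop_iff.
Qed.

Lemma metric_compact_iff X d : is_metric R X d -> (metric_compact R X d <-> compact X (mtop R X d)).
Proof.
  intros hd. split.
  - intros (T & hT & k). apply mtop_iff in hT; auto. now subst.
  - intros h. exists (mtop R X d). split; auto. now apply mtop_iff.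
Qed.

Definition scattered_unions : Prop := forall S X D U : V,
  well_orderable S -> is_family S X -> is_family S D ->
  (forall s x d, s ∈ S -> app X s x -> app D s d ->
     is_metric R x d /\ metric_scattered R x d /\ totally_bounded R x d) ->
  is_family_union S X U -> well_orderable U.

Lemma WOAC_fin_scattered_unions : @WOAC_fin V -> scattered_unions.
Proof.
  intros AC S X D U hS hX hD h hU. apply (scattered_union_well_orderable S X D U); auto.
  - intros s hs. destruct (h s (ap X s) (ap D s)) as (h1 & h2 & h3); eauto using family_ap.
    apply metric_scattered_iff in h2; auto.
  - intros x. rewrite (hU x). split.
    + intros (s & y & hs & hy & k). apply (family_app S) in hy; auto. subst. eauto.
    + intros (s & hs & k). exists s, (ap X s). eauto using family_ap.
Qed.

(** With the two-valued metric the finite members of [A] qualify as spaces. Their union is then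
    well-orderable, and taking least elements is a choice function. *)
Lemma scattered_unions_WOAC_fin : scattered_unions -> @WOAC_fin V.
Proof.
  intros H A hA hne hfin. destruct (unit_exists R) as [u hu].
  assert (idf : fun1 (fun c : V => c)) by df. assert (dmf : fun1 (dm R u)) by df.
  destruct (H A (lam A (fun a => a)) (lam A (dm R u)) (union A)) as [r hr]; auto using lam_family.
  - intros s x d hs hx hd. apply app_lam in hx as [_ ->]; auto. apply app_lam in hd as [_ ->]; auto.
    assert (m := dm_metric R u hu s). split; [exact m|split].
    + now apply dm_scattered.
    + apply totally_bounded_compact; auto. apply finite_compact. now apply hfin.
  - intros z. rewrite in_union. split.
    + intros (y & hy & hz). exists y, y. repeat split; auto. now apply app_lam.
    + intros (i & x & hi & hx & hz). apply app_lam in hx as [_ ->]; auto. eauto.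
  - exists (lam A (least_of r)). split; [apply lam_family; df|].
    intros x y hy. apply app_lam in hy as [hx ->]; [|df].
    apply (least_spec r (union A)); auto; [|now apply hfin]. intros z hz. apply in_union. eauto.
Qed.

End ScatteredUnions.

(** * Products *)

Section Products.
Context {V : ZF_model}.
Implicit Types A B C F G I S X T P TP O U W f g p s x y : V.

Lemma in_product I X P f : is_family I X -> is_product I X P ->
  (f ∈ P <-> is_family I f /\ forall i, i ∈ I -> ap f i ∈ ap X i).
Proof.
  intros hX hP. rewrite (hP f). split; intros [hf h]; split; auto.
  - intros i hi. apply (h i); auto; now apply (family_ap I).
  - intros i x y hi hx hy. apply (family_app I) in hx, hy; auto. subst. auto.
Qed.

Lemma product_exists I X : is_family I X -> exists P, is_product I X P.
Proof.
  intros hX. exists (sep (power (prod I (union (image I (ap X))))) (fun f => is_family I f /\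
    forall i x y, i ∈ I -> app X i x -> app f i y -> y ∈ x)).
  intros f. rewrite in_sep by df. split; [tauto|]. intros [hf h]. split; auto.
  apply in_power. intros q hq. destruct (proj1 hf q hq) as (i & y & hi & e). apply pair_iff in e. subst q.
  apply pair_in_prod. split; auto. apply in_union. exists (ap X i).
  rewrite in_image by df. split; [eauto|]. apply (h i _ y); auto; [now apply (family_ap I)|]. now apply app_iff.
Qed.

(** An intersection of topologies, which is a set because it is bounded by [power P]. The
    implication from compact products to [WOAC_fin] needs an actual product topology to which
    compactness can be applied. *)
Definition product_topology I T P : V :=
  sep (power P) (fun O => forall T', is_topology P T' -> projections_continuous I T P T' -> O ∈ T').

Lemma product_topology_spec I T P : is_product_topology I T P (product_topology I T P).
Proof.
  assert (hin : forall O, O ∈ product_topology I T P <-> O ⊆ P /\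
    forall T', is_topology P T' -> projections_continuous I T P T' -> O ∈ T').
  { intros O. unfold product_topology. rewrite in_sep by df. now rewrite in_power. }
  split; [|split].
  - split; [|split; [|split; [|split]]].
    + intros U hU. now apply hin in hU.
    + apply hin. split; [intros x; auto|]. intros T' h _. apply h.
    + exists zero. split; [|now apply empty_iff]. apply hin. split; [intros x hx; now apply in_zero in hx|].
      intros T' (_ & _ & (o & ho & k) & _) _. apply empty_iff in k. now subst.
    + intros A u hA hu. apply hin. split.
      * intros x hx. apply hu in hx as (y & hy & hx). apply hA, hin in hy as [hy _]. auto.
      * intros T' h k. assert (h' := h). destruct h' as (_ & _ & _ & h' & _). apply (h' A u); auto. intros W hW.
        apply hA, hin in hW as [_ hW]. auto.
    + intros U W c hU hW hc. apply hin in hU as [hU hU'], hW as [hW hW']. apply hin. split.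
      * intros x hx. apply hc in hx as [hx _]. auto.
      * intros T' h k. assert (h' := h). destruct h' as (_ & _ & _ & _ & h'). apply (h' U W c); auto.
  - intros i t U W hi ht hU hW. apply hin. split; [intros f hf; now apply hW in hf|].
    intros T' h k. now apply (k i t U W).
  - intros T' h k O hO. apply hin in hO as [_ hO]. auto.
Qed.

End Products.

(** * Compactness of products with a well-orderable union of factors *)

Section Tychonoff.
Context {V : ZF_model}.
Implicit Types A B C F G I S X T P TP O U W f g p s x y : V.

Definition cyl P s O : V := sep P (fun f => ap f s ∈ O).
Lemma in_cyl P s O f : f ∈ cyl P s O <-> f ∈ P /\ ap f s ∈ O.
Proof. unfold cyl. now rewrite in_sep by df. Qed.
Lemma fun3_cyl : fun3 cyl. Proof. unfold cyl. df. Qed.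
Hint Resolve fun3_cyl : dfdb.

(* The subbasic neighbourhoods, in the product [P], of the partial function with graph [p]. *)
Definition nbds S T P p : V := sep (power P) (fun C =>
  exists s x O, s ∈ S /\ pair s x ∈ p /\ O ∈ ap T s /\ x ∈ O /\ C = cyl P s O).
Lemma in_nbds S T P p C : C ∈ nbds S T P p <->
  exists s x O, s ∈ S /\ pair s x ∈ p /\ O ∈ ap T s /\ x ∈ O /\ C = cyl P s O.
Proof.
  unfold nbds. rewrite in_sep by df. rewrite in_power. split; [tauto|]. intros h; split; auto.
  destruct h as (s & x & O & _ & _ & _ & _ & ->). intros f hf. now apply in_cyl in hf.
Qed.
Lemma fun1_nbds S T P : fun1 (nbds S T P). Proof. unfold nbds. df. Qed.
Hint Resolve fun1_nbds : dfdb.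

Definition meet P G : V := sep P (fun f => forall C, C ∈ G -> f ∈ C).
Lemma in_meet P G f : f ∈ meet P G <-> f ∈ P /\ forall C, C ∈ G -> f ∈ C.
Proof. unfold meet. now rewrite in_sep by df. Qed.
Lemma fun2_meet : fun2 meet. Proof. unfold meet. df. Qed.
Hint Resolve fun2_meet : dfdb.

Definition finitely_covered A B : Prop := exists F, F ⊆ A /\ finite F /\ covers F B.
Lemma def2_finitely_covered : def2 finitely_covered. Proof. unfold finitely_covered. df. Qed.
Hint Resolve def2_finitely_covered : dfdb.

Lemma finitely_covered_subset A B C : C ⊆ B -> finitely_covered A B -> finitely_covered A C.
Proof. intros h (F & h1 & h2 & h3). exists F. repeat split; auto. intros x hx. auto. Qed.

Lemma finitely_covered_cup A B C D : finitely_covered A B -> finitely_covered A C ->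
  (forall x, x ∈ D -> x ∈ B \/ x ∈ C) -> finitely_covered A D.
Proof.
  intros (F & h1 & h2 & h3) (G & k1 & k2 & k3) h. exists (cup F G). repeat split.
  - intros W hW. apply in_cup in hW as [hW|hW]; auto.
  - now apply fin_cup.
  - intros x hx. destruct (h x hx) as [l|l]; [destruct (h3 x l) as (W & hW & m)|destruct (k3 x l) as (W & hW & m)];
      exists W; rewrite in_cup; auto.
Qed.

Section Fixed.
Context (S X T P TP : V).
Hypothesis hS : well_orderable S.
Hypothesis hX : is_family S X.
Hypothesis hP : is_product S X P.
Hypothesis hT : is_family S T.
Hypothesis T_full : forall s, s ∈ S -> ap X s ∈ ap T s.
Hypothesis T_cap : forall s O O', s ∈ S -> O ∈ ap T s -> O' ∈ ap T s -> cap O O' ∈ ap T s.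
Hypothesis T_compact : forall s, s ∈ S -> compact (ap X s) (ap T s).
Hypothesis X_union : well_orderable (union (image S (ap X))).
Hypothesis hTP : is_product_topology S T P TP.

(** The product topology is specified by minimality, not by a base. So the sets with the desired
    property are shown to form a topology with continuous projections, and minimality places [TP]
    inside it. *)
Lemma product_open_nbds W f : W ∈ TP -> f ∈ W -> exists G, finite G /\ G ⊆ nbds S T P f /\ meet P G ⊆ W.
Proof.
  destruct hTP as (_ & _ & hmin). intros hW hf.
  set (T' := sep (power P) (fun O => forall f, f ∈ O -> exists G, finite G /\ G ⊆ nbds S T P f /\ meet P G ⊆ O)).
  assert (hin : forall O, O ∈ T' <-> O ⊆ P /\
    forall f, f ∈ O -> exists G, finite G /\ G ⊆ nbds S T P f /\ meet P G ⊆ O).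
  { intros O. unfold T'. rewrite in_sep by df. now rewrite in_power. }
  clearbody T'.
  assert (top : is_topology P T').
  { split; [|split; [|split; [|split]]].
    - intros U hU. now apply hin in hU.
    - apply hin. split; [intros x; auto|]. intros g hg. exists zero. split; [apply fin_zero|]. split.
      + intros x hx. now apply in_zero in hx.
      + intros x hx. now apply in_meet in hx.
    - exists zero. split; [|now apply empty_iff]. apply hin. split; intros x hx; now apply in_zero in hx.
    - intros A u hA hu. apply hin. split.
      + intros x hx. apply hu in hx as (y & hy & hx). apply hA, hin in hy as [hy _]. auto.
      + intros x hx. apply hu in hx as (y & hy & hx). assert (hy' := hA _ hy). apply hin in hy' as [_ hy'].
        destruct (hy' x hx) as (G & h1 & h2 & h3). exists G. repeat split; auto.
        intros z hz. apply hu. eauto.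
    - intros U W' c hU hW' hc. apply hin in hU as [hU hU'], hW' as [hW' hW'']. apply hin. split.
      + intros x hx. apply hc in hx as [hx _]. auto.
      + intros x hx. apply hc in hx as [hx hx']. destruct (hU' x hx) as (G & h1 & h2 & h3), (hW'' x hx') as (G' & k1 & k2 & k3).
        exists (cup G G'). split; [now apply fin_cup|]. split.
        * intros z hz. apply in_cup in hz as [hz|hz]; auto.
        * intros z hz. apply in_meet in hz as [hz k]. apply hc. split; [apply h3|apply k3]; apply in_meet;
            split; auto; intros C hC; apply k; apply in_cup; auto. }
  assert (cont : projections_continuous S T P T').
  { intros i t U W' hi ht hU hW'. apply (family_app S) in ht; auto. subst t. apply hin. split.
    - intros g hg. now apply hW' in hg.
    - intros g hg. assert (hg' := hg). apply hW' in hg' as [hgP (y & hy & hyU)].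
      assert (hgf := hgP). apply (in_product S X) in hgf as [hgf _]; auto.
      exists (sing (cyl P i U)). split; [apply fin_sing|]. split.
      + intros C hC. apply in_sing in hC. subst C. apply in_nbds. exists i, y, U.
        repeat split; auto. now apply app_iff.
      + intros z hz. apply in_meet in hz as [hzP hz]. specialize (hz (cyl P i U)).
        rewrite in_sing in hz. specialize (hz eq_refl). apply in_cyl in hz as [_ hz].
        apply hW'. split; auto. exists (ap z i). split; auto. apply (family_ap S); auto.
        now apply (in_product S X) in hzP. }
  apply (hmin T' top cont), hin in hW as [_ hW]. auto.
Qed.

(* A maximal [bad] relation contains the graph of a point of the product. *)
Definition bad A p : Prop := forall G, finite G -> G ⊆ nbds S T P p -> ~ finitely_covered A (meet P G).

Lemma nbds_mono p q : p ⊆ q -> nbds S T P p ⊆ nbds S T P q.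
Proof.
  intros h C hC. apply in_nbds in hC as (s & x & O & h1 & h2 & h3). apply in_nbds. exists s, x, O. auto.
Qed.

(** If [p] had no value at [s], adjoining any [x] would destroy badness; then some open [O] around
    [x] and some basic neighbourhood of [p] would have the points [f] with [f(s)] in [O] finitely
    covered. Compactness of this one factor leaves finitely many [O], and intersecting the
    neighbourhoods contradicts badness of [p]. *)
Lemma bad_extension A p : bad A p ->
  (forall s x, s ∈ S -> x ∈ ap X s -> bad A (cup p (sing (pair s x))) -> pair s x ∈ p) ->
  forall s, s ∈ S -> exists x, x ∈ ap X s /\ pair s x ∈ p.
Proof.
  intros hbad hmax s hs. apply NNPP. intros hn.
  set (Q := fun B => exists G, finite G /\ G ⊆ nbds S T P p /\
    finitely_covered A (sep P (fun f => f ∈ meet P G /\ ap f s ∈ B))).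
  assert (Q_def : def1 Q) by (unfold Q; df).
  assert (local : forall x, x ∈ ap X s -> exists O, O ∈ ap T s /\ x ∈ O /\ Q O).
  { intros x hx.
    assert (h : ~ bad A (cup p (sing (pair s x)))) by (intros h; apply hn; eauto).
    assert (h' : exists G, finite G /\ G ⊆ nbds S T P (cup p (sing (pair s x))) /\ finitely_covered A (meet P G)).
    { apply NNPP. intros k. apply h. intros G h1 h2 h3. eauto. }
    destruct h' as (G & fG & hG & cG).
    (* The constraints in [G] are sorted: those due to [p] are kept in [G'], those due to the new
       pair are merged into one open set [O]. *)
    enough (K : exists O G', O ∈ ap T s /\ x ∈ O /\ finite G' /\ G' ⊆ nbds S T P p /\
      forall f, f ∈ meet P G' -> ap f s ∈ O -> f ∈ meet P G).
    { destruct K as (O & G' & h1 & h2 & h3 & h4 & h5). exists O. split; auto. split; auto. exists G'.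
      split; auto. split; auto. revert cG. apply finitely_covered_subset. intros f hf.
      rewrite in_sep in hf by df. destruct hf as (_ & hf & hf'). auto. }
    clear cG. revert G fG hG. apply (fin_ind (fun G => G ⊆ nbds S T P (cup p (sing (pair s x))) ->
      exists O G', O ∈ ap T s /\ x ∈ O /\ finite G' /\ G' ⊆ nbds S T P p /\
      forall f, f ∈ meet P G' -> ap f s ∈ O -> f ∈ meet P G)); [df| |].
    - intros _. exists (ap X s), zero. repeat split; auto; [apply fin_zero|intros z hz; now apply in_zero in hz].
    - intros G C fG IH _ hG. destruct IH as (O & G' & h1 & h2 & h3 & h4 & h5).
      { intros z hz. apply hG. rewrite in_cup. auto. }
      assert (hC : C ∈ nbds S T P (cup p (sing (pair s x)))). { apply hG. rewrite in_cup, in_sing. auto. }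
      apply in_nbds in hC as (s' & x' & O' & k1 & k2 & k3 & k4 & ->).
      rewrite in_cup, in_sing in k2. destruct k2 as [k2|k2].
      + exists O, (cup G' (sing (cyl P s' O'))). split; auto. split; auto. split; [now apply fin_add|]. split.
        * intros z hz. rewrite in_cup, in_sing in hz. destruct hz as [hz| ->]; auto.
          apply in_nbds. eauto 10.
        * intros f hf hfO. apply in_meet in hf as [hf k]. apply in_meet. split; auto.
          assert (l : f ∈ meet P G). { apply h5; auto. apply in_meet. split; auto. intros D hD. apply k. rewrite in_cup; auto. }
          apply in_meet in l as [_ l]. intros D hD. rewrite in_cup, in_sing in hD. destruct hD as [hD| ->]; auto.
          apply k. rewrite in_cup, in_sing. auto.
      + apply pair_inj in k2 as [-> ->]. exists (cap O O'), G'. split; auto. split; [now apply in_cap|].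
        split; auto. split; auto. intros f hf hfO. apply in_cap in hfO as [m m'].
        assert (l := h5 f hf m). apply in_meet in l as [l l']. apply in_meet. split; auto.
        intros D hD. rewrite in_cup, in_sing in hD. destruct hD as [hD| ->]; auto. now apply in_cyl. }
  destruct (T_compact s hs (sep (ap T s) Q)) as (F & hF & fF & cF).
  { intros O hO. rewrite in_sep in hO by df. tauto. }
  { intros x hx. destruct (local x hx) as (O & h1 & h2 & h3). exists O. rewrite in_sep by df. auto. }
  (* The neighbourhoods belonging to the finitely many [O] in [F] are accumulated by induction on
     [F], so that no function assigning them has to be chosen. *)
  enough (K : exists G, finite G /\ G ⊆ nbds S T P p /\
    finitely_covered A (sep P (fun f => f ∈ meet P G /\ exists O, O ∈ F /\ ap f s ∈ O))).
  { destruct K as (G & h1 & h2 & h3). apply (hbad G h1 h2). revert h3. apply finitely_covered_subset.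
    intros f hf. rewrite in_sep by df. split; [now apply in_meet in hf|]. split; auto.
    apply cF. apply in_meet in hf as [hf _]. apply (in_product S X) in hf as [_ hf]; auto. }
  assert (hF' : forall O, O ∈ F -> Q O).
  { intros O hO. apply hF in hO. rewrite in_sep in hO by df. tauto. }
  clear cF hF. revert F fF hF'. unfold Q. apply (fin_ind (fun F => (forall O, O ∈ F -> exists G, finite G /\ G ⊆ nbds S T P p /\
    finitely_covered A (sep P (fun f => f ∈ meet P G /\ ap f s ∈ O))) -> exists G, finite G /\ G ⊆ nbds S T P p /\
    finitely_covered A (sep P (fun f => f ∈ meet P G /\ exists O, O ∈ F /\ ap f s ∈ O)))); [df| |].
  - intros _. exists zero. split; [apply fin_zero|]. split; [intros z hz; now apply in_zero in hz|].
    exists zero. split; [intros z hz; now apply in_zero in hz|]. split; [apply fin_zero|].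
    intros f hf. rewrite in_sep in hf by df. destruct hf as (_ & _ & O & hO & _). now apply in_zero in hO.
  - intros F O _ IH _ hF. destruct IH as (G & h1 & h2 & h3).
    { intros O' hO'. apply hF. rewrite in_cup. auto. }
    destruct (hF O) as (G' & k1 & k2 & k3). { rewrite in_cup, in_sing. auto. }
    assert (mono : forall f, f ∈ meet P (cup G G') -> f ∈ meet P G /\ f ∈ meet P G').
    { intros f hf. apply in_meet in hf as [hf k]. rewrite !in_meet. repeat split; auto; intros C hC; apply k; rewrite in_cup; auto. }
    exists (cup G G'). split; [now apply fin_cup|]. split.
    { intros z hz. apply in_cup in hz as [hz|hz]; auto. }
    apply (finitely_covered_cup _ _ _ _ h3 k3). intros f hf. rewrite !in_sep by df.
    rewrite in_sep in hf by df. destruct hf as (hfP & hf & O' & hO' & l).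
    apply mono in hf as [m m']. rewrite in_cup, in_sing in hO'. destruct hO' as [hO'| ->]; [left|right]; eauto 6.
Qed.

Lemma product_compact : compact P TP.
Proof.
  intros A hA hcov. apply NNPP. intros hn. change (~ finitely_covered A P) in hn.
  destruct (zorn_well_orderable (prod S (union (image S (ap X)))) (bad A)) as (p & hp & hbad & hmax).
  - now apply well_orderable_prod.
  - unfold bad. df.
  - intros B hBb hch G fG hG.
    (* Finitely many neighbourhoods of the union of a chain already belong to one of its members.
       For the empty chain there are none, the intersection is [P], and badness is the assumption
       that [A] has no finite subcover. *)
    destruct (classic (nonempty B)) as [hB|hB].
    + destruct (fin_directed (fun C p => C ∈ nbds S T P p) G B) as (q & hq & k); auto.
      * df.
      * intros a b ha hb. destruct (hch a b ha hb) as [l|l]; [exists b|exists a]; split; auto; intros x [m|m]; auto;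
          now apply (nbds_mono _ _ l).
      * intros C hC. apply hG, in_nbds in hC as (s & x & O & h1 & h2 & h3). apply in_union in h2 as (q & hq & h2).
        exists q. split; auto. apply in_nbds. exists s, x, O. auto.
      * intros hc. destruct (hBb q hq) as [_ hb]. apply (hb G); auto.
    + intros hc. apply hn. revert hc. apply finitely_covered_subset. intros f hf. apply in_meet. split; auto.
      intros C hC. apply hG, in_nbds in hC as (s & x & O & _ & h2 & _). apply in_union in h2 as (q & hq & _).
      exfalso. apply hB. now exists q.
  - assert (htot : forall s, s ∈ S -> exists x, x ∈ ap X s /\ pair s x ∈ p).
    { apply (bad_extension A); auto. intros s x hs hx hb. apply hmax; auto. apply pair_in_prod. split; auto.
      apply in_union. exists (ap X s). split; auto. rewrite in_image by df. eauto. }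
    destruct X_union as [r hr].
    (* [p] is so far only a relation with at least one value at each index; the well-order of the
       union selects one, which gives a point of [P] whose graph lies in [p]. *)
    set (ch := fun s => least_of r (sep (ap X s) (fun x => pair s x ∈ p))).
    assert (ch_def : fun1 ch) by (unfold ch; df).
    assert (hch : forall s, s ∈ S -> ch s ∈ ap X s /\ pair s (ch s) ∈ p).
    { intros s hs. destruct (htot s hs) as (x & hx & hxp).
      enough (K : ch s ∈ sep (ap X s) (fun x => pair s x ∈ p)) by (rewrite in_sep in K by df; auto).
      apply (least_spec r _ _ hr).
      - intros y hy. rewrite in_sep in hy by df. apply in_union. exists (ap X s). split; [|tauto].
        rewrite in_image by df. eauto.
      - exists x. rewrite in_sep by df. auto. }
    clearbody ch.
    assert (hf : lam S ch ∈ P).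
    { apply (in_product S X); auto. split; [now apply lam_family|]. intros i hi. rewrite ap_lam; auto. now apply hch. }
    (* This point belongs to some [W] in the cover. A basic neighbourhood of it inside [W] is
       covered by [W] alone, although its constraints come from [p]. *)
    destruct (hcov _ hf) as (W & hW & hfW). destruct (product_open_nbds W (lam S ch)) as (G & fG & hG & k); auto.
    apply (hbad G fG).
    + intros C hC. apply (nbds_mono (lam S ch)); auto. intros q hq. unfold lam in hq. rewrite in_image in hq by df.
      destruct hq as (s & hs & ->). now apply hch.
    + exists (sing W). split; [intros z hz; apply in_sing in hz; now subst|]. split; [apply fin_sing|].
      intros f h. exists W. split; auto. now apply in_sing.
Qed.

End Fixed.
End Tychonoff.
Global Hint Resolve fun3_cyl : dfdb.

(** * Equivalence of [WOAC_fin] with compactness of products *)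

Section CompactProducts.
Context {V : ZF_model} (R : complete_ordered_field V).

Definition compact_products : Prop := forall S X D T P TP : V,
  well_orderable S -> nonempty S -> is_family S X -> is_family S D ->
  (forall s x d, s ∈ S -> app X s x -> app D s d ->
     is_metric R x d /\ metric_compact R x d /\ metric_scattered R x d) ->
  is_family S T ->
  (forall s x d t, s ∈ S -> app X s x -> app D s d -> app T s t -> is_metric_topology R x d t) ->
  is_product S X P -> is_product_topology S T P TP -> compact P TP.

Lemma WOAC_fin_compact_products : @WOAC_fin V -> compact_products.
Proof.
  intros AC S X D T P TP hS _ hX hD h hT ht hP hTP.
  assert (h' : forall s, s ∈ S -> is_metric R (ap X s) (ap D s) /\ compact (ap X s) (mtop R (ap X s) (ap D s)) /\
    scattered (ap X s) (mtop R (ap X s) (ap D s)) /\ ap T s = mtop R (ap X s) (ap D s)).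
  { intros s hs. destruct (h s (ap X s) (ap D s)) as (h1 & h2 & h3); eauto using family_ap.
    apply metric_compact_iff in h2; auto. apply metric_scattered_iff in h3; auto. split; [exact h1|]. split; auto. split; auto.
    apply mtop_iff; auto. apply (ht s); eauto using family_ap. }
  apply (product_compact S X T P TP); auto.
  - intros s hs. destruct (h' s hs) as (h1 & _ & _ & ->). now apply mtop_full.
  - intros s O O' hs. destruct (h' s hs) as (h1 & _ & _ & ->). now apply mtop_cap.
  - intros s hs. destruct (h' s hs) as (h1 & h2 & _ & ->). auto.
  - apply (scattered_union_well_orderable R S X D); auto.
    + intros s hs. destruct (h' s hs) as (h1 & h2 & h3 & _). split; auto. split; auto.
      now apply totally_bounded_compact.
    + intros x. rewrite in_union. split.
      * intros (y & hy & hx). rewrite in_image in hy by df. destruct hy as (s & hs & ->). eauto.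
      * intros (s & hs & hx). exists (ap X s). rewrite in_image by df. eauto.
Qed.

(* The value [inf] adjoined to each member makes the product non-empty; the sets "f(a) = inf" then
   cover the product unless some [f] avoids [inf], that is, unless some [f] is a choice function. *)
Lemma compact_products_WOAC_fin : compact_products -> @WOAC_fin V.
Proof.
  intros H A hA hne hfin. destruct (unit_exists R) as [u hu].
  (* If [inf] belonged to a member of [A], it would belong to its own union and so to itself,
     against Foundation. One extra point thus serves all members of [A]. *)
  set (inf := union A).
  assert (hinf : forall a, a ∈ A -> ~ inf ∈ a).
  { intros a ha k. apply (mem_irrefl inf). apply in_union. eauto. }
  clearbody inf.
  set (Y := fun a => cup a (sing inf)).
  assert (Y_def : fun1 Y) by (unfold Y; df).
  assert (in_Y : forall a y, y ∈ Y a <-> y ∈ a \/ y = inf).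
  { intros a y. unfold Y. now rewrite in_cup, in_sing. }
  assert (Y_fin : forall a, a ∈ A -> finite (Y a)) by (intros a ha; apply fin_add; now apply hfin).
  clearbody Y.
  assert (hX : is_family A (lam A Y)) by now apply lam_family.
  destruct (product_exists A (lam A Y) hX) as [P hP].
  assert (dY : fun1 (fun a => dm R u (Y a))) by df.
  assert (tY : fun1 (fun a => mtop R (Y a) (dm R u (Y a)))) by df.
  set (T := lam A (fun a => mtop R (Y a) (dm R u (Y a)))).
  assert (inP : forall f, f ∈ P <-> is_family A f /\ forall a, a ∈ A -> ap f a ∈ Y a).
  { intros f. rewrite (in_product A (lam A Y)); auto.
    split; intros [h k]; split; auto; intros a ha; specialize (k a ha); rewrite ap_lam in *; auto. }
  assert (hTP := product_topology_spec A T P). set (TP := product_topology A T P) in *. clearbody TP.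
  assert (comp : compact P TP).
  { apply (H A (lam A Y) (lam A (fun a => dm R u (Y a))) T); auto; try now apply lam_family.
    - intros s x d hs hx hd. apply app_lam in hx as [_ ->]; auto. apply app_lam in hd as [_ ->]; auto.
      assert (m := dm_metric R u hu (Y s)). split; [exact m|split].
      + apply dm_compact; auto.
      + now apply dm_scattered.
    - intros s x d t hs hx hd ht. apply app_lam in hx as [_ ->]; auto. apply app_lam in hd as [_ ->]; auto.
      apply app_lam in ht as [_ ->]; auto. apply mtop_iff; auto. now apply dm_metric. }
  apply NNPP. intros nochoice.
  destruct (comp (image A (fun a => cyl P a (sing inf)))) as (G & hG & fG & cG).
  - intros W hW. rewrite in_image in hW by df. destruct hW as (a & ha & ->).
    destruct hTP as (_ & cont & _). apply (cont a (mtop R (Y a) (dm R u (Y a))) (sing inf)); auto.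
    + now apply app_lam.
    + apply dm_mtop; auto. intros z hz. apply in_sing in hz. apply in_Y. auto.
    + intros f. rewrite in_cyl, in_sing. split; intros [hf k]; split; auto; apply inP in hf as [hf _].
      * exists inf. rewrite in_sing. split; auto. now apply (family_app A).
      * destruct k as (y & hy & k). apply in_sing in k. apply (family_app A) in hy; auto. congruence.
  - intros f hf. apply NNPP. intros hn. apply nochoice. exists f. apply inP in hf as [hf k]. split; auto.
    intros a y hy. assert (ha := family_dom _ _ _ _ hf hy). apply (family_app A) in hy; auto. subst y.
    destruct (proj1 (in_Y _ _) (k a ha)) as [l|l]; auto. exfalso. apply hn. exists (cyl P a (sing inf)).
    rewrite in_image by df. split; [eauto|]. apply in_cyl. rewrite in_sing. split; auto. apply inP. auto.
  - enough (K : exists f, f ∈ P /\ forall W, W ∈ G -> ~ f ∈ W).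
    { destruct K as (f & hf & k). destruct (cG f hf) as (W & hW & l). now apply (k W). }
    (* A point outside finitely many cylinders is built by induction: starting from the constant
       [inf], one coordinate at a time is moved into its member of [A], so that a single element is
       picked at each step. *)
    clear cG. revert G fG hG. apply (fin_ind (fun G => G ⊆ image A (fun a => cyl P a (sing inf)) ->
      exists f, f ∈ P /\ forall W, W ∈ G -> ~ f ∈ W)); [df| |].
    + intros _. exists (lam A (fun _ => inf)). split; [|intros W hW; now apply in_zero in hW].
      apply inP. split; [apply lam_family; df|]. intros a ha. rewrite ap_lam by (auto; df). apply in_Y; auto.
    + intros G W _ IH _ hG. destruct IH as (f & hf & k). { intros z hz. apply hG. rewrite in_cup; auto. }
      assert (hW : W ∈ image A (fun a => cyl P a (sing inf))). { apply hG. rewrite in_cup, in_sing; auto. }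
      rewrite in_image in hW by df. destruct hW as (a & ha & ->).
      destruct (hfin a ha) as [[y0 hy0] _].
      (* [f] altered at [a] only, written by definite description to stay definable. As [y0] lies in
         [a], it differs from [inf], so the cylinders avoided before are still avoided. *)
      set (v := fun b => the (fun y => (b = a /\ y = y0) \/ (b <> a /\ y = ap f b))).
      assert (v_def : fun1 v) by (unfold v; df).
      assert (va : v a = y0) by (apply the_eq; [auto | intros z [[_ h]|[h _]]; congruence]).
      assert (vb : forall b, b <> a -> v b = ap f b).
      { intros b n. apply the_eq; [auto | intros z [[h _]|[_ h]]; congruence]. }
      clearbody v. apply inP in hf as [hf hf'].
      assert (hv : forall b, b ∈ A -> v b ∈ Y b).
      { intros b hb. destruct (classic (b = a)) as [->|n]; [rewrite va; apply in_Y; auto | rewrite vb; auto]. }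
      assert (hva : forall b, b ∈ A -> ap f b <> inf -> v b <> inf).
      { intros b hb n. destruct (classic (b = a)) as [->|m]; [|rewrite vb; auto].
        rewrite va. intros ->. now apply (hinf a). }
      exists (lam A v). split.
      * apply inP. split; [now apply lam_family|]. intros b hb. rewrite ap_lam; auto.
      * intros W hW hvW. rewrite in_cup, in_sing in hW. destruct hW as [hW| ->].
        -- assert (hW' : W ∈ image A (fun a => cyl P a (sing inf))) by (apply hG; rewrite in_cup; auto).
           rewrite in_image in hW' by df. destruct hW' as (b & hb & ->).
           apply in_cyl in hvW as [_ hvW]. rewrite in_sing, ap_lam in hvW; auto.
           apply (hva b hb); auto. intros e. apply (k _ hW). apply in_cyl. rewrite in_sing. split; auto. now apply inP.
        -- apply in_cyl in hvW as [_ hvW]. rewrite in_sing, ap_lam in hvW; auto.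
           apply (hinf a ha). congruence.
Qed.

End CompactProducts.

Theorem theorem4p7 (V : ZF_model) (R : complete_ordered_field V) :
  (* (a) *)
  (forall I X T : V,
     nonempty I -> is_family I X -> is_family I T ->
     (forall i x t, i ∈ I -> app X i x -> app T i t ->
        denumerable x /\ metrizable R x t /\ compact x t) ->
     has_multiple_choice_function I X)
  /\
  (* (b) *)
  (forall alpha X T S TS : V,
     is_ordinal alpha -> nonempty alpha ->
     is_family alpha X -> is_family alpha T ->
     (forall i j x y, i ∈ alpha -> j ∈ alpha -> i <> j ->
        app X i x -> app X j y -> disjoint x y) ->
     (forall i x t, i ∈ alpha -> app X i x -> app T i t ->
        nonempty x /\ countable x /\ compact x t /\ metrizable R x t) ->
     is_direct_sum alpha X T S TS ->
     weakly_loeb S TS)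
  /\
  (* (c): (i) <-> (ii) and (i) <-> (iii) *)
  (@WOAC_fin V <->
   forall S X D U : V,
     well_orderable S -> is_family S X -> is_family S D ->
     (forall s x d, s ∈ S -> app X s x -> app D s d ->
        is_metric R x d /\ metric_scattered R x d /\ totally_bounded R x d) ->
     is_family_union S X U ->
     well_orderable U)
  /\
  (@WOAC_fin V <->
   forall S X D T P TP : V,
     well_orderable S -> nonempty S -> is_family S X -> is_family S D ->
     (forall s x d, s ∈ S -> app X s x -> app D s d ->
        is_metric R x d /\ metric_compact R x d /\ metric_scattered R x d) ->
     is_family S T ->
     (forall s x d t, s ∈ S -> app X s x -> app D s d -> app T s t ->
        is_metric_topology R x d t) ->
     is_product S X P -> is_product_topology S T P TP ->
     compact P TP).
Proof.
  split; [|split; [|split]].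
  - intros I X T _. apply denumerable_compact_multiple_choice.
  - intros al X T S TS hal _ hX hT _. apply (direct_sum_weakly_loeb R al X T); auto. apply hal.
  - split; [apply (WOAC_fin_scattered_unions R) | apply (scattered_unions_WOAC_fin R)].
  - split; [apply (WOAC_fin_compact_products R) | apply (compact_products_WOAC_fin R)].
Qed.
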